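(* Let $1\le p<\infty$ and $\alpha>-2$. Let $\mu$ be a finite positive Borel measure on $[0,1)$. The Cesàro-like operator $\mathcal{C}_\mu$ is compact on $AT_p^\infty(\alpha)$ if and only if $\mu$ is a vanishing Carleson measure.
   Context: $\mathbb{D}$ is the open unit disk in $\mathbb{C}$, $\mathbb{T}$ its boundary, $H(\mathbb{D})$ the set of analytic functions on $\mathbb{D}$, and $dA=\frac1\pi\,dx\,dy$ the normalized area measure on $\mathbb{D}$. Fix $\zeta>\frac12$ and for $\eta\in\mathbb{T}$ let $\Gamma(\eta)=\Gamma_\zeta(\eta)=\{z\in\mathbb{D}:|z-\eta|<\zeta(1-|z|^2)\}$. For $re^{i\theta}\in\mathbb{D}\setminus\{0\}$ let $S(re^{i\theta})=\{\lambda e^{it}:|t-\theta|\le\frac{1-r}{2},\ 1-\lambda\le 1-r\}$ (a subset of $\mathbb{D}$), and $S(0)=\mathbb{D}$. For $0<p<\infty$, the tent space $T_p^\infty(\alpha)$ consists of all measurable functions $f$ on $\mathbb{D}$ with $$\|f\|_{T_p^\infty(\alpha)}^p=\operatorname*{ess\,sup}_{\eta\in\mathbb{T}}\left(\sup_{u\in\Gamma(\eta)}\frac{1}{1-|u|^2}\int_{S(u)}|f(z)|^p(1-|z|^2)^{\alpha+1}\,dA(z)\right)<\infty.$$ The Hardy-Carleson type tent space is $AT_p^\infty(\alpha)=T_p^\infty(\alpha)\cap H(\mathbb{D})$, with $\|f\|_{AT_p^\infty(\alpha)}=\|f\|_{T_p^\infty(\alpha)}$. For a finite positive Borel measure $\mu$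 on $[0,1)$ with moments $\mu_n=\int_0^1t^n\,d\mu(t)$, the Cesàro-like operator $\mathcal{C}_\mu$ is defined for $f(z)=\sum_{n\ge0}a_nz^n\in H(\mathbb{D})$ by $$\mathcal{C}_\mu(f)(z)=\sum_{n=0}^\infty\left(\mu_n\sum_{k=0}^na_k\right)z^n=\int_0^1\frac{f(tz)}{1-tz}\,d\mu(t),\quad z\in\mathbb{D}.$$ The measure $\mu$ on $[0,1)$ is a vanishing Carleson measure (i.e. vanishing $1$-Carleson measure) if $\lim_{t\to1^-}\frac{\mu([t,1))}{1-t}=0$. *)

(* Defs.v *)
From HB Require Import structures.
From mathcomp Require Import all_boot all_order all_algebra.
From mathcomp Require Import all_classical all_reals all_analysis.
From mathcomp Require Import ess_sup_inf.
From mathcomp Require Export complex.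

Set Implicit Arguments.
Unset Strict Implicit.
Unset Printing Implicit Defensive.
Import Order.TTheory GRing.Theory Num.Theory.
Import numFieldNormedType.Exports.

Local Open Scope classical_set_scope.
Local Open Scope ring_scope.
Local Open Scope complex_scope.

(* The library norm on R[i] takes values in R[i]; [modulus] is R-valued. *)
Definition modulus (R : realType) (z : R[i]) : R := ComplexField.Normc.normc z.

Definition cis (R : realType) (t : R) : R[i] := cos t +i* sin t.

Definition of_plane (R : realType) (w : R * R) : R[i] := w.1 +i* w.2.

Definition disk (R : realType) : set R[i] := [set z | modulus z < 1].

(* Functions on the disk are represented by total functions R[i] -> R[i].
   Every definition below depends only on their values on [disk]. *)

(* [R[i]^o] is the alias of R[i] that carries its norm topology. *)
Definition sums_to (R : realType) (u : nat -> R[i]) (s : R[i]) : Prop :=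
  series (u : nat -> R[i]^o) @ \oo --> (s : R[i]^o).

Definition analytic_at (R : realType) (f : R[i] -> R[i]) (z0 : R[i]) : Prop :=
  exists a : nat -> R[i],
    \forall z \near (z0 : R[i]^o), sums_to (fun n => a n * (z - z0) ^+ n) (f z).

Definition analytic (R : realType) : set (R[i] -> R[i]) :=
  [set f | forall z, disk z -> analytic_at f z].

Lemma pi_inv_ge0 (R : realType) : 0 <= (pi : R)^-1.
Proof. by rewrite invr_ge0 pi_ge0. Qed.

Definition area (R : realType) :
    {measure set (measurableTypeR R * measurableTypeR R)%type -> \bar R} :=
  mscale (NngNum (pi_inv_ge0 R)) (@lebesgue_measure R \x @lebesgue_measure R)%E.

(* Arc length on the circle, in the angle parameter t |-> cis t. *)
Definition arc_length (R : realType) :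
    {measure set (measurableTypeR R) -> \bar R} :=
  mrestr (@lebesgue_measure R) (measurable_itv `[0, pi *+ 2[).

Definition Gamma (R : realType) (zeta : R) (eta : R[i]) : set R[i] :=
  [set z | disk z /\ modulus (z - eta) < zeta * (1 - modulus z ^+ 2)].

(* For u != 0 the choice of the argument theta of u is immaterial. *)
Definition carleson_box (R : realType) (u : R[i]) : set R[i] :=
  if u == 0 then @disk R else
  [set z | exists theta t lambda : R,
     [/\ u = (modulus u)%:C * cis theta,
         z = lambda%:C * cis t,
         `|t - theta| <= (1 - modulus u) / 2,
         1 - lambda <= 1 - modulus u
       & lambda < 1]].

Definition tent_norm (R : realType) (zeta p alpha : R) (f : R[i] -> R[i]) :
    \bar R :=
  ((ess_sup (arc_length R) (fun t : measurableTypeR R =>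
     ereal_sup
      [set ((1 - modulus u ^+ 2)^-1)%:E *
           \int[area R]_(w in [set w : R * R | carleson_box u (of_plane w)])
             (modulus (f (of_plane w)) `^ p *
              (1 - modulus (of_plane w) ^+ 2) `^ (alpha + 1))%:E
      | u in Gamma zeta (cis t)])) `^ p^-1)%E.

Definition measurable_on_disk (R : realType) (f : R[i] -> R[i]) : Prop :=
  let D := [set w : measurableTypeR R * measurableTypeR R
           | disk (of_plane w)] in
  measurable_fun D
    ((fun w => complex.Re (f (of_plane w))) :
      measurableTypeR R * measurableTypeR R -> measurableTypeR R) /\
  measurable_fun D
    ((fun w => complex.Im (f (of_plane w))) :
      measurableTypeR R * measurableTypeR R -> measurableTypeR R).

Definition tent_space (R : realType) (zeta p alpha : R) :
    set (R[i] -> R[i]) :=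
  [set f | measurable_on_disk f /\ (tent_norm zeta p alpha f < +oo)%E].

Definition AT (R : realType) (zeta p alpha : R) : set (R[i] -> R[i]) :=
  tent_space zeta p alpha `&` @analytic R.

(* The coefficients a_n of the expansion f(z) = sum_n a_n z^n on the disk; they
   exist and are unique when f is analytic on the disk. *)
Definition taylor_coef (R : realType) (f : R[i] -> R[i]) : nat -> R[i] :=
  xget (fun=> 0) [set a : nat -> R[i] |
    forall z, disk z -> sums_to (fun n => a n * z ^+ n) (f z)].

Definition moment (R : realType)
    (mu : {finite_measure set (measurableTypeR R) -> \bar R}) (n : nat) : R :=
  (\int[mu]_(t in `[0%R, 1%R[) (t ^+ n))%R.

Definition cesaro_like (R : realType)
    (mu : {finite_measure set (measurableTypeR R) -> \bar R})
    (f : R[i] -> R[i]) (z : R[i]) : R[i] :=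
  lim (series ((fun n =>
    (moment mu n)%:C * (\sum_(k < n.+1) taylor_coef f k) * z ^+ n)
      : nat -> R[i]^o) @ \oo).

(* T maps the normed space (X, N) into itself, and every bounded sequence has
   a subsequence whose image converges in norm to an element of X. *)
Definition compact_operator (R : realType) (X : set (R[i] -> R[i]))
    (N : (R[i] -> R[i]) -> \bar R) (T : (R[i] -> R[i]) -> (R[i] -> R[i])) :
    Prop :=
  (forall f, X f -> X (T f)) /\
  (forall f : nat -> (R[i] -> R[i]),
     (forall n, X (f n)) ->
     (exists M : R, forall n, (N (f n) <= M%:E)%E) ->
     exists (phi : nat -> nat) (g : R[i] -> R[i]),
       [/\ {homo phi : m n / (m < n)%N >-> (m < n)%N},
           X g
         & N (fun z => T (f (phi k)) z - g z) @[k --> \oo] --> 0%E]).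

Definition vanishing_carleson (R : realType)
    (mu : {finite_measure set (measurableTypeR R) -> \bar R}) : Prop :=
  fine (mu [set` `[t, 1[]) / (1 - t) @[t --> (1 : R)^'-] --> (0 : R).

(* Main.v *)
Require Import Defs.
From mathcomp Require Import all_boot all_order all_algebra.
From mathcomp Require Import all_classical all_reals all_analysis.
From mathcomp Require Import ess_sup_inf measurable_realfun ring lra zify.

(** Two facts about [N = tent_norm zeta p alpha], with [s = (alpha + 2) / p],
    reduce the theorem to inequalities between functions on the disk.

    First, [|F z| <= C * N F * (1 - |z|) ^ (- s)] for [F] analytic ([growth],
    [growth_disk]): [|F| ^ p] is subharmonic, and a disk around [z] of radius
    comparable to [1 - |z|] lies in a single Carleson box. Secondly, for
    [0 < beta < 1], a function dominated by
    [c * (1 - |z| ^ 2) ^ (- (s - beta / p)) * |1 - z| ^ (- beta / p)] has [N]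
    at most a multiple of [c] ([tent_norm_le]): the [p]-th power of this majorant
    times the weight of the space has integral at most proportional to
    [1 - |u|] on the box of [u] ([box_integral]).

    The operator satisfies the inequality
    [|C_mu h (z)| <= \int |h (t z)| / |1 - t z| dmu(t)] ([cesaro_le]). If [h] grows
    at the rate [s], then splitting this growth between [1 - |z|] and [1 - t], and
    comparing [|1 - t z|] with both [1 - t] and [|1 - z|], bounds the part of the
    integral on [`[rho, 1[] by a multiple of [eps] times the majorant as soon as
    [mu `[t, 1[ <= eps * (1 - t)] for [rho <= t] ([cesaro_split],
    [cesaro_majorant]). The part on [`[0, rho[] only depends on [h] on the disk of
    radius [rho].

    If [mu] is a vanishing Carleson measure, this makes the operator compact: a
    bounded sequence grows at a common rate, a subsequence converges uniformly on
    compact sets ([montel]), and both parts of the integral are small for the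
    differences ([vanishing_compact]).

    Conversely, the functions [(1 - x) ^ (m - s) / (1 - x z) ^ m] with [m >= s + 1]
    are bounded in norm, being dominated by the majorant. Their images tend to
    zero pointwise as [x] tends to [1], while positivity of all coefficients gives
    [|C_mu f (x)| >= c * mu `[x, 1[ / (1 - x) * (1 - x) ^ (- s)] ([cesaro_test_ge]).
    A norm limit of images must therefore vanish near the circle, and the growth
    bound at [x] forces [mu `[x, 1[ / (1 - x)] to zero ([compact_vanishing]).

    Power series are handled by their coefficients alone: discrete averages over
    roots of unity ([poly_coef_average]) give the Cauchy estimates and, with the
    rotation invariance of area, the sub-mean value inequality. *)

Set Implicit Arguments.
Unset Strict Implicit.
Unset Printing Implicit Defensive.
Import Order.TTheory GRing.Theory Num.Theory.
Import numFieldNormedType.Exports.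

Local Open Scope classical_set_scope.
Local Open Scope ring_scope.
Local Open Scope complex_scope.

(** * Modulus and convergence of complex sequences *)

Section modulus_theory.
Variable R : realType.
Implicit Types (z w : R[i]) (x y t : R) (n : nat).

Lemma modulus_ge0 z : 0 <= modulus z.
Proof. by case: z => a b; rewrite /modulus /= sqrtr_ge0. Qed.

Lemma modulus0 : modulus (0 : R[i]) = 0.
Proof. exact: ComplexField.Normc.normc0. Qed.

Lemma modulus1 : modulus (1 : R[i]) = 1.
Proof. exact: ComplexField.Normc.normc1. Qed.

Lemma modulusM z w : modulus (z * w) = modulus z * modulus w.
Proof. exact: ComplexField.Normc.normcM. Qed.

Lemma modulusV z : modulus z^-1 = (modulus z)^-1.
Proof. exact: ComplexField.Normc.normcV. Qed.

Lemma modulusX z n : modulus (z ^+ n) = modulus z ^+ n.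
Proof.
by elim: n => [|n IHn]; rewrite ?expr0 ?modulus1// !exprS modulusM IHn.
Qed.

Lemma modulusN z : modulus (- z) = modulus z.
Proof. exact: normcN. Qed.

Lemma modulusD z w : modulus (z + w) <= modulus z + modulus w.
Proof. exact: le_normcD. Qed.

Lemma modulusBC z w : modulus (z - w) = modulus (w - z).
Proof. by rewrite -modulusN opprB. Qed.

Lemma modulusB_triangle v z w : modulus (z - w) <= modulus (z - v) + modulus (v - w).
Proof. by rewrite (le_trans _ (modulusD _ _))// addrA subrK. Qed.

Lemma modulusB_ge z w : modulus z - modulus w <= modulus (z - w).
Proof. by rewrite lerBlDr (le_trans _ (modulusD _ _))// subrK. Qed.

Lemma modulus_eq0 z : modulus z = 0 -> z = 0.
Proof. exact: ComplexField.Normc.eq0_normc. Qed.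

Lemma modulus_gt0 z : (0 < modulus z) = (z != 0).
Proof.
rewrite lt_neqAle modulus_ge0 andbT; congr (~~ _); apply/eqP/eqP => [/esym|->].
  exact: modulus_eq0.
by rewrite modulus0.
Qed.

Lemma modulus_1B_gt0 z : modulus z < 1 -> 0 < modulus (1 - z).
Proof.
by move=> z1; rewrite (lt_le_trans _ (modulusB_ge _ _))// modulus1 subr_gt0.
Qed.

Lemma modulus_real x : modulus x%:C = `|x|.
Proof. by rewrite /modulus /= expr0n addr0 sqrtr_sqr. Qed.

Lemma sqr_modulus z : modulus z ^+ 2 = complex.Re z ^+ 2 + complex.Im z ^+ 2.
Proof. by case: z => a b; rewrite /modulus /= sqr_sqrtr// addr_ge0 ?sqr_ge0. Qed.

Lemma normr_Re_le z : `|complex.Re z| <= modulus z.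
Proof.
rewrite -(ler_pXn2r (ltn0Sn 1)) ?nnegrE ?modulus_ge0//.
by rewrite sqr_modulus real_normK ?num_real// lerDl sqr_ge0.
Qed.

Lemma normr_Im_le z : `|complex.Im z| <= modulus z.
Proof.
rewrite -(ler_pXn2r (ltn0Sn 1)) ?nnegrE ?modulus_ge0//.
by rewrite sqr_modulus real_normK ?num_real// lerDr sqr_ge0.
Qed.

Lemma modulus_le_ReIm z : modulus z <= `|complex.Re z| + `|complex.Im z|.
Proof.
rewrite -(ler_pXn2r (ltn0Sn 1)) ?nnegrE ?modulus_ge0 ?addr_ge0//.
rewrite sqr_modulus sqrrD !real_normK ?num_real//.
by rewrite lerD2r lerDl mulrn_wge0// mulr_ge0.
Qed.

Lemma modulus_sum (I : Type) (r : seq I) (P : pred I) (F : I -> R[i]) :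
  modulus (\sum_(i <- r | P i) F i) <= \sum_(i <- r | P i) modulus (F i).
Proof.
elim/big_rec2: _ => [|i y z _ le_zy]; first by rewrite modulus0.
by rewrite (le_trans (modulusD _ _))// lerD2l.
Qed.

Lemma modulus_cis t : modulus (cis t) = 1.
Proof. by rewrite /modulus /= cos2Dsin2 sqrtr1. Qed.

Lemma cisD x y : cis (x + y) = cis x * cis y.
Proof.
rewrite /cis cosD sinD; apply/eqP.
by rewrite eq_complex /= eqxx /= addrC.
Qed.

Lemma cis0 : cis (0 : R) = 1.
Proof. by rewrite /cis cos0 sin0. Qed.

Lemma cisMn t n : cis (t *+ n) = cis t ^+ n.
Proof.
by elim: n => [|n IHn]; rewrite ?mulr0n ?cis0// mulrS cisD IHn exprS.
Qed.

Lemma ReD z w : complex.Re (z + w) = complex.Re z + complex.Re w.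
Proof. by case: z w => [? ?] [? ?]. Qed.

Lemma ImD z w : complex.Im (z + w) = complex.Im z + complex.Im w.
Proof. by case: z w => [? ?] [? ?]. Qed.

Lemma ReN z : complex.Re (- z) = - complex.Re z.
Proof. by case: z. Qed.

Lemma ImN z : complex.Im (- z) = - complex.Im z.
Proof. by case: z. Qed.

Lemma ReB z w : complex.Re (z - w) = complex.Re z - complex.Re w.
Proof. by rewrite ReD ReN. Qed.

Lemma ImB z w : complex.Im (z - w) = complex.Im z - complex.Im w.
Proof. by rewrite ImD ImN. Qed.

Lemma Re_sum (I : Type) (r : seq I) (P : pred I) (F : I -> R[i]) :
  complex.Re (\sum_(i <- r | P i) F i) = \sum_(i <- r | P i) complex.Re (F i).
Proof. exact: (big_morph _ ReD). Qed.

Lemma Im_sum (I : Type) (r : seq I) (P : pred I) (F : I -> R[i]) :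
  complex.Im (\sum_(i <- r | P i) F i) = \sum_(i <- r | P i) complex.Im (F i).
Proof. exact: (big_morph _ ImD). Qed.

End modulus_theory.

Section complex_series.
Variable R : realType.
Implicit Types (u : nat -> R[i]) (s z w : R[i]).

(** Convergence in [R[i]] becomes a statement on a real sequence, to which
    squeezing and the order of [R] apply. *)
Lemma ccvgP u s : (u : nat -> R[i]^o) @ \oo --> (s : R[i]^o) <->
  modulus (u n - s) @[n --> \oo] --> 0.
Proof.
split.
- move=> /cvgrPdist_lt us; apply/cvgrPdist_lt => e e0.
  have := us e%:C; rewrite ltcR => /(_ e0); apply: filterS => n.
  rewrite normc_def ltcR sub0r normrN ger0_norm ?modulus_ge0// modulusBC.
  by rewrite /modulus; case: (s - u n).
- move=> /cvgrPdist_lt us; apply/cvgrPdist_lt => e e0.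
  have eE : e = (complex.Re e)%:C.
    by move: e0; rewrite ltcE /= => /andP[/eqP e0 _]; case: e e0 => a b /= ->.
  have := us (complex.Re e); rewrite -ltcR -eE => /(_ e0); apply: filterS => n.
  rewrite eE normc_def ltcR sub0r normrN ger0_norm ?modulus_ge0// modulusBC.
  by rewrite /modulus; case: (s - u n).
Qed.

Lemma sums_toP u s : sums_to u s <->
  modulus (\sum_(k < n) u k - s) @[n --> \oo] --> 0.
Proof. by rewrite -ccvgP /sums_to seriesEord. Qed.

Lemma ccvg_unique u s t :
  modulus (u n - s) @[n --> \oo] --> 0 -> modulus (u n - t) @[n --> \oo] --> 0 ->
  s = t.
Proof.
move=> /ccvgP us /ccvgP ut.
have H : hausdorff_space (R[i]^o) by exact: norm_hausdorff.
by rewrite -(cvg_lim H us) -(cvg_lim H ut).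
Qed.

Lemma sums_to_lim u s : sums_to u s ->
  lim (series (u : nat -> R[i]^o) @ \oo) = s.
Proof. by move=> us; apply: cvg_lim us; exact: norm_hausdorff. Qed.

Lemma squeeze0 (v w : nat -> R) : (\forall n \near \oo, 0 <= v n <= w n) ->
  w n @[n --> \oo] --> 0 -> v n @[n --> \oo] --> 0.
Proof.
by move=> vw w0; apply: (squeeze_cvgr vw _ w0); exact: cvg_cst.
Qed.

Lemma cvg_dist0P (v : nat -> R) l :
  v n @[n --> \oo] --> l <-> `|v n - l| @[n --> \oo] --> 0.
Proof.
split => [vl|vl]; first exact/norm_cvg0P/subr_cvg0.
exact/subr_cvg0/norm_cvg0P.
Qed.

Lemma ccvg_Re u s : modulus (u n - s) @[n --> \oo] --> 0 ->
  complex.Re (u n) @[n --> \oo] --> complex.Re s.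
Proof.
move=> us; apply/cvg_dist0P.
apply: squeeze0 us; apply: nearW => n; rewrite normr_ge0 /=.
by rewrite (le_trans _ (normr_Re_le _))//= ReB.
Qed.

Lemma ccvg_Im u s : modulus (u n - s) @[n --> \oo] --> 0 ->
  complex.Im (u n) @[n --> \oo] --> complex.Im s.
Proof.
move=> us; apply/cvg_dist0P.
apply: squeeze0 us; apply: nearW => n; rewrite normr_ge0 /=.
by rewrite (le_trans _ (normr_Im_le _))//= ImB.
Qed.

Lemma ccvg_ReIm u s :
  complex.Re (u n) @[n --> \oo] --> complex.Re s ->
  complex.Im (u n) @[n --> \oo] --> complex.Im s ->
  modulus (u n - s) @[n --> \oo] --> 0.
Proof.
move=> /cvg_dist0P uR /cvg_dist0P uI.
have : `|complex.Re (u n) - complex.Re s| + `|complex.Im (u n) - complex.Im s|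
    @[n --> \oo] --> 0 by rewrite -[0]addr0; exact: cvgD.
apply: squeeze0; apply: nearW => n.
by rewrite modulus_ge0 /= (le_trans (modulus_le_ReIm _))//= ReB ImB.
Qed.

Lemma ccvg_modulus u s : modulus (u n - s) @[n --> \oo] --> 0 ->
  modulus (u n) @[n --> \oo] --> modulus s.
Proof.
move=> us; apply/cvg_dist0P.
apply: squeeze0 us; apply: nearW => n; rewrite normr_ge0 /=.
by rewrite ler_norml modulusB_ge andbT lerNl opprB modulusBC modulusB_ge.
Qed.

End complex_series.

(** * Power series *)

Section summation.
Variable R : realType.
Implicit Types (u : nat -> R[i]) (v : nat -> R) (s z w : R[i]).

Definition tail v N : R := limn (series v) - \sum_(k < N) v k.

Lemma tail_cvg0 v : cvgn (series v) -> tail v n @[n --> \oo] --> 0.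
Proof.
move=> cv; rewrite /tail.
have h : \sum_(k < n) v k @[n --> \oo] --> limn (series v).
  by move: cv; rewrite seriesEord.
apply/cvg_dist0P; under eq_fun do rewrite subr0 distrC.
exact: (iffLR (cvg_dist0P _ _) h).
Qed.

Lemma sum_le_tail v N M : (forall n, 0 <= v n) -> cvgn (series v) ->
  \sum_(N <= k < M) v k <= tail v N.
Proof.
move=> v0 cv.
have ndv : nondecreasing_seq (series v).
  apply/nondecreasing_seqP => n; rewrite seriesEnat /= big_nat_recr//=.
  by rewrite lerDl.
have le m : \sum_(k < m) v k <= limn (series v).
  have := nondecreasing_cvgn_le ndv cv m; rewrite seriesEnat /=.
  by rewrite big_mkord.
have [MN|NM] := leqP M N; first by rewrite big_geq// subr_ge0.
rewrite lerBrDl -(big_mkord xpredT v) -big_cat_nat ?(ltnW NM)//=.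
by rewrite big_mkord.
Qed.

Lemma tail_ge0 v N : (forall n, 0 <= v n) -> cvgn (series v) -> 0 <= tail v N.
Proof.
by move=> v0 cv; have := @sum_le_tail v N N v0 cv; rewrite big_geq.
Qed.

Lemma modulus_cvg_le u s (B : R) (N : nat) :
  modulus (u n - s) @[n --> \oo] --> 0 ->
  (forall n, (N <= n)%N -> modulus (u n) <= B) -> modulus s <= B.
Proof.
move=> us uB; have us' := ccvg_modulus us.
rewrite -(cvg_lim (@Rhausdorff R) us').
apply: limr_le; first by apply/cvg_ex; exists (modulus s).
by exists N => // n /= Nn; exact: uB.
Qed.

Lemma sums_to_tail u v s N : (forall n, modulus (u n) <= v n) ->
  cvgn (series v) -> sums_to u s ->
  modulus (s - \sum_(k < N) u k) <= tail v N.
Proof.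
move=> uv cv /sums_toP us.
apply: (@modulus_cvg_le (fun n => \sum_(k < n) u k - \sum_(k < N) u k) _ _ N).
  by under eq_fun do rewrite opprB addrA subrK.
move=> n Nn; rewrite -!(big_mkord xpredT u) (big_cat_nat _ Nn)//= [X in X - _]addrC addrK.
rewrite (le_trans (modulus_sum _ _ _))// (le_trans _ (@sum_le_tail v N n _ cv))//.
  exact: ler_sum.
by move=> k; rewrite (le_trans (modulus_ge0 _) (uv k)).
Qed.

Lemma ex_sums_to u v : (forall n, modulus (u n) <= v n) ->
  cvgn (series v) -> exists s, sums_to u s.
Proof.
move=> uv cv.
have v0 n : 0 <= v n by rewrite (le_trans (modulus_ge0 _) (uv n)).
have cR : cvgn (series (fun n => complex.Re (u n))).
  apply: normed_cvg; apply: series_le_cvg cv => // n.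
    exact: normr_ge0.
  exact: le_trans (normr_Re_le _) (uv n).
have cI : cvgn (series (fun n => complex.Im (u n))).
  apply: normed_cvg; apply: series_le_cvg cv => // n.
    exact: normr_ge0.
  exact: le_trans (normr_Im_le _) (uv n).
exists (limn (series (fun n => complex.Re (u n))) +i*
   limn (series (fun n => complex.Im (u n)))).
apply/sums_toP; apply: ccvg_ReIm => /=.
  by under eq_fun do rewrite Re_sum; move: cR; rewrite seriesEord.
by under eq_fun do rewrite Im_sum; move: cI; rewrite seriesEord.
Qed.

Lemma ccvgD u1 u2 s1 s2 : modulus (u1 n - s1) @[n --> \oo] --> 0 ->
  modulus (u2 n - s2) @[n --> \oo] --> 0 ->
  modulus (u1 n + u2 n - (s1 + s2)) @[n --> \oo] --> 0.
Proof.
move=> h1 h2.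
have : modulus (u1 n - s1) + modulus (u2 n - s2) @[n --> \oo] --> 0.
  by rewrite -[0]addr0; exact: cvgD.
apply: squeeze0; apply: nearW => n; rewrite modulus_ge0 /=.
by rewrite (le_trans _ (modulusD _ _))// opprD addrACA.
Qed.

Lemma ccvgZ (c : R[i]) u s : modulus (u n - s) @[n --> \oo] --> 0 ->
  modulus (c * u n - c * s) @[n --> \oo] --> 0.
Proof.
move=> us; rewrite -(mulr0 (modulus c)).
by under eq_fun do rewrite -mulrBr modulusM; apply: cvgM => //; exact: cvg_cst.
Qed.

Lemma ccvg_sum (K : nat) (U : nat -> nat -> R[i]) (S : nat -> R[i]) :
  (forall k, modulus (U k n - S k) @[n --> \oo] --> 0) ->
  modulus (\sum_(k < K) U k n - \sum_(k < K) S k) @[n --> \oo] --> 0.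
Proof.
move=> US; elim: K => [|K IHK].
  by under eq_fun do rewrite !big_ord0 subr0 modulus0; exact: cvg_cst.
by under eq_fun do rewrite !big_ord_recr; exact: ccvgD.
Qed.

End summation.

Section power_series.
Variable R : realType.
Implicit Types (a b : nat -> R[i]) (f : R[i] -> R[i]) (z w : R[i]) (r rho : R).

Definition pseries a f rho :=
  forall z, modulus z < rho -> sums_to (fun n => a n * z ^+ n) (f z).

Definition powersum a z : R[i] :=
  lim (series ((fun n => a n * z ^+ n) : nat -> R[i]^o) @ \oo).

Lemma pseries_terms_bounded a f rho z : pseries a f rho -> modulus z < rho ->
  exists M, forall n, modulus (a n) * modulus z ^+ n <= M.
Proof.
move=> af zr; have /sums_toP fz := af z zr.
have /cvg_seq_bounded [M [_ bM]] : cvgn (fun n : nat =>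
    modulus (\sum_(k < n) a k * z ^+ k - f z)).
  by apply/cvg_ex; exists 0.
have {}bM n : modulus (\sum_(k < n) a k * z ^+ k - f z) <= M + 1.
  by apply: le_trans (ler_norm _) _; apply: bM => //; rewrite ltrDl.
exists ((M + 1) + (M + 1)) => n; rewrite -modulusX -modulusM.
have -> : a n * z ^+ n = \sum_(k < n.+1) a k * z ^+ k - f z
   - (\sum_(k < n) a k * z ^+ k - f z) by rewrite big_ord_recr /=; ring.
by rewrite (le_trans (modulusD _ _))// modulusN lerD.
Qed.

Lemma pseries_summable a f rho r : pseries a f rho -> 0 <= r < rho ->
  cvgn (series (fun n => modulus (a n) * r ^+ n)).
Proof.
move=> af /andP[r0 rrho]; pose r1 := (r + rho) / 2.
have r1r : r < r1 by rewrite /r1; lra.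
have r1rho : r1 < rho by rewrite /r1; lra.
have r10 : 0 < r1 by exact: le_lt_trans r1r.
have mr1 : modulus r1%:C = r1 by rewrite modulus_real gtr0_norm.
have q0 : 0 <= r / r1 by rewrite mulr_ge0 ?invr_ge0 ?(ltW r10).
have [M HM] : exists M, forall n, modulus (a n) * r1 ^+ n <= M.
  by have := @pseries_terms_bounded _ _ _ r1%:C af; rewrite mr1; exact.
apply: (@series_le_cvg _ _ (geometric M (r / r1))) => [n|n|n|].
- by rewrite mulr_ge0 ?modulus_ge0 ?exprn_ge0.
- rewrite /geometric /= mulr_ge0 ?exprn_ge0//.
  by rewrite (le_trans _ (HM 0%N))// mulr_ge0 ?modulus_ge0 ?exprn_ge0// ltW.
- rewrite /geometric /= expr_div_n mulrA -[X in X <= _]mulr1.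
  rewrite ler_pdivlMr ?exprn_gt0// mulr1 mulrAC ler_wpM2r ?exprn_ge0//.
- apply: is_cvg_geometric_series.
  by rewrite ger0_norm// ltr_pdivrMr ?mul1r.
Qed.

Definition psnorm a r n := modulus (a n) * r ^+ n.

Lemma psnorm_ge0 a r n : 0 <= r -> 0 <= psnorm a r n.
Proof. by move=> r0; rewrite mulr_ge0 ?modulus_ge0 ?exprn_ge0. Qed.

Lemma pseries_tail a f rho r z N : pseries a f rho -> modulus z <= r < rho ->
  modulus (f z - \sum_(k < N) a k * z ^+ k) <= tail (psnorm a r) N.
Proof.
move=> af /andP[zr rrho].
apply: (@sums_to_tail _ (fun n => a n * z ^+ n)).
- by move=> n; rewrite modulusM modulusX ler_wpM2l ?modulus_ge0// lerXn2r
    ?nnegrE ?modulus_ge0// (le_trans (modulus_ge0 _) zr).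
- by apply: pseries_summable af _; rewrite rrho (le_trans (modulus_ge0 _) zr).
- by apply: af; exact: le_lt_trans rrho.
Qed.

Lemma powersumP a rho :
  (forall r, 0 <= r < rho -> cvgn (series (psnorm a r))) ->
  pseries a (powersum a) rho.
Proof.
move=> Ha z zrho.
have [||s sz] := @ex_sums_to _ (fun n => a n * z ^+ n) (psnorm a (modulus z)).
- by move=> n; rewrite modulusM modulusX.
- by apply: Ha; rewrite modulus_ge0.
by rewrite /powersum (sums_to_lim sz).
Qed.

Lemma pseries_powersum a f rho z : pseries a f rho -> modulus z < rho ->
  powersum a z = f z.
Proof. by move=> af zr; rewrite /powersum (sums_to_lim (af z zr)). Qed.

Lemma pseriesW a f rho rho' : rho' <= rho -> pseries a f rho -> pseries a f rho'.
Proof. by move=> rr af z zr; apply: af; exact: lt_le_trans rr. Qed.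

Lemma pseries_eq a f g rho : (forall z, modulus z < rho -> f z = g z) ->
  pseries a f rho -> pseries a g rho.
Proof. by move=> fg af z zr; rewrite -fg//; exact: af. Qed.

Lemma pseriesB a b f g rho : pseries a f rho -> pseries b g rho ->
  pseries (fun n => a n - b n) (fun z => f z - g z) rho.
Proof.
move=> af bg z zr; apply/sums_toP.
have /sums_toP h1 := af z zr; have /sums_toP h2 := bg z zr.
have := ccvgD h1 (ccvgZ (-1) h2).
under eq_fun do rewrite !mulN1r -sumrB.
under [in X in _ -> X]eq_fun do under eq_bigr do rewrite mulrBl.
by [].
Qed.

(** The double series of general term [a n * 'C(n, k) * z0 ^ (n - k) * w ^ k]
    converges absolutely for [|z0| + |w| < rho], so that it may be summed in
    [n] first; the sums are the new coefficients [b k]. *)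
Lemma pseries_recenter a f rho z0 : pseries a f rho -> modulus z0 < rho ->
  exists b, pseries b (fun w => f (z0 + w)) (rho - modulus z0).
Proof.
move=> af z0rho.
pose t w n k : R[i] := (z0 ^+ (n - k) * w ^+ k) *+ 'C(n, k).
pose m (x : R) n k : R := (modulus z0 ^+ (n - k) * x ^+ k) *+ 'C(n, k).
have m_ge0 x n k : 0 <= x -> 0 <= m x n k.
  by move=> x0; rewrite mulrn_wge0// mulr_ge0 ?exprn_ge0// modulus_ge0.
have modt w n k : modulus (t w n k) = m (modulus w) n k.
  by rewrite /modulus /t /m normcMn -/(modulus _) modulusM !modulusX.
have m_out x n k : (n < k)%N -> m x n k = 0 by move=> nk; rewrite /m bin_small.
have m_sum x n : \sum_(k < n.+1) m x n k = (modulus z0 + x) ^+ n.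
  by rewrite exprDn.
have m_le x n k : 0 <= x -> m x n k <= (modulus z0 + x) ^+ n.
  move=> x0; have [kn|nk] := leqP k n; last first.
    by rewrite m_out// exprn_ge0 ?addr_ge0 ?modulus_ge0.
  rewrite -m_sum (bigD1 (Ordinal (kn : (k < n.+1)%N)))//= lerDl.
  by rewrite sumr_ge0// => i _; exact: m_ge0.
pose x0 := (rho - modulus z0) / 2.
have x0_gt0 : 0 < x0 by rewrite divr_gt0// subr_gt0.
have x0rho : 0 <= modulus z0 + x0 < rho.
  by have := modulus_ge0 z0; rewrite /x0; lra.
have ex_b k : exists s, sums_to (fun n => a n * t 1 n k) s.
  apply: (@ex_sums_to _ _ (fun n =>
      x0 ^- k * (modulus (a n) * (modulus z0 + x0) ^+ n))) => [n|].
    rewrite modulusM modt modulus1 mulrCA ler_wpM2l ?modulus_ge0//.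
    rewrite -(ler_pM2l (exprn_gt0 k x0_gt0)) mulrA mulfV ?expf_neq0 ?gt_eqF//.
    rewrite mul1r (le_trans _ (m_le x0 n k (ltW x0_gt0)))//.
    by rewrite /m expr1n mulr1 mulrnAr mulrC.
  have := pseries_summable af x0rho.
  exact: (is_cvg_seriesZ (k := x0 ^- k)).
have [b Hb] := choice ex_b; exists b => w wrho; apply/sums_toP.
pose r := modulus z0 + modulus w.
have rrho : 0 <= r < rho by rewrite addr_ge0 ?modulus_ge0//= /r; lra.
have cr := pseries_summable af rrho.
apply: squeeze0 (tail_cvg0 cr); apply: nearW => K; rewrite modulus_ge0 /=.
have /sums_toP h1 : sums_to (fun n => a n * (z0 + w) ^+ n) (f (z0 + w)).
  apply: af; rewrite (le_lt_trans (modulusD _ _))//.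
  by case/andP: rrho.
have h2 : modulus (\sum_(k < K) w ^+ k * \sum_(n < N) a n * t 1 n k
    - \sum_(k < K) w ^+ k * b k) @[N --> \oo] --> 0.
  apply: (@ccvg_sum _ _ (fun k N => w ^+ k * \sum_(n < N) a n * t 1 n k)
    (fun k => w ^+ k * b k)) => k.
  by have /sums_toP Hbk := Hb k; exact: ccvgZ.
have h3 := ccvgD h2 (ccvgZ (-1) h1).
rewrite (_ : \sum_(k < K) b k * w ^+ k - f (z0 + w) =
   \sum_(k < K) w ^+ k * b k + - 1 * f (z0 + w)); last first.
  by rewrite mulN1r; congr (_ - _); apply: eq_bigr => k _; rewrite mulrC.
apply: (modulus_cvg_le (N := K) h3) => N KN.
have -> : \sum_(k < K) w ^+ k * (\sum_(n < N) a n * t 1 n k) +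
   -1 * \sum_(n < N) a n * (z0 + w) ^+ n =
   \sum_(n < N) a n * (\sum_(k < K) t w n k - (z0 + w) ^+ n).
  rewrite mulN1r -sumrN; under eq_bigr do rewrite mulr_sumr.
  rewrite exchange_big -big_split /=; apply: eq_bigr => n _.
  rewrite mulrBr mulr_sumr; congr (_ - _); apply: eq_bigr => k _.
  by rewrite /t expr1n mulr1 mulrCA; congr (_ * _); rewrite mulrnAr mulrC.
have expw n : (z0 + w) ^+ n = \sum_(0 <= k < n.+1) t w n k.
  by rewrite exprDn big_mkord.
have tz n k : (n < k)%N -> t w n k = 0 by move=> nk; rewrite /t bin_small.
rewrite -(big_mkord xpredT (fun n => a n * (\sum_(k < K) t w n k - (z0 + w) ^+ n))).
rewrite (big_cat_nat _ KN)//= big_nat big1 ?add0r => [|n /andP[_ nK]]; last first.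
  rewrite -(big_mkord xpredT (t w n)) expw (big_cat_nat _ nK)//=.
  have -> : \sum_(n.+1 <= i < K) t w n i = 0.
    by rewrite big_nat big1// => k /andP[nk _]; exact: tz.
  by rewrite addr0 subrr mulr0.
apply: le_trans (@sum_le_tail _ _ K N _ cr); last first.
  by move=> n; apply: psnorm_ge0; case/andP: rrho.
rewrite (le_trans (modulus_sum _ _ _))// big_nat [leRHS]big_nat.
apply: ler_sum => n /andP[Kn _]; rewrite modulusM ler_wpM2l ?modulus_ge0//.
rewrite -(big_mkord xpredT (t w n)) expw (@big_cat_nat _ _ _ K 0 n.+1)//=; last first.
  exact: leqW.
rewrite opprD addNKr modulusN (le_trans (modulus_sum _ _ _))//.
rewrite -m_sum -(big_mkord xpredT (m (modulus w) n)).
rewrite (@big_cat_nat _ _ _ K 0 n.+1)//=; last exact: leqW.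
under eq_bigr do rewrite modt.
by rewrite lerDr sumr_ge0// => k _; rewrite m_ge0// modulus_ge0.
Qed.

End power_series.

Lemma cvg0Ml (R : realType) (c : R) (v : nat -> R) :
  v n @[n --> \oo] --> 0 -> c * v n @[n --> \oo] --> 0.
Proof.
by move=> v0; rewrite -[0](mulr0 c); apply: cvgM => //; exact: cvg_cst.
Qed.

Lemma cvg0D (R : realType) (v w : nat -> R) :
  v n @[n --> \oo] --> 0 -> w n @[n --> \oo] --> 0 ->
  v n + w n @[n --> \oo] --> 0.
Proof. by move=> v0 w0; rewrite -[0]addr0; exact: cvgD. Qed.

Lemma cvg0_shiftS (R : realType) (v : nat -> R) :
  v n.+1 @[n --> \oo] --> 0 <-> v n @[n --> \oo] --> 0.
Proof. by have := cvg_shiftS v (nbhs (0 : R)) => /= ->. Qed.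

Section analyticity.
Variable R : realType.
Implicit Types (a b : nat -> R[i]) (f : R[i] -> R[i]) (z w q : R[i]) (r rho : R).

Lemma analytic_atP f z0 : analytic_at f z0 <->
  exists b rho, 0 < rho /\ pseries b (fun w => f (z0 + w)) rho.
Proof.
split=> [[a]|[b [rho [rho0 bf]]]].
- move=> /nbhs_ballP[e /= e0]; rewrite /ball /= => aP.
  have eE : e = (complex.Re e)%:C.
    by move: e0; rewrite ltcE /= => /andP[/eqP e0 _]; case: e e0 {aP} => x y /= ->.
  exists a, (complex.Re e); split=> [|w wr]; first by rewrite -ltcR -eE.
  have := aP (z0 + w); rewrite /ball_ /= opprD addNKr => /(_ _).
  rewrite [z0 + w - z0]addrAC subrr add0r; apply.
  by rewrite normrN eE normc_def ltcR; move: wr; rewrite /modulus; case: (w).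
- exists b; apply/nbhs_ballP; exists rho%:C; first by rewrite /= ltcR.
  move=> z; rewrite /ball /= normc_def ltcR => zr.
  have /bf : modulus (z - z0) < rho.
    by rewrite modulusBC; move: zr; rewrite /modulus; case: (z0 - z).
  by rewrite [X in f X]addrC subrK.
Qed.

Lemma pseries_analytic a f : pseries a f 1 -> @analytic R f.
Proof.
move=> af z z1; apply/analytic_atP.
have [b bf] := pseries_recenter af z1.
by exists b, (1 - modulus z); rewrite subr_gt0.
Qed.

Definition geo_coef a q n : R[i] := \sum_(k < n.+1) a k * q ^+ (n - k).

Lemma geo_coefS a q n : geo_coef a q n.+1 = q * geo_coef a q n + a n.+1.
Proof.
rewrite /geo_coef big_ord_recr /= subnn mulr1; congr (_ + _).
rewrite mulr_sumr; apply: eq_bigr => k _.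
have kn : (k <= n)%N by rewrite -ltnS.
by rewrite subSn// exprS mulrCA.
Qed.

Lemma geo_coef_partial a q z n :
  (1 - q * z) * (\sum_(k < n.+1) geo_coef a q k * z ^+ k) =
  \sum_(k < n.+1) a k * z ^+ k - q * geo_coef a q n * z ^+ n.+1.
Proof.
elim: n => [|n IHn].
  by rewrite !big_ord1 /geo_coef big_ord1 subnn !mulr1 expr1 mulrBl mul1r mulrAC.
rewrite big_ord_recr mulrDr IHn [in RHS]big_ord_recr /= geo_coefS.
rewrite [z ^+ n.+2]exprS.
move: (\sum_(i < n.+1) _) (geo_coef a q n) (a n.+1) (z ^+ n.+1) => A g c y.
by rewrite mulrBl mul1r !mulrDl !mulrDr !mulrA; ring.
Qed.

(** Multiplying a partial sum of the product by [1 - q * z] leaves a partial sum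
    of [f] and one last term, which tends to zero. For [q = 1] the coefficients
    of the product are the partial sums of those of [f], as in the operator. *)
Lemma pseries_geo a f q : pseries a f 1 -> modulus q <= 1 ->
  pseries (geo_coef a q) (fun z => f z / (1 - q * z)) 1.
Proof.
move=> af q1 z z1; apply/sums_toP.
have qz1 : modulus (q * z) < 1.
  by rewrite modulusM (le_lt_trans _ z1)// ler_piMl ?modulus_ge0.
have nz : 1 - q * z != 0.
  rewrite -modulus_gt0 (lt_le_trans _ (modulusB_ge _ _))// modulus1.
  by rewrite subr_gt0.
have z_ge0 := modulus_ge0 z.
have [r [r0 zr r1]] : exists r, [/\ 0 < r, modulus z < r & r < 1].
  by exists ((1 + modulus z) / 2); split; lra.
have cr : cvgn (series (psnorm a r)).
  by apply: pseries_summable af _; rewrite ltW.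
pose S := limn (series (psnorm a r)).
have bS n : modulus (geo_coef a q n) <= r ^- n * S.
  rewrite (le_trans (modulus_sum _ _ _))//.
  apply: (@le_trans _ _ (\sum_(k < n.+1) r ^- n * psnorm a r k)).
    apply: ler_sum => k _; rewrite modulusM modulusX mulrCA.
    rewrite ler_wpM2l ?modulus_ge0//.
    apply: (@le_trans _ _ 1); first by rewrite exprn_ile1// modulus_ge0.
    have kn : (k <= n)%N by rewrite -ltnS.
    rewrite mulrC -{2}(subnK kn) exprD.
    rewrite invfM mulrCA mulfV ?expf_neq0 ?gt_eqF// mulr1 invf_ge1 ?exprn_gt0//.
    by rewrite exprn_ile1// ltW.
  rewrite -mulr_sumr ler_wpM2l ?invr_ge0 ?exprn_ge0 ?(ltW r0)//.
  have psn k : 0 <= psnorm a r k by apply: psnorm_ge0; exact: ltW.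
  have := @sum_le_tail _ (psnorm a r) 0 n.+1 psn cr.
  by rewrite big_mkord /tail big_ord0 subr0.
have S0 : 0 <= S by have := le_trans (modulus_ge0 _) (bS 0%N); rewrite invr1 mul1r.
have h1 : geometric S (modulus z / r) n @[n --> \oo] --> 0.
  have zr0 : 0 <= modulus z / r by rewrite mulr_ge0 ?invr_ge0 ?(ltW r0).
  by apply: cvg_geometric; rewrite ger0_norm// ltr_pdivrMr// mul1r.
have /sums_toP h2 := af z z1.
have {}h2 := iffRL (cvg0_shiftS
  (fun n => modulus (\sum_(k < n) a k * z ^+ k - f z))) h2.
apply: (iffLR (cvg0_shiftS (fun n => modulus
  (\sum_(k < n) geo_coef a q k * z ^+ k - f z / (1 - q * z))))).
have := cvg0Ml (modulus (1 - q * z))^-1 (cvg0D h2 h1); apply: squeeze0.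
apply: nearW => n; rewrite modulus_ge0 /=.
have -> : \sum_(k < n.+1) geo_coef a q k * z ^+ k - f z / (1 - q * z) =
  (1 - q * z)^-1 * (\sum_(k < n.+1) a k * z ^+ k - f z
     - q * geo_coef a q n * z ^+ n.+1).
  apply: (mulfI nz); rewrite mulrBr geo_coef_partial [RHS]mulrA mulfV// mul1r.
  by rewrite mulrCA mulfV// mulr1 addrAC.
rewrite modulusM modulusV ler_wpM2l ?invr_ge0 ?modulus_ge0//.
rewrite (le_trans (modulusD _ _))// lerD2l modulusN !modulusM modulusX.
apply: (@le_trans _ _ (1 * (r ^- n * S) * modulus z ^+ n)).
  apply: ler_pM; rewrite ?mulr_ge0 ?exprn_ge0 ?modulus_ge0//.
    by rewrite ler_pM// modulus_ge0.
  by rewrite exprS ler_piMl ?exprn_ge0 ?modulus_ge0 ?ltW.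
by rewrite mul1r expr_div_n [_ * S]mulrC -mulrA [_^-1 * _]mulrC.
Qed.

End analyticity.

(** * Roots of unity and Cauchy estimates *)

Section cauchy.
Variable R : realType.
Implicit Types (a b c : nat -> R[i]) (f : R[i] -> R[i]) (z w q : R[i])
  (r rho B : R) (N M n : nat).

Definition unity_root N : R[i] := cis (pi *+ 2 / N%:R).

Lemma modulus_unity_root N j : modulus (unity_root N ^+ j) = 1.
Proof. by rewrite modulusX modulus_cis expr1n. Qed.

Lemma unity_rootN N : (0 < N)%N -> unity_root N ^+ N = 1.
Proof.
move=> N0; rewrite /unity_root -cisMn -[X in cis X]mulr_natr divfK ?pnatr_eq0 ?gtn_eqF//.
by rewrite /cis cos2pi sin2pi.
Qed.

Lemma unity_root_neq1 N m : (0 < m < N)%N -> unity_root N ^+ m != 1.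
Proof.
move=> /andP[m0 mN]; rewrite /unity_root -cisMn; apply/eqP => /(congr1 (@complex.Re R)).
have -> : pi *+ 2 / N%:R *+ m = (pi * (m%:R / N%:R)) *+ 2 :> R.
  by rewrite -[LHS]mulr_natr -[pi *+ 2]mulr_natr -[RHS]mulr_natr; ring.
rewrite /= cos_mulr2n cos2sin2.
set s := sin _ => /(congr1 (fun x => 1 - x)).
rewrite mulrnBl mulr2n => h.
have : s ^+ 2 = 0 by lra.
move=> /eqP; rewrite sqrf_eq0 => /eqP s0.
suff : 0 < s by rewrite s0 ltxx.
have N0 : (0 < N)%N by exact: leq_ltn_trans mN.
have NR0 : 0 < N%:R :> R by rewrite ltr0n.
apply: sin_gt0_pi; rewrite mulr_gt0 ?pi_gt0 ?divr_gt0 ?ltr0n//=.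
by rewrite gtr_pMr ?pi_gt0// ltr_pdivrMr// mul1r ltr_nat.
Qed.

Lemma sum_expr_root q N : q ^+ N = 1 -> q != 1 -> \sum_(j < N) q ^+ j = 0.
Proof.
move=> qN q1; have := subrX1 q N; rewrite qN subrr => /esym/eqP.
by rewrite mulf_eq0 subr_eq0 (negbTE q1) => /eqP.
Qed.

(** Averages over roots of unity extract the coefficients of a polynomial
    exactly, as the Cauchy integral does for a power series. *)
Lemma poly_coef_average c M N n z : (n < M <= N)%N ->
  \sum_(j < N) unity_root N ^+ (j * (N - n)) *
      (\sum_(k < M) c k * (unity_root N ^+ j * z) ^+ k) =
  N%:R * (c n * z ^+ n).
Proof.
move=> /andP[nM MN]; have N0 : (0 < N)%N by rewrite (leq_trans _ MN)// (leq_ltn_trans _ nM).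
set o := unity_root N.
under eq_bigr do rewrite mulr_sumr.
rewrite exchange_big /=.
have E (k : 'I_M) : \sum_(j < N) o ^+ (j * (N - n)) * (c k * (o ^+ j * z) ^+ k) =
    (c k * z ^+ k) * \sum_(j < N) (o ^+ (N - n + k)) ^+ j.
  rewrite mulr_sumr; apply: eq_bigr => j _.
  rewrite exprMn -[(o ^+ j) ^+ k]exprM -[(o ^+ (N - n + k)) ^+ j]exprM mulnDl exprD.
  by rewrite ![(_ * j)%N]mulnC; ring.
rewrite (eq_bigr _ (fun k _ => E k)) (bigD1 (Ordinal nM))//=.
rewrite [X in _ + X]big1 ?addr0 => [|k kn].
  rewrite subnK ?(leq_trans (ltnW nM))//.
  rewrite unity_rootN//; under eq_bigr do rewrite expr1n.
  by rewrite sumr_const card_ord mulrC.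
rewrite sum_expr_root ?mulr0//.
  by rewrite -exprM mulnC exprM unity_rootN// expr1n.
have kM := ltn_ord k; have {}kn : (k != n :> nat)%N by [].
have [ltnk|ltkn|eqnk] := ltngtP n k; last by rewrite eqnk eqxx in kn.
  have -> : (N - n + k = N + (k - n))%N by lia.
  rewrite exprD unity_rootN// mul1r; apply: unity_root_neq1.
  by rewrite subn_gt0 ltnk /= (leq_ltn_trans (leq_subr _ _))// (leq_trans kM).
by apply: unity_root_neq1; lia.
Qed.

(** On the circle of radius [r] the partial sums are within a tail of [f], and
    their coefficients are averages of their values there. *)
Lemma cauchy_estimate a f rho r B n : pseries a f rho -> 0 <= r < rho ->
  (forall z, modulus z = r -> modulus (f z) <= B) -> modulus (a n) * r ^+ n <= B.
Proof.
move=> af rrho fB; have r0 : 0 <= r by case/andP: rrho.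
have cr := pseries_summable af rrho.
have key M : (n < M)%N -> modulus (a n) * r ^+ n <= B + tail (psnorm a r) M.
  move=> nM; have M0 : (0 < M)%N by rewrite (leq_ltn_trans _ nM).
  have MR0 : 0 < M%:R :> R by rewrite ltr0n.
  have nMM : (n < M <= M)%N by rewrite nM /=.
  have := poly_coef_average a r%:C nMM => /(congr1 (@modulus R)).
  rewrite [RHS]modulusM modulusM modulusX modulus_real ger0_norm//.
  have -> : modulus (M%:R : R[i]) = M%:R.
    by rewrite -(rmorph_nat (real_complex R)) modulus_real ger0_norm.
  move=> E; rewrite -(ler_pM2l MR0) -E (le_trans (modulus_sum _ _ _))//.
  rewrite mulr_natl -[X in _ *+ X]card_ord -sumr_const; apply: ler_sum => j _.
  rewrite modulusM mulnC exprM modulusX modulus_unity_root expr1n mul1r.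
  set w := _ * _; have mw : modulus w = r.
    by rewrite /w modulusM modulus_unity_root mul1r modulus_real ger0_norm.
  rewrite -[X in modulus X](subrK (f w)) (le_trans (modulusD _ _))// addrC.
  rewrite lerD ?fB// modulusBC.
  by apply: pseries_tail af _; rewrite mw lexx; case/andP: rrho.
rewrite -[B]addr0.
have h : B + tail (psnorm a r) M @[M --> \oo] --> B + 0.
  by apply: cvgD; [exact: cvg_cst|exact: tail_cvg0].
rewrite -(cvg_lim (@Rhausdorff R) h).
apply: limr_ge; first by apply/cvg_ex; exists (B + 0).
by exists n.+1 => // M /= nM; exact: key.
Qed.

(** A discrete mean value property, with the tail of the series as error. *)
Lemma pseries_mean a f rho r w N : pseries a f rho -> modulus w <= r < rho ->
  (0 < N)%N ->
  modulus (f 0) <= N%:R^-1 * (\sum_(j < N) modulus (f (unity_root N ^+ j * w)))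
     + tail (psnorm a r) N.
Proof.
move=> af wr N0; have NR0 : 0 < N%:R :> R by rewrite ltr0n.
have nNN : (0 < N <= N)%N by rewrite N0 /=.
have f0 : f 0 = a 0%N.
  apply/esym; have r0 : modulus (0 : R[i]) < rho.
    rewrite modulus0; case/andP: wr => w0 wr.
    by rewrite (le_lt_trans (modulus_ge0 w))// (le_lt_trans w0).
  have /sums_toP h := af 0 r0.
  apply: ccvg_unique h; apply: squeeze0 (cvg_cst 0); exists 1%N => // n /= n0.
  rewrite modulus_ge0 /= -(prednK n0) big_ord_recl /= mulr1 big1 ?addr0 ?subrr.
    by rewrite modulus0.
  by move=> i _; rewrite exprS mul0r mulr0.
have := poly_coef_average a w nNN => /(congr1 (@modulus R)).
rewrite [RHS]modulusM expr0 mulr1 -f0.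
have -> : modulus (N%:R : R[i]) = N%:R.
  by rewrite -(rmorph_nat (real_complex R)) modulus_real ger0_norm.
move=> E; rewrite -(ler_pM2l NR0) -E (le_trans (modulus_sum _ _ _))//.
rewrite mulrDr mulrA mulfV ?gt_eqF// mul1r.
rewrite [N%:R * _]mulr_natl -[X in _ *+ X]card_ord -sumr_const -big_split /=.
apply: ler_sum => j _.
rewrite modulusM mulnC exprM modulusX modulus_unity_root expr1n mul1r.
set v := _ * _; have mv : modulus v = modulus w.
  by rewrite /v modulusM modulus_unity_root mul1r.
rewrite -[X in modulus X](subrK (f v)) (le_trans (modulusD _ _))// addrC.
rewrite lerD2r modulusBC.
by apply: pseries_tail af _; rewrite mv.
Qed.

Lemma pseries_unique a b f rho : 0 < rho -> pseries a f rho -> pseries b f rho ->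
  a =1 b.
Proof.
move=> rho0 af bf n; apply/eqP; rewrite -subr_eq0 -[_ == 0]negbK -modulus_gt0 -leNgt.
have r0 : 0 < rho / 2 by rewrite divr_gt0.
have := @cauchy_estimate _ _ rho (rho / 2) 0 n (pseriesB af bf) _ _.
rewrite pmulr_lle0 ?exprn_gt0//; apply; first by rewrite ltW//= ltr_pdivrMr// ltr_pMr// ltr1n.
by move=> z _; rewrite subrr modulus0.
Qed.

End cauchy.

(** * Integral inequalities and invariance of plane measure *)

Section integral_bounds.
Context d (T : measurableType d) (R : realType) (mu : {measure set T -> \bar R}).
Local Open Scope ereal_scope.

(** The integral of a nonnegative function is the supremum of the integrals of
    the simple functions below it; hence it is monotone for all functions. *)
Lemma le_integral_ge0 (A B : set T) (f g : T -> \bar R) :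
  (forall x, A x -> 0 <= f x) -> (forall x, B x -> 0 <= g x) ->
  (forall x, A x -> B x /\ f x <= g x) ->
  \int[mu]_(x in A) f x <= \int[mu]_(x in B) g x.
Proof.
move=> f0 g0 fg; rewrite (ge0_integralE mu f0) (ge0_integralE mu g0).
apply: le_ereal_sup => _ [h hf <-]; exists h => // x.
apply: le_trans (hf x) _; rewrite /= /patch.
case: ifPn => [/[!inE] Ax|_]; last by case: ifPn => // /[!inE]; exact: g0.
by have [Bx fgx] := fg x Ax; rewrite mem_set.
Qed.

Lemma integral_pieces_le (A A0 A1 A2 : set T) (f g0 g1 g2 : T -> \bar R) :
  measurable A0 -> measurable A1 -> measurable A2 ->
  measurable_fun setT g0 -> measurable_fun setT g1 -> measurable_fun setT g2 ->
  (forall x, 0 <= g0 x) -> (forall x, 0 <= g1 x) -> (forall x, 0 <= g2 x) ->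
  (forall x, A x -> 0 <= f x) ->
  (forall x, A x -> [\/ A0 x /\ f x <= g0 x, A1 x /\ f x <= g1 x |
                        A2 x /\ f x <= g2 x]) ->
  \int[mu]_(x in A) f x <= \int[mu]_(x in A0) g0 x + \int[mu]_(x in A1) g1 x +
                           \int[mu]_(x in A2) g2 x.
Proof.
move=> m0 m1 m2 mg0 mg1 mg2 g00 g10 g20 f0 cover.
rewrite (integral_mkcond A0) (integral_mkcond A1) (integral_mkcond A2).
have p0 (B : set T) (g : T -> \bar R) x : (forall y, 0 <= g y) -> 0 <= (g \_ B) x.
  by move=> gp; rewrite patchE; case: ifPn.
have mp (B : set T) (g : T -> \bar R) : measurable B -> measurable_fun setT g ->
    measurable_fun setT (g \_ B).
  by move=> mB mg; apply/(measurable_restrictT _ mB); exact: measurable_funTS.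
rewrite -ge0_integralD//; do ?[by move=> x _; exact: p0|exact: mp].
rewrite -ge0_integralD//; do ?[by move=> x _; exact: p0|exact: mp].
- apply: le_integral_ge0 => // [x _|x Ax]; first by rewrite !adde_ge0 ?p0.
  split=> //; have [[q0 q1] q2] := (p0 A0 g0 x g00, p0 A1 g1 x g10, p0 A2 g2 x g20).
  have e (B : set T) (g : T -> \bar R) : B x -> (g \_ B) x = g x by move=> Bx; rewrite patchE mem_set.
  case: (cover x Ax) => -[Bx /le_trans]; apply; rewrite -(e _ _ Bx).
  + by rewrite -addeA leeDl// adde_ge0.
  + by rewrite addeAC leeDr// adde_ge0.
  + by rewrite leeDr// adde_ge0.
- by move=> x _; rewrite adde_ge0 ?p0.
- by apply: emeasurable_funD; exact: mp.
Qed.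

End integral_bounds.

Section plane_invariance.
Variable R : realType.
Local Notation leb := (@lebesgue_measure R).
Local Notation plane := (measurableTypeR R * measurableTypeR R)%type.
Local Notation leb2 := (leb \x leb)%E.
Local Open Scope ereal_scope.

Lemma measurable_translation (c : R) :
  measurable_fun [set: measurableTypeR R]
    ((fun x => x + c)%R : measurableTypeR R -> measurableTypeR R).
Proof. exact: measurable_funD. Qed.

Lemma integral_translation (c : R) (f : measurableTypeR R -> \bar R) :
  measurable_fun setT f -> (forall x, 0 <= f x) ->
  \int[leb]_x f (x + c)%R = \int[leb]_x f x.
Proof.
move=> mf f0.
have := @ge0_integral_pushforward _ _ (measurableTypeR R) (measurableTypeR R) R
  _ (measurable_translation c) leb setT f measurableT mf (fun x _ => f0 x).
rewrite preimage_setT => <-.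
apply: eq_measure_integral; first exact: measurable_translation.
move=> mt A mA _; apply/esym; apply: lebesgue_measure_unique => //.
move=> _ [[a b]] _ <-; rewrite /= /pushforward /=.
have -> : (fun x : R => x + c)%R @^-1` `]a, b]%classic = `](a - c)%R, (b - c)%R]%classic.
  apply/seteqP; split => x /=; rewrite !in_itv /= ltrBlDr lerBrDr//.
rewrite !lebesgue_measure_itv /= !lte_fin ltrD2r.
by case: ifPn => // _; rewrite -!EFinB; congr (_%:E); ring.
Qed.

Lemma integral_plane_translation (c : R * R) (f : plane -> \bar R) :
  measurable_fun setT f -> (forall x, 0 <= f x) ->
  \int[leb2]_w f (w.1 + c.1, w.2 + c.2)%R = \int[leb2]_w f w.
Proof.
move=> mf f0.
have mt : measurable_fun [set: plane]
    (fun w : plane => (w.1 + c.1, w.2 + c.2)%R : plane).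
  by apply/measurable_fun_pairP; split; apply: measurable_funD.
rewrite fubini_tonelli1//; last exact: measurableT_comp.
rewrite [RHS]fubini_tonelli1// /fubini_F /=.
rewrite -[RHS](integral_translation c.1); last 2 first.
- exact: measurable_fun_fubini_tonelli_F.
- by move=> x; exact: integral_ge0.
apply: eq_integral => x _; rewrite (@integral_translation c.2 (fun y => f (x + c.1, y)%R))//.
exact: measurableT_comp.
Qed.

Lemma measurable_shear1 (c : R) :
  measurable_fun [set: plane] (fun w : plane => (w.1 + c * w.2, w.2)%R : plane).
Proof.
apply: measurable_fun_pair; last exact: measurable_snd.
by apply: measurable_funD => //; exact: measurable_funM.
Qed.

Lemma measurable_shear2 (c : R) :
  measurable_fun [set: plane] (fun w : plane => (w.1, w.2 + c * w.1)%R : plane).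
Proof.
apply: measurable_fun_pair; first exact: measurable_fst.
by apply: measurable_funD => //; exact: measurable_funM.
Qed.

(** A shear translates each line of one direction, so that Fubini reduces its
    invariance to that of translations. *)
Lemma integral_shear1 (c : R) (f : plane -> \bar R) :
  measurable_fun setT f -> (forall x, 0 <= f x) ->
  \int[leb2]_w f (w.1 + c * w.2, w.2)%R = \int[leb2]_w f w.
Proof.
move=> mf f0.
have mt := measurable_shear1 c.
rewrite fubini_tonelli2//; last exact: measurableT_comp.
rewrite [RHS]fubini_tonelli2// /fubini_G /=.
apply: eq_integral => y _.
rewrite (@integral_translation (c * y) (fun x => f (x, y)))//.
exact: measurableT_comp.
Qed.

Lemma integral_shear2 (c : R) (f : plane -> \bar R) :
  measurable_fun setT f -> (forall x, 0 <= f x) ->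
  \int[leb2]_w f (w.1, w.2 + c * w.1)%R = \int[leb2]_w f w.
Proof.
move=> mf f0.
have mt := measurable_shear2 c.
rewrite fubini_tonelli1//; last exact: measurableT_comp.
rewrite [RHS]fubini_tonelli1// /fubini_F /=.
apply: eq_integral => x _.
rewrite (@integral_translation (c * x) (fun y => f (x, y)))//.
exact: measurableT_comp.
Qed.

Lemma integral_swap (f : plane -> \bar R) :
  measurable_fun setT f -> (forall x, 0 <= f x) ->
  \int[leb2]_w f (w.2, w.1) = \int[leb2]_w f w.
Proof.
move=> mf f0.
have ms : measurable_fun [set: plane] (fun w : plane => (w.2, w.1) : plane).
  by apply: measurable_fun_pair; [exact: measurable_snd|exact: measurable_fst].
rewrite fubini_tonelli1//; last exact: (measurableT_comp mf ms).
by rewrite [RHS]fubini_tonelli2.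
Qed.

End plane_invariance.

(** * Measurability of power series and rotation invariance *)

Section complex_measurability.
Variable R : realType.
Local Notation plane := (measurableTypeR R * measurableTypeR R)%type.

Lemma measurable_sublevel d (T : measurableType d) (g : T -> R) (r : R) :
  measurable_fun setT g -> measurable [set x | g x < r].
Proof.
move=> mg; rewrite -[X in measurable X]setTI.
have -> : [set x | g x < r] = g @^-1` [set` `]-oo, r[].
  by apply/seteqP; split => x /=; rewrite in_itv.
exact: mg.
Qed.

Definition cmeasurable d (T : measurableType d) (D : set T) (f : T -> R[i]) :=
  measurable_fun D (fun x => complex.Re (f x)) /\
  measurable_fun D (fun x => complex.Im (f x)).

Section closure.
Context d (T : measurableType d) (D : set T).
Implicit Types f g : T -> R[i].

Lemma cmeasurable_cst c : cmeasurable D (fun=> c).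
Proof. by split; exact: measurable_cst. Qed.

Lemma cmeasurableD f g : cmeasurable D f -> cmeasurable D g ->
  cmeasurable D (fun x => f x + g x).
Proof.
move=> [f1 f2] [g1 g2]; split.
  by under eq_fun do rewrite ReD; exact: measurable_funD.
by under eq_fun do rewrite ImD; exact: measurable_funD.
Qed.

Lemma cmeasurableM f g : cmeasurable D f -> cmeasurable D g ->
  cmeasurable D (fun x => f x * g x).
Proof.
move=> [f1 f2] [g1 g2]; split.
  rewrite (_ : (fun _ => _) = (fun x => complex.Re (f x) * complex.Re (g x)
     - complex.Im (f x) * complex.Im (g x))); last first.
    by apply/funext => x; case: (f x) (g x) => [? ?] [? ?].
  by apply: measurable_funB; exact: measurable_funM.
rewrite (_ : (fun _ => _) = (fun x => complex.Re (f x) * complex.Im (g x)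
   + complex.Im (f x) * complex.Re (g x))); last first.
  by apply/funext => x; case: (f x) (g x) => [? ?] [? ?].
by apply: measurable_funD; exact: measurable_funM.
Qed.

Lemma cmeasurableX f n : cmeasurable D f -> cmeasurable D (fun x => f x ^+ n).
Proof.
move=> mf; elim: n => [|n IHn].
  by under eq_fun do rewrite expr0; exact: cmeasurable_cst.
by under eq_fun do rewrite exprS; exact: cmeasurableM.
Qed.

Lemma cmeasurable_sum n (f : nat -> T -> R[i]) :
  (forall k, cmeasurable D (f k)) -> cmeasurable D (fun x => \sum_(k < n) f k x).
Proof.
move=> mf; elim: n => [|n IHn].
  by under eq_fun do rewrite big_ord0; exact: cmeasurable_cst.
by under eq_fun do rewrite big_ord_recr; exact: cmeasurableD.
Qed.

Lemma cmeasurable_cvg (h : nat -> T -> R[i]) f :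
  (forall n, cmeasurable D (h n)) ->
  (forall x, D x -> modulus (h n x - f x) @[n --> \oo] --> 0) ->
  cmeasurable D f.
Proof.
move=> mh hf; split.
  apply: (measurable_fun_cvg (fun n => (mh n).1)) => x Dx.
  exact: ccvg_Re (hf x Dx).
apply: (measurable_fun_cvg (fun n => (mh n).2)) => x Dx.
exact: ccvg_Im (hf x Dx).
Qed.

Lemma measurable_modulus f : cmeasurable D f ->
  measurable_fun D (fun x => modulus (f x)).
Proof.
move=> [f1 f2]; rewrite (_ : (fun _ => _) =
  Num.sqrt \o (fun x => complex.Re (f x) ^+ 2 + complex.Im (f x) ^+ 2)); last first.
  by apply/funext => x; rewrite /modulus /=; case: (f x).
apply: measurableT_comp.
  by apply: continuous_measurable_fun; exact: sqrt_continuous.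
by apply: measurable_funD; exact: measurable_funX.
Qed.

End closure.

Lemma cmeasurable_of_plane (D : set plane) : cmeasurable D (@of_plane R).
Proof.
by split; apply: measurable_funTS => /=; [exact: measurable_fst|exact: measurable_snd].
Qed.

Definition plane_ball (r : R) : set plane := [set w | modulus (of_plane w) < r].

Lemma measurable_plane_ball r : measurable (plane_ball r).
Proof.
apply: measurable_sublevel; apply: measurable_modulus.
exact: cmeasurable_of_plane.
Qed.

Lemma pseries_measurable (a : nat -> R[i]) f r : pseries a f r ->
  cmeasurable (plane_ball r) (fun w : plane => f (of_plane w)).
Proof.
move=> af; apply: (@cmeasurable_cvg _ _ _
  (fun n w => \sum_(k < n) a k * of_plane w ^+ k)) => [n|w wr].
  apply: (@cmeasurable_sum _ _ _ n (fun k w => a k * of_plane w ^+ k)) => k.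
  apply: cmeasurableM; first exact: cmeasurable_cst.
  by apply: cmeasurableX; exact: cmeasurable_of_plane.
by have /sums_toP := af _ wr.
Qed.

End complex_measurability.

Section rotation.
Variable R : realType.
Local Notation leb := (@lebesgue_measure R).
Local Notation plane := (measurableTypeR R * measurableTypeR R)%type.
Local Notation leb2 := (leb \x leb)%E.

Definition rot (c : R[i]) (w : plane) : plane :=
  (complex.Re c * w.1 - complex.Im c * w.2,
   complex.Im c * w.1 + complex.Re c * w.2).

Lemma of_plane_rot c w : of_plane (rot c w) = c * of_plane w.
Proof. by case: c => a b; apply/eqP; rewrite eq_complex /= eqxx /= addrC. Qed.

Lemma measurable_rot c : measurable_fun [set: plane] (rot c).
Proof.
apply: measurable_fun_pair.
  by apply: measurable_funB; apply: measurable_funM.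
by apply: measurable_funD; apply: measurable_funM.
Qed.

(** A rotation by an angle that is not a multiple of [pi] is a product of three
    shears. *)
Lemma integral_rot_nonreal c (f : plane -> \bar R) :
  modulus c = 1 -> complex.Im c != 0 ->
  measurable_fun setT f -> (forall x, 0 <= f x)%E ->
  (\int[leb2]_w f (rot c w) = \int[leb2]_w f w)%E.
Proof.
move=> c1; have := sqr_modulus c; rewrite c1 expr1n => /esym.
case: c {c1} => a b /= ab b0 mf f0.
(* [t] is minus the tangent of half the angle of rotation. *)
pose t := (a - 1) / b.
have tb : t * b = a - 1 by rewrite /t divfK.
have ta : t * (1 + a) = - b.
  apply: (mulfI b0); rewrite mulrA [b * t]mulrC tb.
  by rewrite mulrN -expr2 (_ : b ^+ 2 = 1 - a ^+ 2); [ring|rewrite -ab addrC addKr].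
have -> : (fun w => f (rot (a +i* b) w)) = (fun w => (f \o
    (fun w => (w.1 + t * w.2, w.2)) \o (fun w => (w.1, w.2 + b * w.1)))
    (w.1 + t * w.2, w.2)).
  apply/funext => -[x y]; rewrite /rot /=; congr (f (_, _)).
    rewrite -[- (b * y)]mulNr -ta (_ : a = 1 + t * b); last by rewrite tb; ring.
    by ring.
  by rewrite (_ : a = 1 + t * b); [ring|rewrite tb; ring].
have m1 := measurable_shear1 t; have m2 := measurable_shear2 b.
rewrite (@integral_shear1 _ t (f \o (fun w => (w.1 + t * w.2, w.2)) \o
  (fun w => (w.1, w.2 + b * w.1)))); last 2 first.
- apply: (measurableT_comp _ m2); exact: (measurableT_comp mf m1).
- by move=> x; exact: f0.
rewrite (@integral_shear2 _ b (f \o (fun w => (w.1 + t * w.2, w.2)))); last 2 first.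
- exact: (measurableT_comp mf m1).
- by move=> x; exact: f0.
exact: integral_shear1.
Qed.

Lemma integral_rot c (f : plane -> \bar R) : modulus c = 1 ->
  measurable_fun setT f -> (forall x, 0 <= f x)%E ->
  (\int[leb2]_w f (rot c w) = \int[leb2]_w f w)%E.
Proof.
move=> c1 mf f0; have [b0|b0] := eqVneq (complex.Im c) 0; last exact: integral_rot_nonreal.
have /orP[/eqP a1|/eqP a1] : (complex.Re c == 1) || (complex.Re c == -1).
  rewrite -eqf_sqr expr1n; have := sqr_modulus c.
  by rewrite c1 b0 expr1n expr0n addr0 => ->.
- apply: eq_integral => -[x y] _; rewrite /rot a1 b0 /=.
  by rewrite !mul1r !mul0r subr0 add0r.
(* The rotation by [pi] is the square of the rotation by [pi / 2]. *)
- have i1 : modulus (0 +i* 1 : R[i]) = 1.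
    by rewrite /modulus /= expr0n expr1n add0r sqrtr1.
  rewrite -[RHS](@integral_rot_nonreal (0 +i* 1))//= ?oner_eq0//.
  rewrite -[RHS](@integral_rot_nonreal (0 +i* 1)
    (fun w => f (rot (0 +i* 1) w)))//= ?oner_eq0//; last first.
    by apply: measurableT_comp => //; exact: measurable_rot.
  apply: eq_integral => -[x y] _; rewrite /rot a1 b0 /=.
  by congr (f (_, _)); ring.
Qed.

End rotation.

(** * Sub-mean value inequality *)

(** The graph of the convex function [x `^ p] lies above its tangent at [c];
    this is Young's inequality for [x / c] and [1]. *)
Lemma powR_tangent (R : realType) (p x c : R) : 1 <= p -> 0 <= x -> 0 < c ->
  c `^ p * (p / c) * x <= x `^ p + (p - 1) * c `^ p.
Proof.
move=> p1 x0 c0; have p0 : 0 < p by lra.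
have [pE|pE] := eqVneq p 1.
  by rewrite pE !powRr1 ?(ltW c0)// subrr mul0r addr0 mul1r mulfV ?gt_eqF// mul1r.
have {}p1 : 1 < p by rewrite lt_neqAle eq_sym pE.
have pn : p != 0 by rewrite gt_eqF.
have p1n : p - 1 != 0 by rewrite subr_eq0.
have q0 : 0 < p / (p - 1) by rewrite divr_gt0// subr_gt0.
have cn : 0 <= x / c by rewrite divr_ge0 ?(ltW c0).
have pq : p^-1 + (p / (p - 1))^-1 = 1 by field; rewrite ?pn ?p1n.
have H := conjugate_powR cn ler01 p0 q0 pq.
have cp : 0 < c `^ p by exact: powR_gt0.
have -> : x `^ p = c `^ p * (x / c) `^ p.
  by rewrite -powRM ?(ltW c0)// mulrC divfK// gt_eqF.
have {}H : p * (x / c) <= (x / c) `^ p + (p - 1).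
  rewrite -(ler_pM2l p0) mulr1 powR1 in H; apply: le_trans H _.
  by rewrite le_eqVlt; apply/orP; left; apply/eqP; field; rewrite ?pn ?p1n.
rewrite -(ler_pM2l cp) mulrDr in H.
by rewrite [(p - 1) * _]mulrC -!mulrA [c^-1 * x]mulrC.
Qed.

Section mean_value.
Variable R : realType.
Local Notation leb := (@lebesgue_measure R).
Local Notation plane := (measurableTypeR R * measurableTypeR R)%type.
Local Notation leb2 := (leb \x leb)%E.

Lemma leb2_rect (a b c d : R) : a <= b -> c <= d ->
  leb2 (`[a, b]%classic `*` `[c, d]%classic) = ((b - a) * (d - c))%:E.
Proof.
move=> ab cd; rewrite product_measure1E//= !lebesgue_measure_itv /= !lte_fin.
have H (x y : R) : x <= y -> (if x < y then (y%:E - x%:E)%E else 0%E) = (y - x)%:E.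
  by rewrite le_eqVlt => /orP[/eqP ->|->//]; rewrite ltxx subrr.
by rewrite !H// EFinM.
Qed.

Lemma plane_ball_measure_lt r : 0 <= r -> (leb2 (plane_ball r) < +oo)%E.
Proof.
move=> r0; apply: (@le_lt_trans _ _ (leb2 (`[- r, r]%classic `*` `[- r, r]%classic))).
  apply: le_measure; rewrite ?inE.
  - exact: measurable_plane_ball.
  - by apply: measurableX.
  - move=> w /= /ltW wr; rewrite !in_itv /= -!ler_norml.
    by split; apply: le_trans wr; [exact: normr_Re_le (of_plane w)|
       exact: normr_Im_le (of_plane w)].
by rewrite leb2_rect ?ltry//; lra.
Qed.

Lemma plane_ball_measure_ge r : 0 < r -> ((r ^+ 2)%:E <= leb2 (plane_ball r))%E.
Proof.
move=> r0; have h : - (r / 2) <= r / 2 by lra.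
have -> : (r ^+ 2)%:E = leb2 (`[- (r / 2), r / 2]%classic `*` `[- (r / 2), r / 2]%classic).
  by rewrite leb2_rect//; congr (_%:E); field.
apply: le_measure; rewrite ?inE.
- by apply: measurableX.
- exact: measurable_plane_ball.
- move=> [x y] /=; rewrite !in_itv /= -!ler_norml => -[xr yr].
  change (modulus (of_plane (x, y)) < r).
  rewrite -(ltr_pXn2r (ltn0Sn 1)) ?nnegrE ?modulus_ge0 ?(ltW r0)//.
  rewrite sqr_modulus /= -(real_normK (num_real x)) -(real_normK (num_real y)).
  have := normr_ge0 x; have := normr_ge0 y; nra.
Qed.

Section submean.
Variables (b : nat -> R[i]) (f : R[i] -> R[i]) (rho r : R).
Hypotheses (bf : pseries b f rho) (r0 : 0 < r) (rrho : r < rho).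

Let cmf : cmeasurable (plane_ball r) (fun w : plane => f (of_plane w)).
Proof. by apply: pseries_measurable; apply: pseriesW bf; exact: ltW. Qed.

Let m := fine (leb2 (plane_ball r)).

Let mE : leb2 (plane_ball r) = m%:E.
Proof. by rewrite /m fineK// ge0_fin_numE// plane_ball_measure_lt// ltW. Qed.

Let m_ge0 : 0 <= m. Proof. exact: fine_ge0. Qed.

(** The discrete mean value property is integrated over the disk; all rotated
    copies of [|f|] have the same integral. *)
Lemma submean1 : ((modulus (f 0) * m)%:E <=
  \int[leb2]_(w in plane_ball r) (modulus (f (of_plane w)))%:E)%E.
Proof.
have mB := measurable_plane_ball r.
pose B := plane_ball r.
pose G := (fun w : plane => (modulus (f (of_plane w)))%:E) \_ B.
have G0 w : (0 <= G w)%E.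
  by rewrite /G patchE; case: ifPn => // _; rewrite lee_fin modulus_ge0.
have mG : measurable_fun setT G.
  apply/(measurable_restrictT _ mB).
  by apply/measurable_EFinP; exact: measurable_modulus.
rewrite integral_mkcond -/G.
have [I|I] := eqVneq (\int[leb2]_w G w)%E +oo%E.
  by rewrite -/B -/G in I *; rewrite I leey.
have Ifin : (\int[leb2]_w G w)%E \is a fin_num.
  by rewrite ge0_fin_numE ?ltey//; exact: integral_ge0.
pose v := tail (psnorm b r).
have rr : 0 <= r < rho by rewrite ltW.
have cv := pseries_summable bf rr.
have v0 n : 0 <= v n.
  by apply: tail_ge0 => // k; apply: psnorm_ge0; exact: ltW.
pose c := fine (\int[leb2]_w G w)%E.
have cE : (\int[leb2]_w G w)%E = c%:E by rewrite /c fineK.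
rewrite cE lee_fin.
have intB : (\int[leb2]_x (\1_B x)%:E = m%:E)%E.
  by rewrite integral_indic// setIT -mE.
have key N : (0 < N)%N -> modulus (f 0) * m <= c + v N * m.
  move=> N0; have NR0 : 0 < N%:R :> R by rewrite ltr0n.
  pose H j w : \bar R := G (rot (unity_root R N ^+ j) w).
  pose S w : \bar R := (\sum_(j < N) H j w)%E.
  have S0 w : (0 <= S w)%E by apply: sume_ge0 => j _; exact: G0.
  have mH j : measurable_fun setT (H j).
    by apply: measurableT_comp => //; exact: measurable_rot.
  have : (\int[leb2]_w ((modulus (f 0))%:E * (\1_B w)%:E) <=
     \int[leb2]_w ((N%:R^-1)%:E * S w
       + (v N)%:E * (\1_B w)%:E))%E.
    apply: le_integral_ge0 => [w _|w _|w _].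
    - by rewrite -EFinM lee_fin mulr_ge0 ?modulus_ge0.
    - by rewrite adde_ge0// mule_ge0 ?lee_fin ?invr_ge0.
    split=> //; rewrite indicE; have [wB|wB] := boolP (w \in B); last first.
      rewrite mule0 adde_ge0// mule_ge0 ?lee_fin ?invr_ge0//.
    rewrite !mule1.
    have HE j : H j w =
       (modulus (f (unity_root R N ^+ j * of_plane w)))%:E.
      rewrite /H /G patchE of_plane_rot ifT//; apply/mem_set.
      change (modulus (of_plane (rot (unity_root R N ^+ j) w)) < r).
      move/set_mem : wB; rewrite of_plane_rot /B /plane_ball /mkset.
      by rewrite modulusM modulus_unity_root mul1r.
    rewrite /S; under eq_bigr do rewrite HE.
    rewrite sumEFin -EFinM -EFinD lee_fin; apply: (pseries_mean bf) => //.
    by rewrite ltW ?andTb//; move/set_mem : wB.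
  have m1 : measurable_fun setT (fun w : plane => (\1_B w : R)%:E).
    by apply/measurable_EFinP; exact: measurable_indic.
  have mS : measurable_fun setT S by apply: emeasurable_sum.
  rewrite ge0_integralZl_EFin//; last exact: modulus_ge0.
  rewrite intB -EFinM.
  rewrite ge0_integralD//; last 4 first.
  - by move=> w _; rewrite mule_ge0 ?lee_fin ?invr_ge0.
  - exact: measurable_funeM.
  - by move=> w _; rewrite mule_ge0 ?lee_fin.
  - exact: measurable_funeM.
  rewrite !ge0_integralZl_EFin ?invr_ge0//.
  rewrite intB ge0_integral_sum//; last by move=> j w _; exact: G0.
  under eq_bigr do rewrite /H integral_rot ?modulus_unity_root// cE.
  rewrite sumEFin sumr_const card_ord -(mulr_natl c) -!EFinM -EFinD lee_fin.
  by rewrite mulrA mulVf ?gt_eqF// mul1r.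
have h : c + v N * m @[N --> \oo] --> c + 0 * m.
  apply: cvgD; first exact: cvg_cst.
  by apply: cvgM; [exact: tail_cvg0|exact: cvg_cst].
rewrite -[c]addr0 -[X in c + X](mul0r m) -(cvg_lim (@Rhausdorff R) h).
apply: limr_ge; first by apply/cvg_ex; exists (c + 0 * m).
by exists 1%N.
Qed.

(** Jensen's inequality, by the tangent of [x `^ p] at [|f 0|]. The measure of
    the disk enters through its lower bound [r ^ 2] only. *)
Lemma submean p : 1 <= p -> ((modulus (f 0) `^ p * r ^+ 2)%:E <=
  \int[leb2]_(w in plane_ball r) (modulus (f (of_plane w)) `^ p)%:E)%E.
Proof.
move=> p1; have p0 : 0 < p by lra.
have mB := measurable_plane_ball r.
have [f00|] := eqVneq (modulus (f 0)) 0.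
  rewrite f00 powR0 ?gt_eqF// mul0r; apply: integral_ge0 => w _.
  by rewrite lee_fin powR_ge0.
set c := modulus (f 0) => c0; have {}c0 : 0 < c by rewrite lt_neqAle eq_sym c0 modulus_ge0.
have mr : r ^+ 2 <= m by rewrite -lee_fin -mE plane_ball_measure_ge.
have mf : measurable_fun (plane_ball r) (fun w : plane => modulus (f (of_plane w))).
  exact: measurable_modulus.
have mfp : measurable_fun (plane_ball r)
    (fun w : plane => modulus (f (of_plane w)) `^ p).
  exact: (measurableT_comp (measurable_powR p) mf).
have k0 : 0 <= c `^ p * (p / c) by rewrite mulr_ge0 ?powR_ge0// divr_ge0 ?ltW.
have q0 : 0 <= (p - 1) * c `^ p by rewrite mulr_ge0 ?powR_ge0// subr_ge0.
have : ((c `^ p * (p / c))%:E * \int[leb2]_(w in plane_ball r) (modulus (f (of_plane w)))%:E <=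
   \int[leb2]_(w in plane_ball r) (modulus (f (of_plane w)) `^ p)%:E
   + ((p - 1) * c `^ p)%:E * m%:E)%E.
  rewrite -ge0_integralZl_EFin//; last 2 first.
  - by move=> w _; rewrite lee_fin modulus_ge0.
  - exact/measurable_EFinP.
  rewrite -mE -integral_cst// -ge0_integralD//; last 2 first.
  - by move=> w _; rewrite lee_fin powR_ge0.
  - exact/measurable_EFinP.
  apply: le_integral_ge0 => w wr.
  - by rewrite -EFinM lee_fin mulr_ge0 ?modulus_ge0.
  - by rewrite adde_ge0 ?lee_fin ?powR_ge0.
  - by split=> //; rewrite -EFinM -EFinD lee_fin powR_tangent ?modulus_ge0.
have [->|I] := eqVneq (\int[leb2]_(w in plane_ball r)
  (modulus (f (of_plane w)) `^ p)%:E)%E +oo%E; first by move=> _; rewrite leey.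
have Ifin : (\int[leb2]_(w in plane_ball r)
    (modulus (f (of_plane w)) `^ p)%:E)%E \is a fin_num.
  rewrite ge0_fin_numE ?ltey//; apply: integral_ge0 => w _.
  by rewrite lee_fin powR_ge0.
rewrite -(fineK Ifin); set J := fine _ => H.
have : ((c `^ p * (p / c))%:E * (c * m)%:E <= J%:E + ((p - 1) * c `^ p)%:E * m%:E)%E.
  by apply: le_trans H; rewrite lee_wpmul2l ?lee_fin// submean1.
rewrite -!EFinM -EFinD !lee_fin => {}H.
apply: (@le_trans _ _ (c `^ p * m)); first by rewrite ler_wpM2l// powR_ge0.
have E : c `^ p * (p / c) * (c * m) = p * (c `^ p * m) by field; rewrite gt_eqF.
by move: H; rewrite E; lra.
Qed.

End submean.
End mean_value.

(** * Carleson boxes and approach regions *)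

Section geometry.
Variable R : realType.
Implicit Types (z w u v : R[i]) (r d s t theta zeta : R).

Lemma lipschitz1_derive (f df : R -> R) :
  (forall x : R, is_derive x 1 f (df x)) -> (forall x, `|df x| <= 1) ->
  forall a b, `|f b - f a| <= `|b - a|.
Proof.
move=> fdf df1 a b; wlog ab : a b / a <= b.
  move=> H; have [/H//|/ltW/H] := leP a b.
  by rewrite distrC [leRHS]distrC.
have cf : {within `[a, b], continuous f}.
  apply: continuous_subspaceT => x.
  by apply: differentiable_continuous; apply/derivable1_diffP; case: (fdf x).
have [c _ ->] := MVT_segment ab (fun x _ => fdf x) cf.
by rewrite normrM ler_piMl.
Qed.

Lemma normr_sin_le1 t : `|sin t : R| <= 1.
Proof. by rewrite ler_norml sin_geN1 sin_le1. Qed.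

Lemma normr_cos_le1 t : `|cos t : R| <= 1.
Proof. by rewrite ler_norml cos_geN1 cos_le1. Qed.

Lemma cis_lipschitz s t : modulus (cis t - cis s : R[i]) <= 2 * `|t - s|.
Proof.
rewrite (le_trans (modulus_le_ReIm _))//= mulr_natl mulr2n lerD//.
  apply: (@lipschitz1_derive _ (fun x => - sin x)) => x.
  by rewrite normrN normr_sin_le1.
by apply: lipschitz1_derive => x; exact: normr_cos_le1.
Qed.

Lemma normr_atan_le t : `|atan t : R| <= `|t|.
Proof.
have := @lipschitz1_derive atan (fun x => (1 + x ^+ 2)^-1) _ _ 0 t.
rewrite atan0 !subr0; apply => x.
have x2 := sqr_ge0 x.
rewrite ger0_norm ?invr_ge0 ?addr_ge0// invf_le1 ?lerDl//.
by rewrite ltr_pwDl.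
Qed.

Lemma atan_polar (x y : R) : 0 < x ->
  x +i* y = (modulus (x +i* y))%:C * cis (atan (y / x)).
Proof.
move=> x0; set k := Num.sqrt (1 + (y / x) ^+ 2).
have k2 : 0 < 1 + (y / x) ^+ 2 by rewrite ltr_pwDl// sqr_ge0.
have k0 : 0 < k by rewrite sqrtr_gt0.
have mE : modulus (x +i* y) = x * k.
  apply/eqP; rewrite -(eqrXn2 (ltn0Sn 1)) ?modulus_ge0 ?mulr_ge0 ?ltW//.
  rewrite sqr_modulus /= exprMn sqr_sqrtr ?ltW// mulrDr mulr1 expr_div_n.
  by rewrite mulrC divfK// sqrf_eq0 gt_eqF.
have cE : cos (atan (y / x)) = k^-1 by rewrite cos_atan.
have sE : sin (atan (y / x)) = y / x / k.
  have kn : k != 0 by rewrite gt_eqF.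
  have : tan (atan (y / x)) = y / x by rewrite atanK.
  by rewrite /tan cE invrK => H; apply: (mulIf kn); rewrite H divfK.
rewrite mE /cis cE sE; apply/eqP; rewrite eq_complex /= !mul0r subr0 addr0.
by apply/andP; split; apply/eqP; field; rewrite ?gt_eqF.
Qed.

Lemma polar_form z : exists2 theta, 0 <= theta < pi *+ 2 &
  z = (modulus z)%:C * cis theta.
Proof.
have [z0|z0] := eqVneq (modulus z) 0.
  exists 0; first by rewrite lexx mulrn_wgt0// pi_gt0.
  by rewrite z0 (modulus_eq0 z0) mul0r.
have m0 : 0 < modulus z by rewrite lt_neqAle eq_sym z0 modulus_ge0.
pose x := complex.Re z / modulus z; pose y := complex.Im z / modulus z.
have xy : x ^+ 2 + y ^+ 2 = 1.
  rewrite !expr_div_n -mulrDl -sqr_modulus mulfV// sqrf_eq0//.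
have x1 : -1 <= x <= 1 by apply/andP; split; nra.
have zE theta : cos theta = x -> sin theta = y -> z = (modulus z)%:C * cis theta.
  move=> cE sE; apply/eqP; rewrite eq_complex /= !mul0r subr0 addr0 cE sE.
  by rewrite /x /y ![modulus z * _]mulrC !divfK// !eqxx.
have cE : cos (acos x) = x by rewrite acosK// in_itv.
have sE : sin (acos x) = `|y|.
  by rewrite sin_acos// -xy addrAC subrr add0r sqrtr_sqr.
have a0 : 0 <= acos x by rewrite acos_ge0.
have api : acos x <= pi by rewrite acos_lepi.
have pi0 := pi_gt0 R.
have [y0|y0] := leP 0 y.
  exists (acos x); first by rewrite a0 mulr2n /=; lra.
  by apply: zE => //; rewrite sE ger0_norm.
exists (pi *+ 2 - acos x).
  have ap : 0 < acos x.
    rewrite lt_neqAle a0 andbT eq_sym; apply/eqP => a00.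
    move: sE; rewrite a00 sin0 => /esym/eqP; rewrite normr_eq0.
    by rewrite lt_eqF.
  by rewrite mulr2n; lra.
apply: zE; rewrite [pi *+ 2 - _]addrC.
  by rewrite cosD2pi cosN.
by rewrite sinD2pi sinN sE ltr0_norm ?opprK.
Qed.

(** The radial and the angular extent of a box are at most [1 - |u|]. *)
Lemma carleson_box_sub u z : disk u -> carleson_box u z ->
  disk z /\ modulus (z - u) <= 2 * (1 - modulus u).
Proof.
rewrite /disk /= => u1; rewrite /carleson_box; case: eqVneq => [u0|u0].
  have um : modulus u = 0 by rewrite u0; exact: modulus0.
  by rewrite /disk /= => z1; rewrite um u0 subr0; split=> //; lra.
move=> [theta [t [lambda [uE zE ttheta lu l1]]]].
have m0 := modulus_ge0 u.
have l0 : 0 <= lambda by lra.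
have zl : modulus z = lambda.
  by rewrite zE modulusM modulus_cis mulr1 modulus_real ger0_norm.
split; first by rewrite zl.
rewrite (le_trans (modulusB_triangle ((modulus u)%:C * cis t) _ _))//.
rewrite {1}zE -mulrBl modulusM modulus_cis mulr1 -rmorphB modulus_real.
rewrite [X in _ - X]uE -mulrBr modulusM modulus_real (ger0_norm m0).
have := cis_lipschitz theta t => H.
have : modulus u * modulus (cis t - cis theta) <= 1 * (2 * `|t - theta|).
  by rewrite ler_pM// ?modulus_ge0// ltW.
by move=> H2; rewrite ger0_norm; lra.
Qed.

(** Conversely the box of [(1 - 2 d) e^(i theta)] contains a disk of radius
    comparable to [d] around [(1 - d) e^(i theta)]: such a disk is seen from the
    origin under a small angle, which is estimated by an arctangent. *)
Lemma ball_sub_carleson_box theta d v : 0 < d -> d < 1 / 4 -> modulus v < d / 4 ->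
  carleson_box ((1 - 2 * d)%:C * cis theta) ((1 - d)%:C * cis theta + v).
Proof.
move=> d0 d1 vd; set u := _ * _; set z := _ + v.
have um : modulus u = 1 - 2 * d.
  by rewrite modulusM modulus_cis mulr1 modulus_real ger0_norm; lra.
rewrite /carleson_box ifF; last by rewrite -[_ == 0]negbK -modulus_gt0 um; apply/negbF; lra.
have cc : cis (- theta) * cis theta = 1 :> R[i] by rewrite -cisD addNr cis0.
pose w := cis (- theta) * v.
have wm : modulus w = modulus v by rewrite modulusM modulus_cis mul1r.
have wR := normr_Re_le w; have wI := normr_Im_le w.
rewrite !ler_norml wm in wR wI.
pose x := 1 - d + complex.Re w; pose y := complex.Im w.
have x0 : 1 / 2 < x by move/andP: wR => [? ?]; rewrite /x; lra.
have xy : x +i* y = cis (- theta) * z.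
  rewrite /z mulrDr mulrCA cc mulr1 -/w /x /y; case: (w) => a b.
  by apply/eqP; rewrite eq_complex /= add0r !eqxx.
have zE : z = (modulus z)%:C * cis (theta + atan (y / x)).
  have mz : modulus (x +i* y) = modulus z by rewrite xy modulusM modulus_cis mul1r.
  have := @atan_polar x y; rewrite mz => /(_ _)H.
  rewrite cisD mulrCA -H; last by lra.
  by rewrite xy mulrA [cis theta * _]mulrC cc mul1r.
have zlo : 1 - d - d / 4 < modulus z.
  have := modulusB_ge ((1 - d)%:C * cis theta) (- v).
  rewrite opprK modulusN modulusM modulus_cis mulr1 modulus_real ger0_norm; last by lra.
  by rewrite -/z; lra.
have zhi : modulus z < 1 - d + d / 4.
  rewrite (le_lt_trans (modulusD _ _))// modulusM modulus_cis mulr1 modulus_real.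
  by rewrite ger0_norm ?ltrD2l//; lra.
exists theta, (theta + atan (y / x)), (modulus z); rewrite um; split=> //; last 2 first.
- by lra.
- by lra.
rewrite addrC addKr (le_trans (normr_atan_le _))// normrM normfV.
rewrite [`|x|]gtr0_norm ?ler_pdivrMr; [|lra|lra].
have : `|y| <= d / 4 by rewrite ler_norml; move/andP: wI => [? ?]; apply/andP; split; lra.
by nra.
Qed.

(** Since [zeta > 1 / 2], the region of [cis t] contains the point of argument
    [theta] for all [t] in an arc around [theta]. The bound on [|t - theta|] is
    half the slack [zeta * (1 - |u| ^ 2) - |u - cis theta|]. *)
Lemma Gamma_arc zeta theta d t : 0 < d -> d < 1 / 4 ->
  d < 1 - 1 / (2 * zeta) -> 1 / 2 < zeta ->
  `|t - theta| < (2 * zeta * (1 - d) - 1) * d ->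
  Gamma zeta (cis t) ((1 - 2 * d)%:C * cis theta).
Proof.
move=> d0 d1 dz z2 tt; set u := _ * _.
have um : modulus u = 1 - 2 * d.
  by rewrite modulusM modulus_cis mulr1 modulus_real ger0_norm; lra.
split; first by rewrite /disk /mkset um; lra.
rewrite um (le_lt_trans (modulusB_triangle (cis theta) _ _))//.
have -> : modulus (u - cis theta) = 2 * d.
  rewrite /u -[X in _ - X]mul1r -mulrBl modulusM modulus_cis mulr1.
  rewrite -(rmorph1 (real_complex R)) -rmorphB modulus_real ler0_norm; lra.
have := cis_lipschitz t theta; rewrite distrC => H.
have : modulus (cis theta - cis t) < 2 * ((2 * zeta * (1 - d) - 1) * d).
  by apply: le_lt_trans H _; rewrite ltr_pM2l.
by nra.
Qed.

Lemma Gamma_arc_gt0 zeta d : 0 < d -> d < 1 - 1 / (2 * zeta) -> 1 / 2 < zeta ->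
  0 < (2 * zeta * (1 - d) - 1) * d.
Proof.
move=> d0 dz z2; rewrite mulr_gt0// subr_gt0.
have z0 : 0 < 2 * zeta by lra.
by rewrite mulrC -ltr_pdivrMr// ltrBrDl -ltrBrDr.
Qed.

End geometry.

(** * Growth of functions of finite tent norm *)

Lemma powRDgt0 (R : realType) (x r s : R) : 0 < x ->
  x `^ (r + s) = x `^ r * x `^ s.
Proof. by move=> x0; rewrite powRD//; apply/implyP => _; rewrite gt_eqF. Qed.

(** A power is monotone in its base, in the sense given by the sign of [e]. *)
Lemma powR_ge_min (R : realType) (l x h e : R) : 0 < l -> l <= x <= h ->
  Num.min (l `^ e) (h `^ e) <= x `^ e.
Proof.
move=> l0 /andP[lx xh]; have x0 : 0 < x by exact: lt_le_trans lx.
have h0 : 0 < h by exact: lt_le_trans xh.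
have l1 := ltW l0; have x1 := ltW x0; have h1 := ltW h0.
rewrite ge_min; apply/orP; have [e0|/ltW e0] := leP 0 e; [left|right].
  by apply: ge0_ler_powR.
rewrite -[e]opprK [leRHS]powRN powRN lef_pV2 ?posrE ?powR_gt0//.
by apply: ge0_ler_powR; rewrite ?oppr_ge0.
Qed.

Lemma avg_bound_alg (R : realType) (K x Y d P D : R) : P != 0 -> D != 0 ->
  D^-1 * (P^-1 * (K * x * (Y * (d / 4) ^+ 2))) = (K * x * Y / P / 16) * (d ^+ 2 / D).
Proof. by move=> P0 D0; field; rewrite P0 D0. Qed.

Lemma avg_bound_alg2 (R : realType) (K x Y d P : R) : P != 0 ->
  K / (64 * P) * (x * d) * Y = (K * x * Y / P / 16) * (d / 4).
Proof. by move=> P0; field; rewrite P0. Qed.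

Section growth.
Variable R : realType.
Local Notation leb := (@lebesgue_measure R).
Local Notation plane := (measurableTypeR R * measurableTypeR R)%type.
Local Notation leb2 := (leb \x leb)%E.

(** An arc has positive length, so that it meets the complement of every null
    set. *)
Lemma ess_sup_arc_ge (theta eps : R) (c : \bar R) (f : R -> \bar R) :
  0 <= theta < pi *+ 2 -> 0 < eps ->
  (forall t, `|t - theta| < eps -> (c <= f t)%E) ->
  (c <= ess_sup (arc_length R) f)%E.
Proof.
move=> /andP[th0 th1] eps0 cf; rewrite leNgt; apply/negP => lt_c.
have [N [mN N0 subN]] := ess_sup_ge (arc_length R) f.
pose e := Num.min (theta + eps) (pi *+ 2).
have the : theta < e by rewrite lt_min ltrDl eps0.
have IN : `[theta, e[ `<=` N.
  move=> t /=; rewrite in_itv /= lt_min => /andP[tt /andP[te _]]; apply: subN => /=.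
  apply/negP; rewrite -ltNge; apply: lt_le_trans lt_c (cf _ _).
  by rewrite ger0_norm; lra.
have : (arc_length R `[theta, e[%classic <= arc_length R N)%E.
  by apply: le_measure => //; rewrite ?inE.
rewrite N0 /arc_length /= /mrestr setIidl; last first.
  move=> t /=; rewrite !in_itv /= lt_min => /andP[t0 /andP[_ ->]].
  by rewrite andbT (le_trans th0).
by rewrite lebesgue_measure_itv /= lte_fin the -EFinB lee_fin subr_le0 leNgt the.
Qed.

Definition carleson_avg (p alpha : R) (F : R[i] -> R[i]) (u : R[i]) : \bar R :=
  (((1 - modulus u ^+ 2)^-1)%:E *
   \int[area R]_(w in [set w : R * R | carleson_box u (of_plane w)])
     (modulus (F (of_plane w)) `^ p *
      (1 - modulus (of_plane w) ^+ 2) `^ (alpha + 1))%:E)%E.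

Lemma tent_norm_ge (zeta p alpha : R) F (d theta v : R) :
  0 < p -> 1 / 2 < zeta -> 0 <= theta < pi *+ 2 -> 0 <= v ->
  0 < d -> d < 1 / 4 -> d < 1 - 1 / (2 * zeta) ->
  (v%:E <= carleson_avg p alpha F ((1 - 2 * d)%:C * cis theta)%R)%E ->
  ((v `^ p^-1)%:E <= tent_norm zeta p alpha F)%E.
Proof.
move=> p0 z2 th v0 d0 d1 dz vle.
have eps0 := Gamma_arc_gt0 d0 dz z2.
rewrite -poweR_EFin /tent_norm; set E := ess_sup _ _.
have vE : (v%:E <= E)%E.
  apply: (ess_sup_arc_ge th eps0) => t tt.
  apply: le_trans vle _; apply: ereal_sup_ubound.
  exists ((1 - 2 * d)%:C * cis theta) => //.
  exact: Gamma_arc.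
apply: gt0_ler_poweR => //; first by rewrite invr_ge0 ltW.
  by rewrite in_itv /= leey andbT lee_fin.
by rewrite in_itv /= leey andbT (le_trans _ vE)// lee_fin.
Qed.

Lemma integral_area_ge0 (D : set plane) (f : plane -> \bar R) :
  measurable D -> measurable_fun D f -> (forall w, D w -> 0 <= f w)%E ->
  (\int[area R]_(w in D) f w = (pi^-1)%:E * \int[leb2]_(w in D) f w)%E.
Proof. by move=> mD mf f0; rewrite /area ge0_integral_mscale. Qed.

(** The box of [(1 - 2 d) e^(i theta)] contains a disk around [z] on which
    [1 - |w| ^ 2] is comparable to [d], and [|F| ^ p] is subharmonic there. *)
Lemma carleson_avg_ge (p alpha : R) F z b rho d theta sg : 1 <= p ->
  0 < d -> d < 1 / 4 -> 0 < sg <= 1 -> z = (1 - d)%:C * cis theta ->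
  pseries b (fun v => F (z + v)) rho -> sg * (d / 4) < rho ->
  ((Num.min ((3 / 4) `^ (alpha + 1)) ((5 / 2) `^ (alpha + 1)) / (64 * pi) *
    sg ^+ 2 * d `^ (alpha + 2) * modulus (F z) `^ p)%:E <=
   carleson_avg p alpha F ((1 - 2 * d)%:C * cis theta)%R)%E.
Proof.
move=> p1 d0 d1 /andP[sg0 sg1] zE bF drho; have p0 : 0 < p by lra.
have pi0 := pi_gt0 R.
set kap := Num.min _ _; set u := _ * cis theta.
have kap0 : 0 < kap by rewrite lt_min !powR_gt0.
have um : modulus u = 1 - 2 * d.
  by rewrite modulusM modulus_cis mulr1 modulus_real ger0_norm; lra.
have zm : modulus z = 1 - d.
  by rewrite zE modulusM modulus_cis mulr1 modulus_real ger0_norm; lra.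
rewrite /carleson_avg um.
pose z' : plane := (complex.Re z, complex.Im z).
have [r [r0 rd rE]] : exists r, [/\ 0 < r, r <= d / 4 & r = sg * (d / 4)].
  have d40 : 0 < d / 4 by lra.
  by exists (sg * (d / 4)); rewrite mulr_gt0// ler_piMl// ltW.
rewrite -rE in drho.
pose T : set plane := [set w | modulus (of_plane w - z) < r].
pose g (w : plane) := modulus (F (of_plane w)) `^ p.
pose k := kap * d `^ (alpha + 1).
have k0 : 0 <= k by rewrite mulr_ge0 ?powR_ge0// ltW.
pose tr (w : plane) : plane := (w.1 + - z'.1, w.2 + - z'.2).
have trE w : of_plane (tr w) = of_plane w - z.
  by rewrite /tr /of_plane /z' /=; case: (z) => x y; apply/eqP; rewrite eq_complex /= !eqxx.
have mtr : measurable_fun setT tr.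
  by apply: measurable_fun_pair; apply: measurable_funD.
have TE : T = tr @^-1` (plane_ball r).
  by apply/seteqP; split => w; rewrite /T /plane_ball /preimage /mkset trE.
have mT : measurable T.
  by rewrite TE -[X in measurable X]setTI; exact: mtr (measurable_plane_ball r).
have cmF : cmeasurable (plane_ball r) (fun w : plane => F (z + of_plane w)).
  by apply: (@pseries_measurable _ b (fun v => F (z + v))); apply: pseriesW bF; exact: ltW.
pose g0 (w : plane) := (modulus (F (z + of_plane w)) `^ p)%:E.
have mg0 : measurable_fun setT (g0 \_ (plane_ball r)).
  apply/(measurable_restrictT _ (measurable_plane_ball r)).
  apply/measurable_EFinP; apply: (measurableT_comp (measurable_powR p)).
  exact: measurable_modulus.
have gE : (fun w => (g w)%:E) \_ T = (g0 \_ (plane_ball r)) \o tr.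
  apply/funext => w /=; rewrite !patchE TE.
  rewrite (_ : (w \in tr @^-1` plane_ball r) = (tr w \in plane_ball r)); last first.
    by apply/idP/idP => /set_mem ?; apply/mem_set.
  by case: ifPn => // _; rewrite /g0 trE addrC subrK.
have mg : measurable_fun T (fun w => (g w)%:E).
  apply/(measurable_restrictT _ mT); rewrite gE.
  exact: measurableT_comp.
have box_ge w : T w -> carleson_box u (of_plane w) /\
    k <= (1 - modulus (of_plane w) ^+ 2) `^ (alpha + 1).
  rewrite /T /mkset => wr; split.
    by rewrite -[of_plane w](subrK z) addrC zE; apply: ball_sub_carleson_box => //; rewrite -zE (lt_le_trans wr).
  have h1 := modulusB_ge (of_plane w) z; have h2 := modulusB_ge z (of_plane w).
  rewrite modulusBC zm in h2; rewrite zm in h1.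
  set D := 1 - _.
  have Dd : 3 / 4 * d <= D <= 5 / 2 * d.
    by move: wr h1 h2; rewrite /D; set q := modulus _ => *; apply/andP; split; nra.
  have Dd' : 3 / 4 <= D / d <= 5 / 2 by rewrite ler_pdivlMr// ler_pdivrMr.
  have h34 : 0 < 3 / 4 :> R by lra.
  have kD := powR_ge_min (alpha + 1) h34 Dd'; rewrite -/kap in kD.
  have -> : D `^ (alpha + 1) = (D / d) `^ (alpha + 1) * d `^ (alpha + 1).
    rewrite -powRM ?divfK ?gt_eqF ?(ltW d0)// divr_ge0 ?(ltW d0)//; lra.
  by rewrite ler_wpM2r ?powR_ge0.
have low : ((pi^-1)%:E * (k%:E * (modulus (F z) `^ p * r ^+ 2)%:E) <=
   \int[area R]_(w in [set w : R * R | carleson_box u (of_plane w)])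
     (modulus (F (of_plane w)) `^ p *
      (1 - modulus (of_plane w) ^+ 2) `^ (alpha + 1))%:E)%E.
  apply: (@le_trans _ _ (\int[area R]_(w in T) (k%:E * (g w)%:E))%E); last first.
    apply: le_integral_ge0 => w wT.
    - by rewrite -EFinM lee_fin mulr_ge0 ?powR_ge0.
    - by rewrite lee_fin mulr_ge0 ?powR_ge0.
    - have [wb kw] := box_ge w wT; split=> //.
      by rewrite -EFinM lee_fin mulrC ler_wpM2l ?powR_ge0.
  rewrite integral_area_ge0//; last 2 first.
  - exact: measurable_funeM.
  - by move=> w _; rewrite -EFinM lee_fin mulr_ge0 ?powR_ge0.
  rewrite ge0_integralZl_EFin//; last by move=> w _; rewrite lee_fin powR_ge0.
  apply: lee_wpmul2l; first by rewrite lee_fin invr_ge0 ltW.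
  apply: lee_wpmul2l; first by rewrite lee_fin.
  rewrite integral_mkcond gE /comp.
  rewrite (@integral_plane_translation _ (- z'.1, - z'.2) (g0 \_ (plane_ball r)))//; last first.
    by move=> w; rewrite patchE; case: ifPn => // _; rewrite lee_fin powR_ge0.
  rewrite -integral_mkcond.
  have := submean bF r0 drho p1; rewrite addr0; exact.
have D0 : 0 < 1 - (1 - 2 * d) ^+ 2 by nra.
apply: le_trans (lee_wpmul2l _ low); last by rewrite lee_fin invr_ge0 ltW.
rewrite -!EFinM lee_fin.
have dE : d `^ (alpha + 2) = d `^ (alpha + 1) * d.
  rewrite (_ : alpha + 2 = alpha + 1 + 1); last by ring.
  by rewrite powRDgt0// powRr1// ltW.
set Y := modulus (F z) `^ p; have Y0 : 0 <= Y by exact: powR_ge0.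
rewrite dE /k rE; set x := d `^ (alpha + 1).
have -> : kap / (64 * pi) * sg ^+ 2 * (x * d) * Y =
    sg ^+ 2 * (kap / (64 * pi) * (x * d) * Y) by ring.
have -> : (1 - (1 - 2 * d) ^+ 2)^-1 * (pi^-1 * (kap * x * (Y * (sg * (d / 4)) ^+ 2))) =
    sg ^+ 2 * ((1 - (1 - 2 * d) ^+ 2)^-1 * (pi^-1 * (kap * x * (Y * (d / 4) ^+ 2)))).
  by rewrite exprMn; ring.
apply: ler_wpM2l; first by rewrite exprn_ge0// ltW.
rewrite avg_bound_alg ?gt_eqF// avg_bound_alg2 ?gt_eqF//.
rewrite ler_wpM2l//.
  by rewrite !mulr_ge0 ?powR_ge0 ?invr_ge0 ?ltW.
by rewrite ler_pdivlMr//; nra.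
Qed.

(** The factor [sg] shrinks the disk of subharmonicity, for functions of which
    only a local expansion at [z] of small radius is known; the price is a
    larger constant [C]. *)
Lemma growth (zeta p alpha : R) : 1 <= p -> 1 / 2 < zeta ->
  exists2 d0 : R, 0 < d0 & forall sg : R, 0 < sg <= 1 -> exists2 C : R, 0 < C &
    forall F z b rho M,
    1 - d0 < modulus z < 1 -> pseries b (fun v => F (z + v)) rho ->
    sg * ((1 - modulus z) / 4) < rho -> (tent_norm zeta p alpha F <= M%:E)%E ->
    modulus (F z) <= C * M * (1 - modulus z) `^ (- ((alpha + 2) / p)).
Proof.
move=> p1 z2; have p0 : 0 < p by lra.
have pi0 := pi_gt0 R.
exists (Num.min (1 / 4) (1 - 1 / (2 * zeta))).
  by rewrite lt_min divr_gt0//= subr_gt0 ltr_pdivrMr; lra.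
move=> sg sg01; have [sg0 _] := andP sg01.
have [c1 c10 c1E] : exists2 c1, 0 < c1 & c1 =
    Num.min ((3 / 4) `^ (alpha + 1)) ((5 / 2) `^ (alpha + 1)) / (64 * pi) * sg ^+ 2.
  by eexists; last reflexivity; rewrite mulr_gt0 ?exprn_gt0// divr_gt0 ?lt_min ?powR_gt0 ?mulr_gt0.
exists (c1 `^ (- p^-1)); first by rewrite powR_gt0.
move=> F z b rho M /andP[zd z1] bF rho1 NM.
have [theta th zE] := polar_form z.
pose d := 1 - modulus z.
have d0 : 0 < d by rewrite subr_gt0.
have [d1 d2] : d < 1 / 4 /\ d < 1 - 1 / (2 * zeta).
  by apply/andP; rewrite -lt_min /d; lra.
have zE' : z = (1 - d)%:C * cis theta by rewrite /d subKr.
have v0 : 0 <= c1 * d `^ (alpha + 2) * modulus (F z) `^ p.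
  by rewrite !mulr_ge0 ?powR_ge0 ?modulus_ge0// ltW.
have avg := carleson_avg_ge alpha p1 d0 d1 sg01 zE' bF rho1; rewrite -c1E in avg.
have := tent_norm_ge p0 z2 th v0 d0 d1 d2 avg.
move=> /le_trans/(_ NM); rewrite lee_fin.
rewrite !powRM ?mulr_ge0 ?powR_ge0 ?(ltW c10)// -!powRrM mulfV ?gt_eqF//.
rewrite powRr1 ?modulus_ge0// => H.
set y := modulus (F z) in H *.
have dn : d `^ ((alpha + 2) / p) != 0 by rewrite gt_eqF// powR_gt0.
have cn : c1 `^ p^-1 != 0 by rewrite gt_eqF// powR_gt0.
have -> : y = c1 `^ (- p^-1) * (c1 `^ p^-1 * d `^ ((alpha + 2) / p) * y) *
    d `^ (- ((alpha + 2) / p)).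
  rewrite !powRN; move: cn dn; set X := c1 `^ _; set Y := d `^ _ => X0 Y0.
  by rewrite -[X * Y * y]mulrA mulKf// [Y * y]mulrC mulfK.
by rewrite ler_wpM2r ?powR_ge0// ler_wpM2l ?powR_ge0.
Qed.

End growth.

(** * Dyadic integration *)

Section dyadic.
Variable R : realType.
Implicit Types (x y q g h : R).

Lemma expr2_unbounded (x : R) : exists n : nat, x < 2 ^+ n.
Proof.
have [m xm] : exists m : nat, x < m%:R.
  by exists (Num.truncn x).+1; exact: truncnS_gt.
exists m; apply: lt_trans xm _; rewrite -natrX ltr_nat; exact: ltn_expl.
Qed.

Lemma dyadic_floor x : 1 <= x -> exists k : nat, 2 ^+ k <= x < 2 ^+ k.+1.
Proof.
move=> x1; have := expr2_unbounded x => ex.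
have [[|k] xk min] := ex_minnP ex.
  by move: xk; rewrite expr0 ltNge x1.
exists k; rewrite xk andbT leNgt; apply/negP => /min.
by rewrite ltnn.
Qed.

Lemma dyadic_ceil x : 1 < x -> exists k : nat, 2 ^+ k < x <= 2 ^+ k.+1.
Proof.
move=> x1; have [m xm] := expr2_unbounded x.
have ex : exists n : nat, x <= 2 ^+ n by exists m; exact: ltW.
have [[|k] xk min] := ex_minnP ex.
  by move: xk; rewrite expr0 leNgt x1.
exists k; rewrite xk andbT ltNge; apply/negP => /min.
by rewrite ltnn.
Qed.

Lemma geometric_sum_le q n : 0 <= q -> q < 1 -> \sum_(k < n) q ^+ k <= (1 - q)^-1.
Proof.
move=> q0 q1; have q1' : 0 < 1 - q by rewrite subr_gt0.
rewrite -(ler_pM2l q1') mulfV ?gt_eqF//.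
have -> : (1 - q) * \sum_(k < n) q ^+ k = 1 - q ^+ n.
  by rewrite -[1 - q]opprB mulNr -subrX1 opprB.
by rewrite lerBlDr lerDl exprn_ge0.
Qed.

(** Sums of the geometric series met on the shells [h / 2^(k+1) < v <= h / 2^k]
    and [h * 2^k < v <= h * 2^(k+1)]. *)
Definition near_const g := 2 `^ g / (1 - 2 `^ (g - 1)).
Definition far_const b : R := 2 / (1 - 2 `^ (- b)).

Lemma powR2_lt1 g : g < 0 -> (2 : R) `^ g < 1.
Proof.
move=> g0; rewrite -(powRr0 (2 : R)) -[ltLHS]opprK -[ltRHS]opprK.
have : ((2 : R) `^ (- g))^-1 < 1; last by rewrite -powRN !opprK powRr0.
rewrite invf_lt1 ?powR_gt0//.
have := @gt0_ltr_powR R (- g); rewrite oppr_gt0 => /(_ g0) /(_ 1 2).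
by rewrite !nnegrE ler01 ler0n powR1 => /(_ isT isT); apply; rewrite ltr1n.
Qed.

Lemma near_const_gt0 g : g < 1 -> 0 < near_const g.
Proof.
move=> g1; rewrite divr_gt0 ?powR_gt0// subr_gt0 powR2_lt1//.
by rewrite subr_lt0.
Qed.

Lemma far_const_gt0 b : 0 < b -> 0 < far_const b.
Proof.
by move=> b0; rewrite divr_gt0// subr_gt0 powR2_lt1// oppr_lt0.
Qed.

Lemma powR_2n r n : (2 ^+ n : R) `^ r = (2 `^ r) ^+ n.
Proof. by rewrite -!powR_mulrn ?powR_ge0// -!powRrM mulrC. Qed.

Lemma near_sum g h C n : 0 <= g -> g < 1 -> 0 < h -> 0 <= C ->
  \sum_(k < n) (h / 2 ^+ k.+1) `^ (- g) * (C * (h / 2 ^+ k)) <=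
  C * near_const g * h `^ (1 - g).
Proof.
move=> g0 g1 h0 C0.
have q1 : (2 : R) `^ (g - 1) < 1 by rewrite powR2_lt1// subr_lt0.
have E (k : nat) : (h / 2 ^+ k.+1) `^ (- g) * (C * (h / 2 ^+ k)) =
    C * h `^ (1 - g) * 2 `^ g * (2 `^ (g - 1)) ^+ k.
  have e2 (m : nat) : 0 < (2 : R) ^+ m by rewrite exprn_gt0.
  rewrite powRM ?invr_ge0 ?(ltW h0) ?(ltW (e2 _))//.
  rewrite -[(2 ^+ k.+1)^-1]powR_inv1 ?(ltW (e2 _))// -powRrM mulN1r opprK powR_2n.
  rewrite (_ : 1 - g = - g + 1); last by ring.
  rewrite (powRDgt0 _ _ h0) (powRr1 (ltW h0)).
  rewrite (powRDgt0 g (-1)) // powR_inv1 ?ler0n// exprMn exprVn exprS.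
  by ring.
under eq_bigr do rewrite E.
rewrite -mulr_sumr (_ : C * near_const g * h `^ (1 - g) =
  C * h `^ (1 - g) * 2 `^ g * (1 - 2 `^ (g - 1))^-1); last first.
  by rewrite /near_const; ring.
apply: ler_wpM2l; first by rewrite !mulr_ge0 ?powR_ge0.
exact: geometric_sum_le (powR_ge0 _ _) q1.
Qed.

Lemma far_sum b h C n : 0 < b -> 0 < h -> 0 <= C ->
  \sum_(k < n) (h * 2 ^+ k) `^ (- (1 + b)) * (C * (h * 2 ^+ k.+1)) <=
  C * far_const b * h `^ (- b).
Proof.
move=> b0 h0 C0.
have q1 : (2 : R) `^ (- b) < 1 by rewrite powR2_lt1// oppr_lt0.
have E (k : nat) : (h * 2 ^+ k) `^ (- (1 + b)) * (C * (h * 2 ^+ k.+1)) =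
    C * h `^ (- b) * 2 * (2 `^ (- b)) ^+ k.
  have e2 (m : nat) : 0 < (2 : R) ^+ m by rewrite exprn_gt0.
  have hk : 0 < h * 2 ^+ k by rewrite mulr_gt0.
  rewrite (_ : - (1 + b) = - b - 1); last by ring.
  rewrite (powRDgt0 _ _ hk) powR_inv1 ?(ltW hk)// powRM ?(ltW h0) ?(ltW (e2 _))//.
  rewrite powR_2n exprS; move: hk; set y := h * 2 ^+ k => hk.
  rewrite (_ : h * (2 * 2 ^+ k) = 2 * y); last by rewrite /y mulrCA.
  by rewrite [2 * y]mulrC; move: (gt_eqF hk) => /negbT yn; field.
under eq_bigr do rewrite E.
rewrite -mulr_sumr (_ : C * far_const b * h `^ (- b) =
  C * h `^ (- b) * 2 * (1 - 2 `^ (- b))^-1); last first.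
  by rewrite /far_const; ring.
apply: ler_wpM2l; first by rewrite !mulr_ge0 ?powR_ge0.
exact: geometric_sum_le (powR_ge0 _ _) q1.
Qed.

End dyadic.

Section layers.
Context d (T : measurableType d) (R : realType) (mu : {measure set T -> \bar R}).

(** The function [g] lies below the double sum of [c j * c' k] over the shells
    [S j k], which is integrated term by term. The measures being bounded by
    products, the result is a product of two simple sums. *)
Lemma integral_shells2 (A : set T) (g : T -> \bar R) (S : nat -> nat -> set T)
    (c c' m m' : nat -> R) (M M' : R) :
  (forall x, A x -> 0 <= g x)%E -> (forall j k, measurable (S j k)) ->
  (forall j, 0 <= c j) -> (forall j, 0 <= m j) ->
  (forall k, 0 <= c' k) -> (forall k, 0 <= m' k) ->
  (forall j k, mu (S j k) <= (m j * m' k)%:E)%E ->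
  (forall x, A x -> exists j k, S j k x /\ (g x <= (c j * c' k)%:E)%E) ->
  (forall n, \sum_(j < n) c j * m j <= M) ->
  (forall n, \sum_(k < n) c' k * m' k <= M') ->
  (\int[mu]_(x in A) g x <= (M * M')%:E)%E.
Proof.
move=> g0 mS c0 m0 c'0 m'0 mum cover sumM sumM'.
have M'0 : 0 <= M' by have := sumM' 0%N; rewrite big_ord0.
pose t j k x := ((c j * c' k) * \1_(S j k) x)%:E.
pose u j x := (\sum_(k <oo) t j k x)%E.
have t0 j k x : (0 <= t j k x)%E by rewrite lee_fin mulr_ge0// mulr_ge0.
have u0 j x : (0 <= u j x)%E by apply: nneseries_ge0.
have mt j k : measurable_fun setT (t j k).
  by apply/measurable_EFinP/measurable_funM => //; exact: measurable_indic.
have mu_ j : measurable_fun setT (u j).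
  by apply: ge0_emeasurable_sum => // k x _ _; exact: t0.
apply: (@le_trans _ _ (\int[mu]_x (\sum_(j <oo) u j x))%E).
  apply: le_integral_ge0 => // [x _|x Ax]; first by apply: nneseries_ge0.
  split=> //; have [j [k [Sk gk]]] := cover x Ax; apply: le_trans gk _.
  apply: (@le_trans _ _ (u j x)); last first.
    have := @nneseries_lim_ge R (u ^~ x) xpredT 0 j.+1 (fun n _ _ => u0 n x).
    apply: le_trans; rewrite big_nat_recr //=.
    by apply: leeDr; apply: sume_ge0 => i _; exact: u0.
  have := @nneseries_lim_ge R (t j ^~ x) xpredT 0 k.+1 (fun n _ _ => t0 j n x).
  apply: le_trans; rewrite big_nat_recr //= /t indicE mem_set// mulr1.
  by apply: leeDr; apply: sume_ge0 => i _; exact: t0.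
rewrite integral_nneseries//.
have intu j : (\int[mu]_x u j x <= (c j * m j * M')%:E)%E.
  rewrite /u integral_nneseries//.
  apply: lime_le; first by apply: is_cvg_nneseries => k _ _; exact: integral_ge0.
  apply: nearW => n; rewrite big_mkord.
  apply: (@le_trans _ _ (\sum_(k < n) (c j * m j * (c' k * m' k))%:E)%E); last first.
    by rewrite sumEFin lee_fin -mulr_sumr ler_wpM2l// mulr_ge0.
  apply: lee_sum => k _; rewrite /t; under eq_integral do rewrite EFinM.
  rewrite ge0_integralZl_EFin//; last 2 first.
  - by apply/measurable_EFinP; exact: measurable_indic.
  - by rewrite mulr_ge0.
  rewrite integral_indic// setIT mulrACA [leRHS]EFinM.
  by apply: lee_wpmul2l => //; rewrite lee_fin mulr_ge0.
apply: lime_le; first by apply: is_cvg_nneseries => k _ _; exact: integral_ge0.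
apply: nearW => n; rewrite big_mkord.
apply: (@le_trans _ _ (\sum_(j < n) (c j * m j * M')%:E)%E).
  by apply: lee_sum => j _; exact: intu.
by rewrite sumEFin lee_fin -mulr_suml ler_wpM2r.
Qed.

Lemma integral_shells (A : set T) (g : T -> \bar R) (S : nat -> set T)
    (c m : nat -> R) (M : R) :
  (forall x, A x -> 0 <= g x)%E -> (forall k, measurable (S k)) ->
  (forall k, 0 <= c k) -> (forall k, mu (S k) <= (m k)%:E)%E ->
  (forall x, A x -> exists2 k, S k x & (g x <= (c k)%:E)%E) ->
  (forall n, \sum_(k < n) c k * m k <= M) ->
  (\int[mu]_(x in A) g x <= M%:E)%E.
Proof.
move=> g0 mS c0 mum cover sumM; rewrite -[M]mulr1.
have m0 k : 0 <= m k by rewrite -lee_fin (le_trans _ (mum k)).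
apply: (@integral_shells2 A g (fun j k => if k is 0%N then S j else set0)
  c (fun k => (k == 0%N)%:R) m (fun k => (k == 0%N)%:R)) => //.
- by move=> j [|k].
- by move=> j [|k]; rewrite ?mulr1// measure0 mulr0.
- by move=> x /cover[j Sj gj]; exists j, 0%N; rewrite mulr1.
- case=> [|n]; first by rewrite big_ord0.
  by rewrite big_ord_recl big1 ?addr0 ?mulr1// => i _; rewrite mulr0.
Qed.

Lemma near_shell (v h : R) : 0 < v -> v <= h ->
  exists k : nat, h / 2 ^+ k.+1 < v <= h / 2 ^+ k.
Proof.
move=> v0 vh; have [|k /andP[k1 k2]] := @dyadic_floor R (h / v).
  by rewrite ler_pdivlMr ?mul1r.
have e2 (n : nat) : 0 < (2 : R) ^+ n by rewrite exprn_gt0.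
exists k; rewrite ltr_pdivrMr// mulrC -ltr_pdivrMr// k2 /=.
by rewrite ler_pdivlMr// mulrC -ler_pdivlMr.
Qed.

Lemma far_shell (v h : R) : 0 < h -> h < v ->
  exists k : nat, h * 2 ^+ k < v <= h * 2 ^+ k.+1.
Proof.
move=> h0 hv; have [|k /andP[k1 k2]] := @dyadic_ceil R (v / h).
  by rewrite ltr_pdivlMr ?mul1r.
by exists k; rewrite mulrC -ltr_pdivlMr// k1 /= mulrC -ler_pdivrMr.
Qed.

Lemma powRN_le (x y g : R) : 0 <= g -> 0 < x -> x <= y -> y `^ (- g) <= x `^ (- g).
Proof.
move=> g0 x0 xy; have y0 : 0 < y by exact: lt_le_trans xy.
by rewrite !powRN lef_pV2 ?posrE ?powR_gt0// ge0_ler_powR ?nnegrE// ltW.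
Qed.

Lemma powRN_le2 (x y g : R) : 0 <= g -> 0 < x -> x <= 2 * y ->
  y `^ (- g) <= 2 `^ g * x `^ (- g).
Proof.
move=> g0 x0 xy.
have -> : 2 `^ g * x `^ (- g) = (x / 2) `^ (- g).
  rewrite powRM ?invr_ge0 ?(ltW x0)// mulrC; congr (_ * _).
  by rewrite -powR_inv1// -powRrM mulN1r opprK.
by apply: powRN_le => //; [exact: divr_gt0|rewrite ler_pdivrMr// mulrC].
Qed.

Lemma measurable_layer (A : set T) (v : T -> R) (h : R) : measurable A ->
  measurable_fun setT v -> measurable (A `&` [set x | 0 < v x <= h]).
Proof.
move=> mA mv; apply: measurableI => //.
have -> : [set x | 0 < v x <= h] = v @^-1` [set` `]0, h]].
  by apply/seteqP; split => x /=; rewrite in_itv.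
by rewrite -[X in measurable X]setTI; exact: mv.
Qed.

(** If [{v <= eta}] has measure at most [C * eta], as for a distance to a
    boundary, then negative powers of [v] of exponent above [-1] are
    integrable at the rate that scaling predicts. *)
Lemma integral_near (A : set T) (v : T -> R) (C h g : R) : measurable A ->
  measurable_fun setT v -> 0 <= C -> 0 < h -> 0 <= g -> g < 1 ->
  (forall eta, 0 < eta <= h ->
    (mu (A `&` [set x | 0 < v x <= eta]%R) <= (C * eta)%:E)%E) ->
  (\int[mu]_(x in A `&` [set x | 0 < v x <= h]%R) (v x `^ (- g))%:E <=
   (C * near_const g * h `^ (1 - g))%:E)%E.
Proof.
move=> mA mv C0 h0 g0 g1 muA.
have e2 (n : nat) : 0 < (2 : R) ^+ n by rewrite exprn_gt0.
apply: (@integral_shells _ _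
  (fun k => A `&` [set x | 0 < v x <= h / 2 ^+ k])
  (fun k => (h / 2 ^+ k.+1) `^ (- g)) (fun k => C * (h / 2 ^+ k))).
- by move=> x _; rewrite lee_fin powR_ge0.
- by move=> k; exact: measurable_layer.
- by move=> k; exact: powR_ge0.
- move=> k; apply: muA; rewrite divr_gt0//= ler_pdivrMr// ler_peMr ?(ltW h0)//.
  by rewrite exprn_ege1// ler1n.
- move=> x [Ax /andP[v0 vh]]; have [k /andP[k1 k2]] := near_shell v0 vh.
  exists k; first by split=> //=; rewrite v0.
  by rewrite lee_fin powRN_le// ?divr_gt0// ltW.
- by move=> n; exact: near_sum.
Qed.

(** Away from [v = 0] the same hypothesis makes the exponents below [-1]
    integrable. *)
Lemma integral_far (A : set T) (v : T -> R) (C h b : R) : measurable A ->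
  measurable_fun setT v -> 0 <= C -> 0 < h -> 0 < b ->
  (forall eta, 0 < eta ->
    (mu (A `&` [set x | 0 < v x <= eta]%R) <= (C * eta)%:E)%E) ->
  (\int[mu]_(x in A `&` [set x | h < v x]%R) (v x `^ (- (1 + b)))%:E <=
   (C * far_const b * h `^ (- b))%:E)%E.
Proof.
move=> mA mv C0 h0 b0 muA.
have e2 (n : nat) : 0 < (2 : R) ^+ n by rewrite exprn_gt0.
apply: (@integral_shells _ _
  (fun k => A `&` [set x | 0 < v x <= h * 2 ^+ k.+1])
  (fun k => (h * 2 ^+ k) `^ (- (1 + b))) (fun k => C * (h * 2 ^+ k.+1))).
- by move=> x _; rewrite lee_fin powR_ge0.
- by move=> k; exact: measurable_layer.
- by move=> k; exact: powR_ge0.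
- by move=> k; apply: muA; rewrite mulr_gt0.
- move=> x [Ax /= hv]; have [k /andP[k1 k2]] := far_shell h0 hv.
  exists k; first by split=> //=; rewrite k2 andbT (lt_trans h0).
  by rewrite lee_fin powRN_le// ?mulr_gt0 ?ltW// addr_gt0.
- by move=> n; exact: far_sum.
Qed.

End layers.

(** * Integral of the model weight over a box *)

Section slabs.
Variable R : realType.
Local Notation leb := (@lebesgue_measure R).
Local Notation plane := (measurableTypeR R * measurableTypeR R)%type.
Local Notation leb2 := (leb \x leb)%E.

(** The values of one coordinate, not close to zero, for which a point has depth
    at most [eta] when the other coordinate [y] is fixed; then [c = 1 - y ^ 2]. *)
Definition slab (c eta : R) : set (measurableTypeR R) :=
  [set x | 1 / 4 <= x ^+ 2 /\ 0 < c - x ^+ 2 <= eta].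

Lemma measurable_slab c eta : measurable (slab c eta).
Proof.
have m2 : measurable_fun setT (fun x : measurableTypeR R => x ^+ 2).
  exact: measurable_funX.
have m3 : measurable_fun setT (fun x : measurableTypeR R => c - x ^+ 2).
  exact: measurable_funB.
have -> : slab c eta = (fun x : measurableTypeR R => x ^+ 2) @^-1` `[1 / 4, +oo[%classic
    `&` (fun x : measurableTypeR R => c - x ^+ 2) @^-1` `]0, eta]%classic.
  by apply/seteqP; split => x /=; rewrite !in_itv /= andbT.
apply: measurableI; rewrite -[X in measurable X]setTI; first exact: m2.
exact: m3.
Qed.

(** For [|x| >= 1 / 2], on either side of zero, [x ^ 2] is a coordinate that
    does not contract distances. *)
Lemma slab_measure_le c eta : 0 <= eta -> (leb (slab c eta) <= (4 * eta)%:E)%E.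
Proof.
move=> eta0.
have half (s : R) : s ^+ 2 = 1 -> exists x1 : R,
    [set x | slab c eta x /\ 0 <= s * x] `<=` `[x1 - eta, x1 + eta]%classic.
  move=> s1; have [[x1 [[x1s x1c] x1p]]|nex] :=
    pselect (exists x, slab c eta x /\ 0 <= s * x); last first.
    by exists 0 => x sx; exfalso; apply: nex; exists x.
  exists x1 => x [[xs xc] xp] /=; rewrite in_itv /= -ler_distlC.
  have big (y : R) : 1 / 4 <= y ^+ 2 -> 0 <= s * y -> 1 / 2 <= s * y.
    move=> y4 sy; rewrite leNgt; apply/negP => sy2.
    have : (s * y) ^+ 2 < (1 / 2) ^+ 2 by rewrite ltr_pXn2r ?nnegrE.
    by rewrite exprMn s1 mul1r; lra.
  have bx := big x xs xp; have bx1 := big x1 x1s x1p.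
  have ax : `|s| = 1.
    by apply/eqP; rewrite -(eqrXn2 (ltn0Sn 1))// real_normK ?num_real// s1 expr1n.
  rewrite distrC; have -> : `|x - x1| = `|s * x - s * x1| by rewrite -mulrBr normrM ax mul1r.
  have e : (s * x) ^+ 2 - (s * x1) ^+ 2 = x ^+ 2 - x1 ^+ 2.
    by rewrite !exprMn s1 !mul1r.
  move: e bx bx1; set p := s * x; set q := s * x1 => e bp bq.
  by move/andP: xc => [? ?]; move/andP: x1c => [? ?]; rewrite ler_norml; apply/andP; split; nra.
have [x1 H1] := half 1 (expr1n _ _).
have [x2 H2] := half (-1) (etrans (sqrrN 1) (expr1n _ _)).
apply: (@le_trans _ _ (leb (`[(x1 - eta)%R, (x1 + eta)%R]%classic `|`
    `[(x2 - eta)%R, (x2 + eta)%R]%classic))).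
  apply: le_measure; rewrite ?inE//.
  - exact: measurable_slab.
  - exact: measurableU.
  - move=> x sx; have [x0|x0] := leP 0 x; [left|right].
      by apply: H1; split=> //; rewrite mul1r.
    by apply: H2; split=> //; rewrite mulN1r oppr_ge0 ltW.
apply: (@le_trans _ _ (leb `[(x1 - eta)%R, (x1 + eta)%R]%classic +
    leb `[(x2 - eta)%R, (x2 + eta)%R]%classic)%E); first exact: measureU2.
have L (y : R) : leb `[(y - eta)%R, (y + eta)%R]%classic = (2 * eta)%:E.
  rewrite lebesgue_measure_itv /= lte_fin.
  case: ltP => h; first by rewrite -EFinB; congr (_%:E); ring.
  by congr (_%:E); lra.
by rewrite !L -EFinD lee_fin; lra.
Qed.

(** The slice of [S] at height [y] is contained in a slab. *)
Lemma slab1_measure (S : set plane) (eta y0 k : R) : measurable S ->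
  0 <= eta -> 0 <= k ->
  (forall w, S w -> [/\ 1 / 4 <= w.1 ^+ 2, 0 < 1 - w.1 ^+ 2 - w.2 ^+ 2 <= eta &
     `|w.2 - y0| <= k]) ->
  (leb2 S <= (4 * eta * (2 * k))%:E)%E.
Proof.
move=> mS eta0 k0 HS.
pose I : set (measurableTypeR R) := `[y0 - k, y0 + k]%classic.
have mI : measurable I by exact: measurable_itv.
have Ik : leb I = (2 * k)%:E.
  rewrite /I lebesgue_measure_itv /= lte_fin.
  case: ltP => h; first by rewrite -EFinB; congr (_%:E); ring.
  by congr (_%:E); lra.
have {}Ik : (\int[leb]_x (\1_I x)%:E = (2 * k)%:E)%E.
  by rewrite integral_indic// setIT -Ik.
have -> : leb2 S = (\int[leb2]_w (\1_S w)%:E)%E by rewrite integral_indic// setIT.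
rewrite fubini_tonelli2//; last first.
  by apply/measurable_EFinP; exact: measurable_indic.
apply: (@le_trans _ _ (\int[leb]_y ((4 * eta)%:E * (\1_I y)%:E))%E); last first.
  rewrite ge0_integralZl_EFin//; last 2 first.
  - by apply/measurable_EFinP; exact: measurable_indic.
  - by rewrite mulr_ge0.
  by rewrite Ik -EFinM.
apply: le_integral_ge0 => [y _|y _|y _].
- exact: integral_ge0.
- by rewrite mule_ge0 ?lee_fin ?mulr_ge0.
split=> //; rewrite /fubini_G.
apply: (@le_trans _ _ (\int[leb]_x ((\1_I y)%:E * (\1_(slab (1 - y ^+ 2) eta) x)%:E))%E).
  apply: le_integral_ge0 => [x _|x _|x _].
  - by rewrite lee_fin.
  - by rewrite mule_ge0 ?lee_fin.
  split=> //; rewrite [X in (X <= _)%E]/= !indicE -EFinM lee_fin.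
  case: (boolP ((x, y) \in S)) => [/set_mem/HS [/= x4 xy yk]|_]; last by rewrite mulr_ge0.
  rewrite !mem_set ?mulr1//; first by split=> //; rewrite addrAC.
  by rewrite /I /= in_itv /= -ler_distlC distrC.
rewrite ge0_integralZl_EFin//; last first.
  by apply/measurable_EFinP; apply: measurable_indic; exact: measurable_slab.
rewrite integral_indic//; last exact: measurable_slab.
rewrite setIT muleC; apply: lee_wpmul2r; first by rewrite lee_fin.
exact: slab_measure_le.
Qed.

Lemma slab2_measure (S : set plane) (eta x0 k : R) : measurable S ->
  0 <= eta -> 0 <= k ->
  (forall w, S w -> [/\ 1 / 4 <= w.2 ^+ 2, 0 < 1 - w.1 ^+ 2 - w.2 ^+ 2 <= eta &
     `|w.1 - x0| <= k]) ->
  (leb2 S <= (4 * eta * (2 * k))%:E)%E.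
Proof.
move=> mS eta0 k0 HS.
have ms : measurable_fun [set: plane] (fun w : plane => (w.2, w.1) : plane).
  by apply: measurable_fun_pair; [exact: measurable_snd|exact: measurable_fst].
pose S' : set plane := (fun w : plane => (w.2, w.1) : plane) @^-1` S.
have mS' : measurable S' by rewrite -[S']setTI; exact: ms.
have <- : leb2 S' = leb2 S.
  have -> : leb2 S' = (\int[leb2]_w (\1_S' w)%:E)%E by rewrite integral_indic// setIT.
  have -> : leb2 S = (\int[leb2]_w (\1_S w)%:E)%E by rewrite integral_indic// setIT.
  rewrite -(integral_swap (f := fun w => (\1_S w)%:E))//.
  by apply/measurable_EFinP; exact: measurable_indic.
apply: (slab1_measure (y0 := x0)) => // w Sw; have [y4 xy xk] := HS (w.2, w.1) Sw.
by split=> //; rewrite addrAC.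
Qed.

End slabs.

Section box_integral.
Variable R : realType.
Local Notation leb := (@lebesgue_measure R).
Local Notation plane := (measurableTypeR R * measurableTypeR R)%type.
Local Notation leb2 := (leb \x leb)%E.

Lemma integral_setU_le d (T : measurableType d) (mu : {measure set T -> \bar R})
    (A A1 A2 : set T) (f : T -> \bar R) :
  measurable A1 -> measurable A2 -> measurable_fun setT f ->
  (forall x, 0 <= f x)%E -> A `<=` A1 `|` A2 ->
  (\int[mu]_(x in A) f x <= \int[mu]_(x in A1) f x + \int[mu]_(x in A2) f x)%E.
Proof.
move=> m1 m2 mf f0 sub.
have := @integral_pieces_le _ _ _ mu A A1 A2 set0 f f f f m1 m2 measurable0 mf mf mf f0 f0 f0.
rewrite integral_set0 adde0; apply=> x // /sub[?|?]; first by constructor 1.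
by constructor 2.
Qed.

Definition depth (w : plane) : R := 1 - modulus (of_plane w) ^+ 2.
Definition dist1 (w : plane) : R := modulus (1 - of_plane w).

Lemma depthE w : depth w = 1 - w.1 ^+ 2 - w.2 ^+ 2.
Proof. by rewrite /depth sqr_modulus /= opprD addrA. Qed.

Lemma measurable_depth : measurable_fun setT depth.
Proof.
apply: measurable_funB => //; apply: measurable_funX.
by apply: measurable_modulus; exact: cmeasurable_of_plane.
Qed.

Lemma measurable_dist1 : measurable_fun setT dist1.
Proof.
apply: measurable_modulus; apply: cmeasurableD; first exact: cmeasurable_cst.
under eq_fun do rewrite -mulN1r.
by apply: cmeasurableM; [exact: cmeasurable_cst|exact: cmeasurable_of_plane].
Qed.

(** The weight left when [majorant] below is raised to the power [p] and
    multiplied by [depth `^ (alpha + 1)]. *)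
Definition kernel (beta : R) (w : plane) : R :=
  depth w `^ (beta - 1) * dist1 w `^ (- beta).

Lemma measurable_kernel beta :
  measurable_fun setT (fun w => (kernel beta w)%:E).
Proof.
apply/measurable_EFinP; apply: measurable_funM.
  exact: (measurableT_comp (measurable_powR _) measurable_depth).
exact: (measurableT_comp (measurable_powR _) measurable_dist1).
Qed.

Definition box_const (beta : R) : R :=
  8 * near_const (1 - beta) * (1 + near_const beta) +
  96 * near_const (1 - beta) + 48.

Lemma box_const_gt0 beta : 0 < beta < 1 -> 0 < box_const beta.
Proof.
move=> /andP[b0 b1].
have n1 : 0 < near_const (1 - beta) by rewrite near_const_gt0// ltrBlDr ltrDl.
have n2 : 0 < near_const beta by rewrite near_const_gt0.
by rewrite /box_const; have := mulr_gt0 n1 n2; nra.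
Qed.

Lemma quarter_sqr_dist1 (x : R) : x ^+ 2 < 1 / 4 -> 1 / 2 <= `|1 - x|.
Proof.
move=> x4; have x2 : x < 1 / 2 by rewrite ltNge; apply/negP => x2; nra.
by rewrite ger0_norm; lra.
Qed.

Lemma quarter_sqr_depth (x y : R) : x ^+ 2 < 1 / 4 -> y ^+ 2 < 1 / 4 ->
  1 / 2 <= 1 - x ^+ 2 - y ^+ 2.
Proof. by move=> *; lra. Qed.

Lemma half_gt0 : 0 < 1 / 2 :> R. Proof. by lra. Qed.

Section box.
Variables (beta H x0 y0 : R).
Hypotheses (b0 : 0 < beta) (b1 : beta < 1) (H0 : 0 < H) (H6 : H <= 6).

Let box : set plane :=
  [set w | 0 < depth w <= H] `&` [set w | `|w.1 - x0| <= H] `&`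
  [set w | `|w.2 - y0| <= H].

Let n1_gt0 : 0 < near_const (1 - beta).
Proof. by rewrite near_const_gt0// ltrBlDr ltrDl. Qed.

Let n2_gt0 : 0 < near_const beta.
Proof. by rewrite near_const_gt0. Qed.

Let m_strip (g : plane -> R) (k : R) : measurable_fun setT g ->
  measurable [set w | `|g w| <= k].
Proof.
move=> mg; have -> : [set w | `|g w| <= k] = g @^-1` `[- k, k]%classic.
  by apply/seteqP; split => w /=; rewrite in_itv /= ler_norml.
by rewrite -[X in measurable X]setTI; exact: mg.
Qed.

Let m_depth (eta : R) : measurable [set w : plane | 0 < depth w <= eta].
Proof.
by have := measurable_layer eta measurableT measurable_depth; rewrite setTI.
Qed.

Let m1 : measurable_fun setT (fun w : plane => w.1). Proof. exact: measurable_fst. Qed.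
Let m2 : measurable_fun setT (fun w : plane => w.2). Proof. exact: measurable_snd. Qed.

Let m_big (g : plane -> R) : measurable_fun setT g ->
  measurable [set w | 1 / 4 <= g w ^+ 2].
Proof.
move=> mg; have -> : [set w | 1 / 4 <= g w ^+ 2] =
    (fun w => g w ^+ 2) @^-1` `[1 / 4, +oo[%classic.
  by apply/seteqP; split => w /=; rewrite in_itv /= andbT.
rewrite -[X in measurable X]setTI.
have : measurable_fun setT (fun w => g w ^+ 2) by exact: measurable_funX.
exact.
Qed.

Let A1 := box `&` [set w : plane | 1 / 4 <= w.1 ^+ 2].
Let A2 := box `&` [set w : plane | 1 / 4 <= w.2 ^+ 2].
Let A3 := box `&` [set w : plane | w.1 ^+ 2 < 1 / 4 /\ w.2 ^+ 2 < 1 / 4].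

Lemma measurable_box : measurable box.
Proof.
apply: measurableI; first apply: measurableI.
- exact: m_depth.
- by apply: (m_strip (g := fun w => w.1 - x0)); exact: measurable_funB.
- by apply: (m_strip (g := fun w => w.2 - y0)); exact: measurable_funB.
Qed.

Let mbox := measurable_box.

Let Hpow : H `^ beta <= 6.
Proof.
apply: (@le_trans _ _ (6 `^ beta)).
  by rewrite ge0_ler_powR ?nnegrE ?(ltW b0) ?(ltW H0).
by apply: ler1_powR; [rewrite ler1n|exact: ltW].
Qed.

Let k0 w : (0 <= (kernel beta w)%:E)%E.
Proof. by rewrite lee_fin mulr_ge0 ?powR_ge0. Qed.

Let dist1_Im (w : plane) : `|w.2| <= dist1 w.
Proof.
have -> : w.2 = - complex.Im (1 - of_plane w) by rewrite ImB /= sub0r opprK.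
by rewrite normrN; exact: normr_Im_le.
Qed.

Let dist1_Re (w : plane) : `|1 - w.1| <= dist1 w.
Proof.
have -> : 1 - w.1 = complex.Re (1 - of_plane w) by rewrite ReB.
exact: normr_Re_le.
Qed.

(** Depth and second coordinate are almost independent here, and a point within
    [r] of [1] has second coordinate at most [r] in absolute value. The index
    [k = 0] stands for the points at distance more than [H] from [1]. *)
Let int_A1 : (\int[leb2]_(w in A1) (kernel beta w)%:E <=
  (8 * near_const (1 - beta) * (1 + near_const beta) * H)%:E)%E.
Proof.
have e2 (n : nat) : 0 < (2 : R) ^+ n by rewrite exprn_gt0.
have hk n : 0 < H / 2 ^+ n by rewrite divr_gt0.
pose c' k := if k is k'.+1 then (H / 2 ^+ k'.+1) `^ (- beta) else H `^ (- beta).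
pose m' k := if k is k'.+1 then 2 * (H / 2 ^+ k') else 2 * H.
pose S j k : set plane := [set w : plane | 1 / 4 <= w.1 ^+ 2] `&`
  [set w | 0 < depth w <= H / 2 ^+ j] `&`
  (if k is k'.+1 then [set w | `|w.2| <= H / 2 ^+ k'] else [set w | `|w.2 - y0| <= H]).
have -> : 8 * near_const (1 - beta) * (1 + near_const beta) * H =
   (4 * near_const (1 - beta) * H `^ (1 - (1 - beta))) *
   (2 * (1 + near_const beta) * H `^ (1 - beta)).
  rewrite subKr mulrACA [X in _ = _ * X](_ : _ = H); last first.
    by rewrite -powRDgt0// addrC subrK powRr1// ltW.
  by ring.
apply: (@integral_shells2 _ _ _ leb2 _ _ S (fun j => (H / 2 ^+ j.+1) `^ (- (1 - beta)))
   c' (fun j => 4 * (H / 2 ^+ j)) m').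
- by move=> w _; exact: k0.
- move=> j [|k]; (apply: measurableI; first apply: measurableI).
  + exact: m_big.
  + exact: m_depth.
  + by apply: (m_strip (g := fun w => w.2 - y0)); exact: measurable_funB.
  + exact: m_big.
  + exact: m_depth.
  + exact: (m_strip (g := fun w => w.2)).
- by move=> j; exact: powR_ge0.
- by move=> j; rewrite mulr_ge0// ltW.
- by case=> [|k]; exact: powR_ge0.
- by case=> [|k] /=; rewrite mulr_ge0// ltW.
- move=> j [|k].
  + apply: (@slab1_measure _ _ _ y0); rewrite ?(ltW (hk j)) ?(ltW H0)//.
      apply: measurableI; first by apply: measurableI; [exact: m_big|exact: m_depth].
      by apply: (m_strip (g := fun w => w.2 - y0)); exact: measurable_funB.
    by move=> w [[/= w4]]; rewrite depthE => wd wy; split.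
  + apply: (@slab1_measure _ _ _ 0); rewrite ?(ltW (hk _))//.
      apply: measurableI; first by apply: measurableI; [exact: m_big|exact: m_depth].
      exact: (m_strip (g := fun w => w.2)).
    by move=> w [[/= w4]]; rewrite depthE => wd wy; split=> //; rewrite subr0.
- move=> w [[[/= /andP[D0 DH] wx] wy] w4].
  have [j /andP[j1 j2]] := near_shell D0 DH; exists j.
  have Dle : depth w `^ (beta - 1) <= (H / 2 ^+ j.+1) `^ (- (1 - beta)).
    by rewrite -(opprB 1 beta) powRN_le// ?subr_ge0 ltW.
  have [dH|Hd] := leP (dist1 w) H; last first.
    exists 0%N; split; first by split; [split=> //=; rewrite D0|].
    rewrite lee_fin ler_pM ?powR_ge0// powRN_le// ltW//.
  have d0 : 0 < dist1 w.
    rewrite lt_neqAle modulus_ge0 andbT eq_sym; apply/eqP => d0.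
    have := modulusB_ge 1 (of_plane w); rewrite modulus1 -/(dist1 w) d0.
    have := modulus_ge0 (of_plane w); move: D0; rewrite /depth => *; nra.
  have [k /andP[k1 k2]] := near_shell d0 dH; exists k.+1; split.
    split; first by split=> //=; rewrite D0.
    by rewrite /= (le_trans (dist1_Im w)).
  by rewrite lee_fin ler_pM ?powR_ge0// powRN_le// ltW.
- move=> n; apply: near_sum => //; first by rewrite subr_ge0 ltW.
  by rewrite ltrBlDr ltrDl.
- have HH : H `^ (- beta) * (2 * H) = 2 * H `^ (1 - beta).
    rewrite mulrCA; congr (_ * _).
    by rewrite -{2}(powRr1 (ltW H0)) -powRDgt0// addrC.
  have nn : 0 <= 2 * (1 + near_const beta) * H `^ (1 - beta).
    by rewrite !mulr_ge0 ?powR_ge0 ?addr_ge0// ltW.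
  case=> [|n]; first by rewrite big_ord0.
  rewrite big_ord_recl /= HH.
  have := near_sum n (ltW b0) b1 H0 (ler0n R 2) => NS.
  by move: NS; rewrite /= mulrDr mulr1 mulrDl => NS; rewrite lerD2l.
Qed.

(** Away from the real axis only the depth is singular. *)
Let int_A2 : (\int[leb2]_(w in A2) (kernel beta w)%:E <=
  (96 * near_const (1 - beta) * H)%:E)%E.
Proof.
pose B := [set w : plane | 1 / 4 <= w.2 ^+ 2] `&` [set w | `|w.1 - x0| <= H].
have mB : measurable B.
  apply: measurableI; first exact: m_big.
  by apply: (m_strip (g := fun w => w.1 - x0)); exact: measurable_funB.
apply: (@le_trans _ _ (\int[leb2]_(w in B `&` [set w : plane | 0 < depth w <= H]%R)
   ((2 : R)%:E * (depth w `^ (- (1 - beta)))%:E))%E).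
  apply: le_integral_ge0 => [w _|w _|w [[[wD wx] wy] w4]].
  - exact: k0.
  - by rewrite -EFinM lee_fin mulr_ge0 ?powR_ge0.
  split; first by [].
  rewrite -EFinM lee_fin /kernel opprB mulrC ler_wpM2r ?powR_ge0//.
  have : 1 / 2 <= `|w.2|.
    rewrite leNgt; apply/negP => w2; move: w4 => /=.
    have : `|w.2| ^+ 2 < (1 / 2) ^+ 2 by rewrite ltr_pXn2r ?nnegrE.
    by rewrite real_normK ?num_real//; lra.
  move=> /le_trans/(_ (dist1_Im w)) d2.
  have h2 := half_gt0.
  apply: le_trans (powRN_le (ltW b0) h2 d2) _.
  rewrite div1r -[2^-1]powR_inv1// -powRrM mulN1r opprK.
  by apply: ler1_powR; [rewrite ler1n|exact: ltW].
rewrite ge0_integralZl_EFin//; last 3 first.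
- by apply: measurableI.
- by move=> w _; rewrite lee_fin powR_ge0.
- apply/measurable_EFinP; apply: measurable_funTS.
  exact: (measurableT_comp (measurable_powR _) measurable_depth).
apply: (@le_trans _ _ ((2 : R)%:E *
   (8 * H * near_const (1 - beta) * H `^ (1 - (1 - beta)))%:E)%E).
  apply: lee_wpmul2l => //; apply: integral_near => //.
  - exact: measurable_depth.
  - by rewrite mulr_ge0// ltW.
  - by rewrite subr_ge0 ltW.
  - by rewrite ltrBlDr ltrDl.
  move=> eta /andP[eta0 etaH].
  have -> : 8 * H * eta = 4 * eta * (2 * H) by ring.
  apply: (@slab2_measure _ _ _ x0); rewrite ?(ltW eta0) ?(ltW H0)//.
    exact: measurableI.
  by move=> w [[/= w4 wx]]; rewrite depthE.
rewrite subKr -EFinM lee_fin.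
have -> : 2 * (8 * H * near_const (1 - beta) * H `^ beta) =
  (16 * near_const (1 - beta) * H) * H `^ beta by ring.
have -> : 96 * near_const (1 - beta) * H = (16 * near_const (1 - beta) * H) * 6 by ring.
apply: ler_wpM2l => //; apply: mulr_ge0; last exact: ltW.
by apply: mulr_ge0 => //; exact: ltW.
Qed.

Let int_A3 : (\int[leb2]_(w in A3) (kernel beta w)%:E <= (48 * H)%:E)%E.
Proof.
pose Q : set plane := `[x0 - H, x0 + H]%classic `*` `[y0 - H, y0 + H]%classic.
have mQ : measurable Q by apply: measurableX.
have QE : leb2 Q = (4 * H ^+ 2)%:E.
  have h (x : R) : x - H <= x + H by rewrite lerBlDr -addrA lerDl addr_ge0// ltW.
  by rewrite leb2_rect//; congr (_%:E); ring.
apply: (@le_trans _ _ (\int[leb2]_(w in Q) (cst (2 : R)%:E) w)%E); last first.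
  rewrite integral_cst//; apply: (@le_trans _ _ ((2 : R)%:E * leb2 Q)%E).
    exact: lexx.
  rewrite QE -EFinM lee_fin.
  have -> : 2 * (4 * H ^+ 2) = 8 * H * H by ring.
  have -> : 48 * H = 8 * H * 6 by ring.
  by rewrite ler_wpM2l// mulr_ge0// ltW.
apply: le_integral_ge0 => [w _|w _|w [[[/= wD wx] wy] [w1 w2]]].
- exact: k0.
- by rewrite lee_fin.
split; first by split; rewrite /= in_itv /= -ler_distlC distrC.
rewrite /= lee_fin /kernel.
have h2 := half_gt0.
have D2 : 1 / 2 <= depth w by rewrite depthE; exact: quarter_sqr_depth.
have d2 : 1 / 2 <= dist1 w.
  by apply: le_trans (dist1_Re w); exact: quarter_sqr_dist1.
have -> : 2 = (1 / 2) `^ (- (1 - beta)) * (1 / 2) `^ (- beta) :> R.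
  rewrite -powRDgt0//.
  have -> : - (1 - beta) + - beta = -1 by ring.
  by rewrite powR_inv1 ?(ltW h2)// div1r invrK.
by rewrite ler_pM ?powR_ge0// -?(opprB 1 beta) powRN_le// ?subr_ge0 ltW.
Qed.

(** Both exponents of the weight exceed [-1], so that it is integrable over a box
    that touches the circle; homogeneity of degree [-1] gives the factor [H]. *)
Lemma box_integral : (\int[leb2]_(w in box) (kernel beta w)%:E <=
  (box_const beta * H)%:E)%E.
Proof.
have mk := measurable_kernel beta.
have mA1 : measurable A1 by apply: measurableI => //; exact: m_big.
have mA2 : measurable A2 by apply: measurableI => //; exact: m_big.
have mA3 : measurable A3.
  apply: measurableI => //.
  have -> : [set w : plane | w.1 ^+ 2 < 1 / 4 /\ w.2 ^+ 2 < 1 / 4] =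
     ~` [set w : plane | 1 / 4 <= w.1 ^+ 2] `&` ~` [set w : plane | 1 / 4 <= w.2 ^+ 2].
    apply/seteqP; split => w /=; rewrite !ltNge; first by case=> /negP ? /negP ?.
    by move=> [? ?]; split; apply/negP.
  by apply: measurableI; apply: measurableC; exact: m_big.
apply: (@le_trans _ _ (\int[leb2]_(w in A1) (kernel beta w)%:E +
  \int[leb2]_(w in A2 `|` A3) (kernel beta w)%:E)%E).
  apply: integral_setU_le => //; first exact: measurableU.
  move=> w wb; have [w1|w1] := leP (1 / 4) (w.1 ^+ 2); first by left; split.
  by right; have [w2|w2] := leP (1 / 4) (w.2 ^+ 2); [left|right]; split.
have -> : box_const beta * H =
    8 * near_const (1 - beta) * (1 + near_const beta) * H +
    (96 * near_const (1 - beta) * H + 48 * H) by rewrite /box_const; ring.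
rewrite EFinD; apply: leeD; first exact: int_A1.
rewrite EFinD; apply: (@le_trans _ _ (\int[leb2]_(w in A2) (kernel beta w)%:E +
  \int[leb2]_(w in A3) (kernel beta w)%:E)%E); first exact: integral_setU_le.
by apply: leeD; [exact: int_A2|exact: int_A3].
Qed.

End box.
End box_integral.

(** * A majorant of finite tent norm *)

Section majorant.
Variable R : realType.
Local Notation leb := (@lebesgue_measure R).
Local Notation plane := (measurableTypeR R * measurableTypeR R)%type.
Local Notation leb2 := (leb \x leb)%E.

(** With the whole exponent [(alpha + 2) / p] on [1 - |z| ^ 2], the weight over a
    box would be the power [-1] of the depth, which is not integrable; a part
    [beta / p] is therefore put on the distance to [1]. *)
Definition majorant (p alpha beta : R) (z : R[i]) : R :=
  (1 - modulus z ^+ 2) `^ (- ((alpha + 2 - beta) / p)) *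
  modulus (1 - z) `^ (- (beta / p)).

Lemma majorant_ge0 p alpha beta z : 0 <= majorant p alpha beta z.
Proof. by rewrite mulr_ge0 ?powR_ge0. Qed.

Lemma majorant_kernel p alpha beta c (w : plane) : 0 < p -> 0 <= c ->
  disk (of_plane w) ->
  (c * majorant p alpha beta (of_plane w)) `^ p *
    (1 - modulus (of_plane w) ^+ 2) `^ (alpha + 1) = c `^ p * kernel beta w.
Proof.
move=> p0 c0; rewrite /disk /mkset => wd.
have D0 : 0 < 1 - modulus (of_plane w) ^+ 2.
  by rewrite subr_gt0 expr_lt1// modulus_ge0.
rewrite /majorant /kernel /depth /dist1 powRM ?majorant_ge0// powRM ?powR_ge0//.
rewrite -!powRrM !mulNr !divfK ?gt_eqF// -!mulrA; congr (_ * _).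
rewrite mulrC -mulrA -powRDgt0// mulrC; congr (_ `^ _ * _); ring.
Qed.

Lemma carleson_avg_le p alpha beta c F (u : R[i]) : 0 < p -> 0 < beta < 1 ->
  0 <= c -> disk u ->
  (forall z, disk z -> modulus (F z) <= c * majorant p alpha beta z) ->
  (carleson_avg p alpha F u <= (c `^ p * (6 * box_const beta / pi))%:E)%E.
Proof.
move=> p0 /andP[b0 b1] c0 du HF; have pi0 := pi_gt0 R.
have u1 : modulus u < 1 by [].
have u0 := modulus_ge0 u.
pose h := 1 - modulus u; have h0 : 0 < h by rewrite subr_gt0.
have H0 : 0 < 6 * h by rewrite mulr_gt0.
have H6 : 6 * h <= 6 by rewrite /h; lra.
have bc0 : 0 < box_const beta by rewrite box_const_gt0// b0.
(* A point [w] of the box has [|w - u| <= 2 * h], thus [1 - |w| <= 3 * h]. *)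
pose B : set plane := [set w : plane | 0 < depth w <= 6 * h] `&`
  [set w | `|w.1 - complex.Re u| <= 6 * h] `&` [set w | `|w.2 - complex.Im u| <= 6 * h].
have mB : measurable B by exact: measurable_box.
have subB (w : plane) : carleson_box u (of_plane w) -> B w /\ disk (of_plane w).
  move=> /(carleson_box_sub du)[wd]; rewrite -/h => wu; split=> //.
  have w1 : modulus (of_plane w) < 1 by [].
  have w0 := modulus_ge0 (of_plane w).
  have rw : `|w.1 - complex.Re u| <= 6 * h.
    have -> : w.1 - complex.Re u = complex.Re (of_plane w - u) by rewrite ReB.
    by apply: le_trans (normr_Re_le _) _; lra.
  have iw : `|w.2 - complex.Im u| <= 6 * h.
    have -> : w.2 - complex.Im u = complex.Im (of_plane w - u) by rewrite ImB.
    by apply: le_trans (normr_Im_le _) _; lra.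
  split=> //; split=> //=; rewrite /depth.
  have := modulusB_ge u (of_plane w); rewrite modulusBC => hw.
  by move: hw wu w0 w1; rewrite /h; set m := modulus (of_plane w) => *; apply/andP; split; nra.
have intle : (\int[area R]_(w in [set w : R * R | carleson_box u (of_plane w)])
     (modulus (F (of_plane w)) `^ p *
      (1 - modulus (of_plane w) ^+ 2) `^ (alpha + 1))%:E <=
    \int[area R]_(w in B) ((c `^ p)%:E * (kernel beta w)%:E))%E.
  apply: le_integral_ge0 => w wb.
  - by rewrite lee_fin mulr_ge0 ?powR_ge0.
  - by rewrite -EFinM lee_fin !mulr_ge0 ?powR_ge0.
  have [wB wd] := subB w wb; split=> //.
  rewrite -EFinM lee_fin -(majorant_kernel alpha beta p0 c0 wd).
  rewrite ler_wpM2r ?powR_ge0// ge0_ler_powR ?nnegrE ?modulus_ge0 ?(ltW p0)//.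
    by rewrite mulr_ge0 ?majorant_ge0.
  exact: HF.
have mk : measurable_fun B (fun w => (kernel beta w)%:E).
  by apply: measurable_funTS; exact: measurable_kernel.
have kn w : (0 <= (kernel beta w)%:E)%E by rewrite lee_fin mulr_ge0 ?powR_ge0.
have areaB : (\int[area R]_(w in B) ((c `^ p)%:E * (kernel beta w)%:E) =
    (pi^-1)%:E * ((c `^ p)%:E * \int[leb2]_(w in B) (kernel beta w)%:E))%E.
  rewrite integral_area_ge0//; last 2 first.
  - exact: measurable_funeM.
  - by move=> w _; apply: mule_ge0 => //; rewrite lee_fin powR_ge0.
  by rewrite ge0_integralZl_EFin ?powR_ge0.
rewrite areaB in intle.
have BI := box_integral (complex.Re u) (complex.Im u) b0 b1 H0 H6.
have {}intle := le_trans intle (lee_wpmul2l _ (lee_wpmul2l _ BI)).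
have D0 : 0 < 1 - modulus u ^+ 2 by rewrite subr_gt0 expr_lt1.
rewrite /carleson_avg.
apply: (@le_trans _ _ (((1 - modulus u ^+ 2)^-1)%:E *
   ((pi^-1)%:E * ((c `^ p)%:E * (box_const beta * (6 * h))%:E)))%E).
  apply: lee_wpmul2l; first by rewrite lee_fin invr_ge0 ltW.
  by apply: intle; rewrite lee_fin ?powR_ge0 ?invr_ge0// ltW.
rewrite -!EFinM lee_fin.
have hD : h <= 1 - modulus u ^+ 2 by rewrite /h; nra.
have -> : (1 - modulus u ^+ 2)^-1 * (pi^-1 * (c `^ p * (box_const beta * (6 * h)))) =
  (c `^ p * (6 * box_const beta / pi)) * (h / (1 - modulus u ^+ 2)) by ring.
rewrite -[leRHS]mulr1; apply: ler_wpM2l; last by rewrite ler_pdivrMr// mul1r.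
apply: mulr_ge0; first exact: powR_ge0.
by apply: divr_ge0; [apply: mulr_ge0 => //|]; exact: ltW.
Qed.

(** Uniformity over all vertices [u] holds since the integral of the weight over
    a box is at most proportional to [1 - |u|], wherever the box lies. *)
Lemma tent_norm_le zeta p alpha beta c F : 1 <= p -> 1 / 2 < zeta ->
  0 < beta < 1 -> 0 <= c ->
  (forall z, disk z -> modulus (F z) <= c * majorant p alpha beta z) ->
  (tent_norm zeta p alpha F <= (c * (6 * box_const beta / pi) `^ p^-1)%:E)%E.
Proof.
move=> p1 z2 bb c0 HF; have p0 : 0 < p by lra.
rewrite /tent_norm; set E := ess_sup _ _.
have [d [d0 d1 d2]] : exists d, [/\ 0 < d, d < 1 / 4 & d < 1 - 1 / (2 * zeta)].
  have z0 : 0 < 1 - 1 / (2 * zeta) by rewrite subr_gt0 ltr_pdivrMr; lra.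
  exists (Num.min (1 / 8) ((1 - 1 / (2 * zeta)) / 2)); split.
  - by rewrite lt_min divr_gt0//= divr_gt0.
  - by rewrite gt_min; apply/orP; left; lra.
  - by rewrite gt_min; apply/orP; right; lra.
have E0 : (0 <= E)%E.
  have pi0 := pi_gt0 R.
  apply: (@ess_sup_arc_ge _ 0 1) => //; first by rewrite lexx mulrn_wgt0.
  move=> t _.
  apply: (@le_trans _ _ (carleson_avg p alpha F ((1 - 2 * d)%:C * cis t)%R)).
    rewrite /carleson_avg mule_ge0 ?lee_fin ?invr_ge0 ?subr_ge0//.
      rewrite modulusM modulus_cis mulr1 modulus_real ger0_norm; last by lra.
      by rewrite exprn_ile1//; lra.
    by apply: integral_ge0 => w _; rewrite lee_fin mulr_ge0 ?powR_ge0.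
  apply: ereal_sup_ubound; exists ((1 - 2 * d)%:C * cis t) => //.
  by apply: Gamma_arc => //; rewrite subrr normr0 Gamma_arc_gt0.
have EC : (E <= (c `^ p * (6 * box_const beta / pi))%:E)%E.
  apply/ess_supP; apply: nearW => t; apply: ge_ereal_sup => _ [u [ud _] <-].
  exact: carleson_avg_le.
have K0 : 0 <= 6 * box_const beta / pi.
  apply: divr_ge0; last exact: pi_ge0.
  by apply: mulr_ge0 => //; apply/ltW/box_const_gt0.
have cK (K : R) : 0 <= K -> c * K `^ p^-1 = (c `^ p * K) `^ p^-1.
  by move=> ?; rewrite powRM ?powR_ge0// -powRrM mulfV ?gt_eqF// powRr1.
rewrite (cK _ K0).
rewrite -poweR_EFin; apply: gt0_ler_poweR => //.
- by rewrite invr_ge0 ltW.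
- by rewrite in_itv /= E0 leey.
- by rewrite in_itv /= leey andbT lee_fin mulr_ge0 ?powR_ge0.
Qed.

End majorant.

(** * Moments and the integral bound of the operator *)

Section moments.
Variable R : realType.
Variable mu : {finite_measure set (measurableTypeR R) -> \bar R}.
Local Notation I := (`[0, 1[%classic : set (measurableTypeR R)).

Lemma mu_ltoo (A : set (measurableTypeR R)) : measurable A -> (mu A < +oo)%E.
Proof. by move=> mA; rewrite -ge0_fin_numE ?fin_num_measure. Qed.

Lemma measurable_unit : measurable I.
Proof. exact: measurable_itv. Qed.

Lemma integrable_expr n : mu.-integrable I (EFin \o (fun t : R => t ^+ n)).
Proof.
apply: measurable_bounded_integrable => //.
- by apply: mu_ltoo; exact: measurable_unit.
- exists 1; split=> // M M1 t; rewrite /= in_itv /= => /andP[t0 t1].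
  by rewrite normrX ger0_norm// (le_trans _ (ltW M1))// exprn_ile1// ltW.
Qed.

Lemma moment_ge0 n : 0 <= moment mu n.
Proof.
by apply: Rintegral_ge0 => t /=; rewrite in_itv /= => /andP[t0 _]; rewrite exprn_ge0.
Qed.

Lemma moment_le0 n : moment mu n <= moment mu 0.
Proof.
apply: le_Rintegral; [exact: measurable_unit|exact: integrable_expr|exact: integrable_expr|].
by move=> t /=; rewrite in_itv /= => /andP[t0 t1]; rewrite expr0 exprn_ile1// ltW.
Qed.

(** On [`[a, 1[] the integrand [t ^ n] is at least [a ^ n]. *)
Lemma moment_ge_tail (a : R) n : 0 <= a < 1 ->
  a ^+ n * fine (mu [set` `[a, 1[]) <= moment mu n.
Proof.
move=> /andP[a0 a1].
have mE : measurable ([set` `[a, 1[] : set (measurableTypeR R)).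
  exact: measurable_itv.
rewrite -lee_fin EFinM fineK ?fin_num_measure//.
rewrite /moment /Rintegral fineK; last first.
  by apply: integrable_fin_num; [exact: measurable_unit|exact: integrable_expr].
rewrite -integral_cst//; apply: le_integral_ge0 => t /=.
- by rewrite lee_fin exprn_ge0.
- by rewrite in_itv /= => /andP[t0 _]; rewrite lee_fin exprn_ge0.
- rewrite !in_itv /= => /andP[t0 ->]; rewrite (le_trans a0 t0).
  by split=> //; rewrite lee_fin lerXn2r// nnegrE// (le_trans a0).
Qed.

Lemma integrable_polynomial N (c : nat -> R) :
  mu.-integrable I (EFin \o (fun t : R => \sum_(n < N) t ^+ n * c n)) /\
  (\int[mu]_(t in I) (\sum_(n < N) t ^+ n * c n))%R = \sum_(n < N) moment mu n * c n.
Proof.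
have term n : mu.-integrable I (EFin \o (fun t : R => t ^+ n * c n)).
  have := integrableZl measurable_unit (c n) (integrable_expr n).
  by apply: eq_integrable; [exact: measurable_unit|move=> t _ /=; rewrite -EFinM mulrC].
elim: N => [|N [IH1 IH2]].
  under eq_Rintegral do rewrite big_ord0.
  rewrite big_ord0 Rintegral_cst ?mul0r//.
  split=> //; have := integrable0 mu I.
  by apply: eq_integrable; [exact: measurable_unit|move=> t _ /=; rewrite big_ord0].
split.
  have := integrableD measurable_unit IH1 (term N).
  by apply: eq_integrable; [exact: measurable_unit|move=> t _ /=; rewrite big_ord_recr].
under eq_Rintegral do rewrite big_ord_recr /=.
rewrite RintegralD// IH2 big_ord_recr /=; congr (_ + _).
under eq_Rintegral do rewrite mulrC.
by rewrite RintegralZl// 1?mulrC//; exact: integrable_expr.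
Qed.

Lemma unimodular_rotation (S : R[i]) :
  exists w : R[i], modulus w = 1 /\ w * S = (modulus S)%:C.
Proof.
have [->|S0] := eqVneq S 0.
  by exists 1; rewrite modulus1 mulr0 modulus0.
exists ((modulus S)%:C / S); rewrite divfK//; split=> //.
by rewrite modulusM modulusV modulus_real ger0_norm ?modulus_ge0// divff// gt_eqF// modulus_gt0.
Qed.

Lemma cmeasurable_polynomial N (v : nat -> R[i]) (D : set (measurableTypeR R)) :
  cmeasurable D (fun t : R => \sum_(n < N) (t ^+ n)%:C * v n).
Proof.
apply: (@cmeasurable_sum _ _ _ D N
  (fun n (t : measurableTypeR R) => ((t : R) ^+ n)%:C * v n)) => k.
apply: cmeasurableM; last exact: cmeasurable_cst.
split; first by apply: measurable_funTS; exact: measurable_funX.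
exact: measurable_cst.
Qed.

(** Rotating the sum to the positive axis reduces the triangle inequality for
    a complex-valued integral to the real one. *)
Lemma moment_sum_le N (v : nat -> R[i]) :
  ((modulus (\sum_(n < N) (moment mu n)%:C * v n))%:E <=
   \int[mu]_(t in I) (modulus (\sum_(n < N) (t ^+ n)%:C * v n))%:E)%E.
Proof.
set S := \sum_(n < N) _.
have [w [w1 wS]] := unimodular_rotation S.
have [ic Ic] := integrable_polynomial N (fun n => complex.Re (w * v n)).
have -> : modulus S = \sum_(n < N) moment mu n * complex.Re (w * v n).
  have -> : modulus S = complex.Re (w * S) by rewrite wS.
  rewrite /S mulr_sumr Re_sum; apply: eq_bigr => n _.
  by rewrite mulrCA; case: (w * v n) => x y /=; rewrite mul0r subr0.
rewrite -Ic /Rintegral fineK; last first.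
  by apply: integrable_fin_num; [exact: measurable_unit|exact: ic].
apply: le_trans (lee_abs _) _; apply: le_trans (le_abse_integral _ measurable_unit _) _.
  by case/integrableP: ic.
apply: le_integral_ge0 => // [t _|t It]; first by rewrite lee_fin modulus_ge0.
split=> //; rewrite lee_fin.
have -> : \sum_(n < N) t ^+ n * complex.Re (w * v n) =
   complex.Re (w * \sum_(n < N) (t ^+ n)%:C * v n).
  rewrite mulr_sumr Re_sum; apply: eq_bigr => n _.
  by rewrite [in RHS]mulrCA; case: (w * v n) => x y /=; rewrite mul0r subr0.
by rewrite (le_trans (normr_Re_le _))// modulusM w1 mul1r.
Qed.

Definition cesaro_coef (e : nat -> R[i]) n : R[i] :=
  (moment mu n)%:C * \sum_(k < n.+1) e k.

Lemma geo_coef1 (e : nat -> R[i]) n : geo_coef e 1 n = \sum_(k < n.+1) e k.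
Proof. by apply: eq_bigr => k _; rewrite expr1n mulr1. Qed.

Lemma cesaro_pseries e h : pseries e h 1 ->
  pseries (cesaro_coef e) (powersum (cesaro_coef e)) 1.
Proof.
move=> eh; have m1 : modulus (1 : R[i]) <= 1 by rewrite modulus1.
have gh := pseries_geo eh m1.
apply: powersumP => r r01; have r0 : 0 <= r by case/andP: r01.
have := is_cvg_seriesZ (k := moment mu 0) (pseries_summable gh r01).
apply: series_le_cvg => n; rewrite ?psnorm_ge0//.
  by rewrite mulr_ge0 ?moment_ge0// mulr_ge0 ?modulus_ge0// exprn_ge0.
rewrite /psnorm /cesaro_coef modulusM -geo_coef1 modulus_real.
rewrite ger0_norm ?moment_ge0// -mulrA ler_wpM2r ?moment_le0//.
by rewrite mulr_ge0 ?modulus_ge0// exprn_ge0.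
Qed.

(** The integral representation, as an inequality: the partial sums of the
    geometric product converge uniformly on the segment from [0] to [z]. *)
Lemma cesaro_le e h z : pseries e h 1 -> modulus z < 1 ->
  ((modulus (powersum (cesaro_coef e) z))%:E <=
   \int[mu]_(t in I) (modulus (h (t%:C * z)) / modulus (1 - t%:C * z))%:E)%E.
Proof.
move=> eh z1; have m1 : modulus (1 : R[i]) <= 1 by rewrite modulus1.
have gh := pseries_geo eh m1.
pose v n := geo_coef e 1 n * z ^+ n.
pose G w := h w / (1 - 1 * w).
have It (t : R) : I t -> modulus (t%:C * z) <= modulus z.
  rewrite /= in_itv /= => /andP[t0 /ltW t1].
  by rewrite modulusM modulus_real ger0_norm// ler_piMl ?modulus_ge0.
have rz : 0 <= modulus z < 1 by rewrite modulus_ge0.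
have vt (t : R) N : \sum_(n < N) (t ^+ n)%:C * v n =
   \sum_(n < N) geo_coef e 1 n * (t%:C * z) ^+ n.
  by apply: eq_bigr => n _; rewrite /v exprMn rmorphXn mulrCA.
have mG : measurable_fun I (fun t : R => modulus (G (t%:C * z))).
  apply: measurable_modulus.
  apply: (@cmeasurable_cvg _ _ _ _ (fun N (t : R) => \sum_(n < N) (t ^+ n)%:C * v n)).
    by move=> N; exact: cmeasurable_polynomial.
  move=> t tI; under eq_fun do rewrite vt.
  exact: (iffLR (sums_toP _ _) (gh _ (le_lt_trans (It t tI) z1))).
pose tau := tail (psnorm (geo_coef e 1) (modulus z)).
have tau0 N : 0 <= tau N.
  apply: tail_ge0; last exact: pseries_summable gh rz.
  by move=> n; rewrite psnorm_ge0// modulus_ge0.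
have -> : (\int[mu]_(t in I) (modulus (h (t%:C * z)) / modulus (1 - t%:C * z))%:E
   = \int[mu]_(t in I) (modulus (G (t%:C * z)))%:E)%E.
  by apply: eq_integral => t _; rewrite /G mul1r modulusM modulusV.
have bound N : ((modulus (\sum_(n < N) (moment mu n)%:C * v n))%:E <=
   \int[mu]_(t in I) (modulus (G (t%:C * z)))%:E + (tau N * fine (mu I))%:E)%E.
  apply: le_trans (moment_sum_le _ _) _.
  have -> : (tau N * fine (mu I))%:E = ((tau N)%:E * mu I)%E.
    by rewrite EFinM fineK ?fin_num_measure//; exact: measurable_unit.
  rewrite -(integral_cst mu measurable_unit) -ge0_integralD//; first last.
  - by move=> t _; rewrite lee_fin tau0.
  - exact/measurable_EFinP.
  - by move=> t _; rewrite lee_fin modulus_ge0.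
  apply: le_integral_ge0 => t; rewrite ?lee_fin ?modulus_ge0//.
    by move=> _; rewrite addr_ge0 ?modulus_ge0.
  move=> tI; split=> //; rewrite vt -lerBlDl.
  have := @pseries_tail _ _ _ _ (modulus z) (t%:C * z) N gh.
  rewrite It //= z1 => /(_ isT); apply: le_trans.
  by rewrite modulusBC modulusB_ge.
case: (\int[mu]_(t in I) (modulus (G (t%:C * z)))%:E)%E bound => [b|_|].
- move=> bound; rewrite lee_fin; apply/ler_addgt0Pr => eps eps0.
  have /sums_toP S := cesaro_pseries eh z1.
  have tc : tau N * fine (mu I) @[N --> \oo] --> 0.
    under eq_fun do rewrite mulrC; apply: cvg0Ml.
    exact: tail_cvg0 (pseries_summable gh rz).
  have /cvgrPdist_le /(_ eps eps0) [N0 _ HN] := tc.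
  apply: (modulus_cvg_le (N := N0) S) => N NN0.
  have := bound N; rewrite -EFinD lee_fin.
  have -> : \sum_(k < N) cesaro_coef e k * z ^+ k = \sum_(n < N) (moment mu n)%:C * v n.
    by apply: eq_bigr => n _; rewrite /v /cesaro_coef geo_coef1 mulrA.
  move/le_trans; apply; rewrite lerD2l.
  by have := HN N NN0; rewrite sub0r normrN; apply: le_trans; exact: ler_norm.
- by rewrite leey.
- by move=> /(_ 0%N); rewrite addNye leeNy_eq.
Qed.

End moments.

(** * Pointwise estimate of the operator *)

Section cesaro_estimate.
Variable R : realType.
Variable mu : {finite_measure set (measurableTypeR R) -> \bar R}.
Local Notation I := (`[0, 1[%classic : set (measurableTypeR R)).
Implicit Types (e : nat -> R[i]) (h : R[i] -> R[i]) (z w : R[i]).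

(** The Carleson condition for the part of [mu] on [`[rho, 1[], written with the
    distance [1 - t] to the endpoint as the dyadic integration requires. *)
Definition carleson_from (rho eps : R) := forall eta : R, 0 < eta ->
  (mu ([set` `[rho, 1[]%R `&` [set t : R | 0 < 1 - t <= eta]%R) <= (eps * eta)%:E)%E.

Lemma vanishing_carleson_from (eps : R) : 0 < eps -> vanishing_carleson mu ->
  exists2 rho, 0 < rho < 1 & carleson_from rho eps.
Proof.
move=> eps0 /cvgrPdist_le /(_ eps eps0) [r /= r0 Hr].
have [rho [rho0 rho1 rhor]] : exists rho : R, [/\ 0 < rho, rho < 1 & 1 - rho < r].
  exists (1 - Num.min (1 / 2) (r / 2)).
  have m0 : 0 < Num.min (1 / 2) (r / 2) by rewrite lt_min; apply/andP; split; lra.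
  have m1 : Num.min (1 / 2) (r / 2) <= 1 / 2 by rewrite ge_min lexx.
  have m2 : Num.min (1 / 2) (r / 2) <= r / 2 by rewrite ge_min lexx orbT.
  by split; lra.
exists rho; first by rewrite rho0.
move=> eta eta0; set t0 : R := Num.max rho (1 - eta).
have t0rho : rho <= t0 by rewrite le_max lexx.
have t0eta : 1 - eta <= t0 by rewrite le_max lexx orbT.
have t01 : t0 < 1 by rewrite gt_max rho1/=; lra.
have mE : measurable ([set` `[t0, 1[] : set (measurableTypeR R)).
  exact: measurable_itv.
apply: (@le_trans _ _ (mu [set` `[t0, 1[])).
  apply: le_measure; rewrite ?inE//.
    apply: measurable_layer; first exact: measurable_itv.
    by apply: measurable_funB => //; exact: measurable_cst.
  move=> t [/=]; rewrite !in_itv /= => /andP[t1 t2] /andP[_ t3].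
  by rewrite t2 andbT ge_max t1 /=; lra.
have /Hr : ball_ (fun x : R => `|x|) (1 : R) r t0 by rewrite /ball_ /= ger0_norm; lra.
move=> /(_ t01); rewrite sub0r normrN => /(le_trans (ler_norm _)).
rewrite ler_pdivrMr; last by lra.
rewrite -(fineK (fin_num_measure mu _ mE)) lee_fin => /le_trans; apply.
by apply: ler_wpM2l; [exact: ltW|lra].
Qed.

(** The exponent of growth is split between the distance of [z] to the circle
    and the distance of [t] to [1]; what is left of the kernel is then compared
    with the distance of [z] to [1]. *)
Lemma cesaro_split (a b M rho sig eps : R) e h z :
  0 < a -> 0 < b < 1 -> 0 <= M -> 0 < rho < 1 -> 0 <= eps -> 0 <= sig ->
  carleson_from rho eps -> pseries e h 1 ->
  (forall w, modulus w < 1 -> modulus (h w) <= M * (1 - modulus w) `^ (- (a + b))) ->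
  (forall w, modulus w <= rho -> modulus (h w) <= sig) ->
  modulus z < 1 ->
  modulus (powersum (cesaro_coef mu e) z) <= sig * fine (mu I) / (1 - rho) +
    M * eps * (2 * near_const b + far_const b) *
      (1 - modulus z) `^ (- a) * modulus (1 - z) `^ (- b).
Proof.
move=> a0 /andP[b0 b1] M0 /andP[rho0 rho1] eps0 sig0 Hmu eh Hh Hs z1.
have z0 := modulus_ge0 z.
set dl := modulus (1 - z).
have dl0 : 0 < dl by exact: modulus_1B_gt0.
have d0 : 0 < 1 - modulus z by rewrite subr_gt0.
rewrite -lee_fin; apply: le_trans (cesaro_le mu eh z1) _.
have mv : measurable_fun setT (fun t : measurableTypeR R => (1 - t : R)).
  by apply: measurable_funB => //; exact: measurable_cst.
have mpow c q : measurable_fun setT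
    (fun t : measurableTypeR R => (c * (1 - t) `^ q)%:E).
  apply/measurable_EFinP; apply: measurable_funM; first exact: measurable_cst.
  exact: (measurableT_comp (measurable_powR q) mv).
pose c1 := M * (1 - modulus z) `^ (- a) * (2 / dl).
pose c2 := M * (1 - modulus z) `^ (- a).
have c20 : 0 <= c2 by rewrite /c2 mulr_ge0 ?powR_ge0.
have c10 : 0 <= c1 by rewrite mulr_ge0// divr_ge0// ltW.
pose J : set (measurableTypeR R) := [set` `[rho, 1[].
have mJ : measurable J by exact: measurable_itv.
have mI0 : measurable ([set` `[0, rho[] : set (measurableTypeR R)).
  exact: measurable_itv.
have mfar : measurable (J `&` [set t : R | dl < 1 - t]).
  apply: measurableI => //.
  have -> : [set t : R | dl < 1 - t] =
      (fun t : measurableTypeR R => (1 - t : R)) @^-1` [set` `]dl, +oo[].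
    by apply/seteqP; split => t /=; rewrite in_itv /= andbT.
  by rewrite -[X in measurable X]setTI; exact: mv.
apply: (@le_trans _ _ (\int[mu]_(t in [set` `[0%R, rho[]) (sig / (1 - rho))%:E +
    \int[mu]_(t in J `&` [set t : R | 0 < 1 - t <= dl]%R) (c1 * (1 - t) `^ (- b))%:E +
    \int[mu]_(t in J `&` [set t : R | dl < 1 - t]%R) (c2 * (1 - t) `^ (- (1 + b)))%:E)%E).
  apply: integral_pieces_le => //.
  - exact: measurable_layer.
  - by move=> t; rewrite lee_fin divr_ge0// subr_ge0 ltW.
  - by move=> t; rewrite lee_fin mulr_ge0 ?powR_ge0.
  - by move=> t; rewrite lee_fin mulr_ge0 ?powR_ge0.
  - by move=> t _; rewrite lee_fin divr_ge0 ?modulus_ge0.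
  move=> t; rewrite /= !in_itv /= => /andP[t0 t1].
  have x0 : 0 < 1 - t by rewrite subr_gt0.
  have mtz : modulus (t%:C * z) = t * modulus z.
    by rewrite modulusM modulus_real ger0_norm.
  have tz1 : t * modulus z < 1 by nra.
  have k1 : 1 - t * modulus z <= modulus (1 - t%:C * z).
    by rewrite -mtz -(modulus1 R) modulusB_ge.
  have k2 : 1 - t <= 1 - t * modulus z by nra.
  have k3 : 1 - modulus z <= 1 - t * modulus z by nra.
  have k0 : 0 < modulus (1 - t%:C * z) by lra.
  have k4 : dl / 2 <= modulus (1 - t%:C * z).
    have : dl <= modulus (1 - t%:C * z) + modulus (t%:C * z - z).
      exact: modulusB_triangle.
    have -> : t%:C * z - z = - ((1 - t)%:C * z) by rewrite rmorphB mulrBl mul1r opprB.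
    rewrite modulusN modulusM modulus_real gtr0_norm// => ?.
    have : (1 - t) * modulus z <= 1 - t * modulus z by nra.
    by lra.
  have [trho|rhot] := ltP t rho.
    constructor 1; rewrite t0; split=> //; rewrite lee_fin.
    apply: ler_pM; rewrite ?modulus_ge0 ?invr_ge0 ?modulus_ge0//.
      by apply: Hs; rewrite mtz; nra.
    by rewrite lef_pV2 ?posrE//; lra.
  have hM : modulus (h (t%:C * z)) <= c2 * (1 - t) `^ (- b).
    have := Hh (t%:C * z); rewrite mtz => /(_ tz1) /le_trans; apply.
    rewrite /c2 -mulrA ler_wpM2l// opprD powRDgt0; last by lra.
    apply: ler_pM; rewrite ?powR_ge0//.
      by apply: powRN_le => //; exact: ltW.
    by apply: powRN_le => //; exact: ltW.
  have q0 : 0 <= c2 * (1 - t) `^ (- b) by rewrite mulr_ge0 ?powR_ge0.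
  have Jt : J t by rewrite /J /= in_itv /= rhot t1.
  have [xd|dx] := leP (1 - t) dl.
    constructor 2; rewrite x0; split=> //; rewrite lee_fin.
    rewrite /c1 -/c2 mulrAC; apply: ler_pM; rewrite ?modulus_ge0 ?invr_ge0 ?modulus_ge0//.
    by rewrite -[2 / dl]invf_div lef_pV2 ?posrE// divr_gt0.
  constructor 3; split=> //; rewrite lee_fin.
  have -> : (1 - t) `^ (- (1 + b)) = (1 - t) `^ (- b) * (1 - t)^-1.
    have -> : - (1 + b) = - b + - 1 by ring.
    by rewrite powRDgt0// powR_inv1// ltW.
  rewrite mulrA.
  apply: ler_pM; rewrite ?modulus_ge0 ?invr_ge0 ?modulus_ge0//.
  by rewrite lef_pV2 ?posrE//; lra.
have pm (D : set (measurableTypeR R)) q :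
    measurable_fun D (fun t : measurableTypeR R => ((1 - t) `^ q)%:E).
  apply/measurable_EFinP; apply: measurable_funTS.
  exact: (measurableT_comp (measurable_powR q) mv).
have i1 : (\int[mu]_(t in [set` `[0%R, rho[]) (sig / (1 - rho))%:E <=
    (sig * fine (mu I) / (1 - rho))%:E)%E.
  have -> : (sig * fine (mu I) / (1 - rho))%:E = ((sig / (1 - rho))%:E * mu I)%E.
    by rewrite mulrAC EFinM fineK ?fin_num_measure//; exact: measurable_unit.
  rewrite integral_cst//; apply: lee_wpmul2l; first by rewrite lee_fin divr_ge0// subr_ge0 ltW.
  apply: le_measure; rewrite ?inE//.
  by move=> t /=; rewrite !in_itv /= => /andP[-> /lt_trans]; exact.
have i2 : (\int[mu]_(t in J `&` [set t : R | 0 < 1 - t <= dl]%R)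
    (c1 * (1 - t) `^ (- b))%:E <= (c1 * (eps * near_const b * dl `^ (1 - b)))%:E)%E.
  under eq_integral do rewrite EFinM.
  rewrite ge0_integralZl_EFin//; first last.
  - by move=> t _; rewrite lee_fin powR_ge0.
  - exact: measurable_layer.
  rewrite (EFinM c1); apply: lee_wpmul2l => //.
  apply: (@integral_near _ _ _ mu J (fun t : measurableTypeR R => 1 - t : R)) => //.
  - exact: ltW.
  - by move=> eta /andP[eta0 _]; exact: Hmu.
have i3 : (\int[mu]_(t in J `&` [set t : R | dl < 1 - t]%R)
    (c2 * (1 - t) `^ (- (1 + b)))%:E <= (c2 * (eps * far_const b * dl `^ (- b)))%:E)%E.
  under eq_integral do rewrite EFinM.
  rewrite ge0_integralZl_EFin//; last first.
    by move=> t _; rewrite lee_fin powR_ge0.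
  rewrite (EFinM c2); apply: lee_wpmul2l => //.
  exact: (@integral_far _ _ _ mu J (fun t : measurableTypeR R => 1 - t : R)).
apply: le_trans (leeD (leeD i1 i2) i3) _.
rewrite -!EFinD lee_fin -addrA lerD2l.
have -> : dl `^ (1 - b) = dl * dl `^ (- b) by rewrite powRDgt0// powRr1// ltW.
rewrite /c1 /c2 le_eqVlt; apply/orP; left; apply/eqP; clear i1 i2 i3.
move: (near_const b) (far_const b) (dl `^ _) (_ `^ _) => A B X Y.
by field; rewrite gt_eqF.
Qed.

Lemma cesaro_majorant (p alpha beta M rho sig eps : R) e h z :
  1 <= p -> 0 < beta -> beta < 1 -> beta < alpha + 2 ->
  0 <= M -> 0 < rho < 1 -> 0 <= eps -> 0 <= sig ->
  carleson_from rho eps -> pseries e h 1 ->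
  (forall w, modulus w < 1 ->
    modulus (h w) <= M * (1 - modulus w) `^ (- ((alpha + 2) / p))) ->
  (forall w, modulus w <= rho -> modulus (h w) <= sig) ->
  disk z ->
  modulus (powersum (cesaro_coef mu e) z) <=
    (2 `^ (beta / p) * (sig * fine (mu I) / (1 - rho)) +
     2 `^ ((alpha + 2 - beta) / p) * (M * eps *
        (2 * near_const (beta / p) + far_const (beta / p)))) *
    majorant p alpha beta z.
Proof.
move=> p1 beta0 beta1 ba M0 rho01 eps0 sig0 Hmu eh Hh Hs z1.
have p0 : 0 < p by lra.
have z0 := modulus_ge0 z.
have [a [a0 aE]] : exists a : R, 0 < a /\ a = (alpha + 2 - beta) / p.
  by exists ((alpha + 2 - beta) / p); rewrite divr_gt0// subr_gt0.
have [b [b0 [b1 bE]]] : exists b : R, 0 < b /\ b < 1 /\ b = beta / p.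
  exists (beta / p); rewrite divr_gt0//; split=> //; split=> //.
  by rewrite ltr_pdivrMr// mul1r; lra.
have abE : (alpha + 2) / p = a + b by rewrite aE bE -mulrDl subrK.
rewrite abE in Hh; rewrite /majorant -aE -bE.
have := cesaro_split a0 _ M0 rho01 eps0 sig0 Hmu eh Hh Hs z1.
rewrite b0 b1 => /(_ isT) /le_trans; apply.
have ub0 : 0 <= fine (mu I) by apply: fine_ge0; exact: measure_ge0.
have n0 : 0 <= M * eps * (2 * near_const b + far_const b).
  have nb := ltW (near_const_gt0 b1); have fb := ltW (far_const_gt0 b0).
  apply: mulr_ge0; first exact: mulr_ge0.
  by apply: addr_ge0 => //; exact: mulr_ge0.
have s0 : 0 <= sig * fine (mu I) / (1 - rho).
  by case/andP: rho01 => _ ?; rewrite divr_ge0 ?mulr_ge0// subr_ge0 ltW.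
have D0 : 0 < 1 - modulus z ^+ 2 by rewrite subr_gt0 expr_lt1.
have dl0 : 0 < modulus (1 - z) by exact: modulus_1B_gt0.
have dl2 : modulus (1 - z) <= 2.
  rewrite (le_trans (modulusD _ _))// modulusN modulus1.
  by move: z1; rewrite /disk /mkset => ?; lra.
have e1 : (1 - modulus z) `^ (- a) <= 2 `^ a * (1 - modulus z ^+ 2) `^ (- a).
  apply: powRN_le2 => //; first exact: ltW.
  by move: z1; rewrite /disk /mkset => ?; nra.
have e2 : 1 <= 2 `^ b * ((1 - modulus z ^+ 2) `^ (- a) * modulus (1 - z) `^ (- b)).
  have h1 : 1 <= (1 - modulus z ^+ 2) `^ (- a).
    have := @powRN_le R (1 - modulus z ^+ 2) 1 a (ltW a0) D0.
    by rewrite powR1; apply; rewrite gerBl exprn_ge0.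
  have h2 : 2 `^ (- b) <= modulus (1 - z) `^ (- b) by exact: powRN_le (ltW b0) dl0 dl2.
  have u1 : 2 `^ b * (1 * 2 `^ (- b)) = 1 :> R.
    by rewrite mul1r -powRDgt0// subrr powRr0.
  rewrite -[X in X <= _]u1.
  by apply: ler_wpM2l; rewrite ?powR_ge0//; apply: ler_pM; rewrite ?powR_ge0.
move: n0 s0 e1 e2 (powR_ge0 (modulus (1 - z)) (- b)).
move: (M * eps * _) (sig * _ / _) (_ `^ (- a)) (_ `^ (- b)) (_ `^ (- a)) => A B X Y Z.
move: (2 `^ a) (2 `^ b) => U V A0 B0 h1 h2 Y0.
rewrite mulrDl; apply: lerD.
  rewrite mulrAC -[X in X <= _]mul1r; exact: ler_wpM2r.
have -> : U * A * (X * Y) = A * (U * X) * Y by ring.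
by apply: ler_wpM2r => //; exact: ler_wpM2l.
Qed.

End cesaro_estimate.

(** * Normal families *)

Section normal_families.
Variable R : realType.
Implicit Types (e : nat -> nat -> R[i]) (u : nat -> nat -> R).

(** By Tychonoff the sequence has a cluster point for pointwise convergence;
    the basic neighbourhoods being indexed by [nat], a subsequence converges. *)
Lemma diagonal_subsequence u (B : nat -> R) : (forall n k, `|u n k| <= B k) ->
  exists (phi : nat -> nat) (p : nat -> R),
    {homo phi : m n / (m < n)%N >-> (m < n)%N} /\
    forall k, u (phi n) k @[n --> \oo] --> p k.
Proof.
move=> uB; pose A k : set R := [set` `[- B k, B k]].
have cA k : compact (A k) by exact: segment_compact.
have C := @tychonoff nat (fun=> R) A cA.
have uA : \forall n \near \oo, forall k, A k (u n k).
  by apply: nearW => n k; rewrite /A /= in_itv /= -ler_norml.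
pose F : set_system (prod_topology (fun _ : nat => R)) := fmap u \oo.
have [p [_ clp]] := C F _ uA.
have nearp m (eps : R) : 0 < eps ->
    \forall q \near (p : prod_topology (fun _ : nat => R)),
      forall k, (k < m)%N -> `|p k - q k| < eps.
  move=> eps0; elim: m => [|m IHm]; first by apply: (@filterE _ (nbhs p)) => q k; rewrite ltn0.
  have pm : nbhs p [set q | `|p m - q m| < eps].
    apply: (@proj_continuous nat (fun=> R) m p [set x | `|p m - x| < eps]).
    by apply/nbhs_ballP; exists eps.
  apply: (@filterS2 _ (nbhs p) _ _ _ _ _ pm IHm) => q /= qm qk k.
  by rewrite ltnS leq_eqVlt => /orP[/eqP ->|/qk].
have step (m N : nat) : exists n, (N < n)%N /\
    forall k, (k < m)%N -> `|p k - u n k| < m.+1%:R^-1.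
  have m0 : 0 < (m.+1%:R : R)^-1 by rewrite invr_gt0 ltr0n.
  have tailN : F (u @` [set n | (N < n)%N]).
    by exists N.+1 => // n /= Nn; exists n.
  have [_ [[n /= Nn <-] H]] := clp _ _ tailN (nearp m _ m0).
  by exists n.
have [nxt Hnxt] := choice (fun mN => step mN.1 mN.2).
(* [phi n] is chosen after [phi n.-1], close to [p] in the first [n] coordinates. *)
pose phi := fix phi n := if n is n'.+1 then nxt (n, phi n') else nxt (0%N, 0%N).
exists phi, p; split=> [|k].
  by apply: homo_ltn => [n m l|n]; [exact: ltn_trans|exact: (Hnxt (n.+1, phi n)).1].
apply/cvg_dist0P; apply: squeeze0 (@cvg_harmonic R).
exists k.+1 => // n /= kn; rewrite normr_ge0 /= distrC ltW//.
case: n kn => // n kn; exact: (Hnxt (n.+1, phi n)).2.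
Qed.

Lemma diagonal_subsequence_complex e (B : nat -> R) :
  (forall n k, modulus (e n k) <= B k) ->
  exists (phi : nat -> nat) (a : nat -> R[i]),
    {homo phi : m n / (m < n)%N >-> (m < n)%N} /\
    forall k, modulus (e (phi n) k - a k) @[n --> \oo] --> 0.
Proof.
move=> eB.
pose u n k := if odd k then complex.Im (e n k./2) else complex.Re (e n k./2).
have uB n k : `|u n k| <= B k./2.
  rewrite /u; case: ifP => _; apply: le_trans (eB n k./2).
    exact: normr_Im_le.
  exact: normr_Re_le.
have [phi [p [phi_lt up]]] := diagonal_subsequence uB.
exists phi, (fun k => p k.*2 +i* p k.*2.+1); split=> // k; apply: ccvg_ReIm => /=.
  by have := up k.*2; rewrite /u odd_double doubleK.
by have := up k.*2.+1; rewrite /u /= odd_double uphalf_double.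
Qed.

End normal_families.

(** * Growth in the whole disk *)

Section global_growth.
Variable R : realType.
Implicit Types (e a : nat -> R[i]) (h : R[i] -> R[i]) (w : R[i]).

(** A bound on a circle controls the function inside it by Cauchy estimates and
    a geometric series. *)
Lemma interior_bound e h (r q B : R) w : pseries e h 1 -> 0 < r < 1 -> 0 <= B ->
  0 <= q < 1 -> (forall v, modulus v = r -> modulus (h v) <= B) ->
  modulus w <= q * r -> modulus (h w) <= B * (1 - q)^-1.
Proof.
move=> eh /andP[r0 r1] B0 /andP[q0 q1] hB wq.
have ce n : modulus (e n) * r ^+ n <= B.
  by apply: (cauchy_estimate (rho := 1) _ eh) => //; rewrite ltW.
have w1 : modulus w < 1 by nra.
have /sums_toP S := eh w w1.
apply: (modulus_cvg_le (N := 0%N) S) => n _.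
rewrite (le_trans (modulus_sum _ _ _))//.
apply: (@le_trans _ _ (\sum_(k < n) B * q ^+ k)).
  apply: ler_sum => k _; rewrite modulusM modulusX.
  apply: (@le_trans _ _ (modulus (e k) * (q * r) ^+ k)).
    by rewrite ler_wpM2l ?modulus_ge0// lerXn2r// nnegrE ?modulus_ge0// mulr_ge0// ltW.
  by rewrite exprMn mulrCA mulrC ler_wpM2r// exprn_ge0.
by rewrite -mulr_sumr ler_wpM2l// geometric_sum_le.
Qed.

(** Near the circle the expansion at [0] is recentred; the points inside are
    reached from a circle on which the bound is known. *)
Lemma growth_disk (zeta p alpha : R) : 1 <= p -> 1 / 2 < zeta -> - 2 < alpha ->
  exists2 C : R, 0 < C & forall e h (M : R), 0 <= M -> pseries e h 1 ->
    (tent_norm zeta p alpha h <= M%:E)%E ->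
    forall w, modulus w < 1 ->
      modulus (h w) <= C * M * (1 - modulus w) `^ (- ((alpha + 2) / p)).
Proof.
move=> p1 z2 a2; have [d0 d00 Hg] := growth alpha p1 z2.
have [|C C0 H] := Hg 1; first by rewrite ltr01 lexx.
have p0 : 0 < p by lra.
have s0 : 0 <= (alpha + 2) / p by rewrite divr_ge0; lra.
have [d [dgt0 dd0 d1]] : exists d : R, [/\ 0 < d, d < d0 & d < 1 / 2].
  exists (Num.min (d0 / 2) (1 / 4)).
  have m0 : 0 < Num.min (d0 / 2) (1 / 4) by rewrite lt_min; apply/andP; split; lra.
  have m1 : Num.min (d0 / 2) (1 / 4) <= 1 / 4 by rewrite ge_min lexx orbT.
  have m2 : Num.min (d0 / 2) (1 / 4) <= d0 / 2 by rewrite ge_min lexx.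
  by split; lra.
have [r [r0 r1 rd]] : exists r : R, [/\ 0 < r, r < 1 & 1 - d < r].
  by exists (1 - d / 2); split; lra.
pose q := (1 - d) / r.
have q0 : 0 <= q by rewrite divr_ge0; lra.
have q1 : q < 1 by rewrite ltr_pdivrMr// mul1r.
have qr : q * r = 1 - d by rewrite divfK// gt_eqF.
pose K := (1 - r) `^ (- ((alpha + 2) / p)) * (1 - q)^-1.
have K0 : 0 <= K by rewrite mulr_ge0 ?powR_ge0// invr_ge0 subr_ge0 ltW.
exists (C * (1 + K)) => [|e h M M0 eh hM w w1]; first by rewrite mulr_gt0//; lra.
have near_circle v : 1 - d < modulus v < 1 ->
    modulus (h v) <= C * M * (1 - modulus v) `^ (- ((alpha + 2) / p)).
  move=> /andP[v1 v2]; have [b bh] := pseries_recenter eh v2.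
  apply: (H h v b (1 - modulus v)) => //; first by apply/andP; split; lra.
  by rewrite mul1r; lra.
have CM : 0 <= C * M by rewrite mulr_ge0// ltW.
have w0 := modulus_ge0 w.
have [wd|wd] := ltP (1 - d) (modulus w).
  have := near_circle w; rewrite wd w1 => /(_ isT) /le_trans; apply.
  rewrite ler_wpM2r ?powR_ge0// -mulrA ler_wpM2l ?(ltW C0)// mulrDl mul1r.
  by rewrite lerDl mulr_ge0.
have hr v : modulus v = r -> modulus (h v) <= C * M * (1 - r) `^ (- ((alpha + 2) / p)).
  by move=> vr; have := near_circle v; rewrite vr rd r1; exact.
have := @interior_bound e h r q _ w eh _ _ _ hr.
rewrite r0 r1 q0 q1 qr => /(_ isT) h1.
apply: le_trans (h1 _ isT wd) _; first by rewrite mulr_ge0 ?powR_ge0.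
rewrite -[X in X <= _]mulrA -/K.
have pw : 1 <= (1 - modulus w) `^ (- ((alpha + 2) / p)).
  have := @powRN_le R (1 - modulus w) 1 _ s0; rewrite powR1; apply; lra.
apply: (@le_trans _ _ (C * (1 + K) * M)).
  rewrite [C * (1 + K) * M]mulrAC; apply: ler_wpM2l => //; lra.
rewrite ler_peMr//; apply: mulr_ge0 => //; apply: mulr_ge0; lra.
Qed.

End global_growth.

(** * Compactness of bounded families *)

Section montel.
Variable R : realType.
Implicit Types (e : nat -> R[i]) (h : R[i] -> R[i]) (w : R[i]).

Definition growth_bound s M h := forall w, modulus w < 1 ->
  modulus (h w) <= M * (1 - modulus w) `^ (- s).

Lemma growth_bound_coef e h (s M r : R) k : pseries e h 1 -> growth_bound s M h ->
  0 <= r < 1 -> modulus (e k) * r ^+ k <= M * (1 - r) `^ (- s).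
Proof.
move=> eh hM r01; apply: (cauchy_estimate (rho := 1) _ eh) => // z zr.
by have := hM z; rewrite zr; apply; case/andP: r01.
Qed.

Lemma sum_cvg0 (N : nat) (v : nat -> nat -> R) :
  (forall k, v n k @[n --> \oo] --> 0) -> \sum_(k < N) v n k @[n --> \oo] --> 0.
Proof.
move=> v0; elim: N => [|N IHN].
  by under eq_fun do rewrite big_ord0; exact: cvg_cst.
by under eq_fun do rewrite big_ord_recr; exact: cvg0D.
Qed.

(** Cauchy estimates make the tails of the power series uniformly small, so
    that convergence of each coefficient gives locally uniform convergence. *)
Lemma montel (s M : R) (e : nat -> nat -> R[i]) (h : nat -> R[i] -> R[i]) :
  0 <= M -> (forall n, pseries (e n) (h n) 1) -> (forall n, growth_bound s M (h n)) ->
  exists (phi : nat -> nat) (a : nat -> R[i]) (H : R[i] -> R[i]),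
    [/\ {homo phi : m n / (m < n)%N >-> (m < n)%N}, pseries a H 1,
        growth_bound s M H &
        forall rho eps, 0 < rho < 1 -> 0 < eps -> \forall n \near \oo,
          forall w, modulus w <= rho -> modulus (h (phi n) w - H w) <= eps].
Proof.
move=> M0 eh hM; pose B r := M * (1 - r) `^ (- s).
have B0 r : 0 <= B r by rewrite mulr_ge0 ?powR_ge0.
have ce n k r : 0 <= r < 1 -> modulus (e n k) * r ^+ k <= B r.
  by move=> r01; exact: growth_bound_coef (eh n) (hM n) r01.
have eB n k : modulus (e n k) <= B (1 / 2) / (1 / 2) ^+ k.
  by rewrite ler_pdivlMr ?exprn_gt0//; apply: ce; apply/andP; split; lra.
have [phi [a [phi_lt ea]]] := diagonal_subsequence_complex eB.
have ca k r : 0 <= r < 1 -> modulus (a k) * r ^+ k <= B r.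
  move=> r01; have [r0 r1] := andP r01.
  rewrite -[r in r ^+ k]ger0_norm// -modulus_real -modulusX -modulusM mulrC.
  apply: (modulus_cvg_le (N := 0%N) (ccvgZ (r%:C ^+ k) (ea k))) => n _.
  by rewrite modulusM modulusX modulus_real ger0_norm// mulrC ce.
have geom r : 0 <= r < 1 -> exists r' q : R, [/\ 0 < r' < 1, 0 <= q < 1 & r = q * r'].
  move=> /andP[r0 r1]; exists ((1 + r) / 2), (r / ((1 + r) / 2)).
  have rr : 0 < (1 + r) / 2 by lra.
  rewrite divfK ?gt_eqF// rr; split=> //; first by lra.
  by rewrite divr_ge0 ?(ltW rr)//= ltr_pdivrMr//; lra.
have geomcv c q : 0 <= q < 1 -> cvgn (series (geometric c q : R^nat)).
  by move=> /andP[q0 q1]; apply: is_cvg_geometric_series; rewrite ger0_norm.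
have aH : pseries a (powersum a) 1.
  apply: powersumP => r r01; have [r' [q [/andP[r'0 r'1] q01 rE]]] := geom r r01.
  apply: series_le_cvg (geomcv (B r') q q01) => n.
  - by rewrite psnorm_ge0//; case/andP: r01.
  - by rewrite mulr_ge0 ?exprn_ge0//; case/andP: q01.
  rewrite /psnorm /geometric /= rE exprMn mulrCA mulrC.
  apply: ler_wpM2r; first by rewrite exprn_ge0//; case/andP: q01.
  by apply: ca; rewrite (ltW r'0).
have unif rho eps : 0 < rho < 1 -> 0 < eps -> \forall n \near \oo,
    forall w, modulus w <= rho -> modulus (h (phi n) w - powersum a w) <= eps.
  move=> /andP[rho0 rho1] eps0.
  have rho01 : 0 <= rho < 1 by rewrite ltW.
  have [r' [q [/andP[r'0 r'1] q01 rE]]] := geom rho rho01.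
  have [q0 q1] := andP q01.
  have /cvgrPdist_le /(_ (eps / 2)) := tail_cvg0 (geomcv (2 * B r') q q01).
  rewrite divr_gt0// => /(_ isT) [N _ /(_ N (leqnn N))].
  rewrite sub0r normrN => /(le_trans (ler_norm _)) tN.
  have S0 := sum_cvg0 N ea.
  have /cvgrPdist_le /(_ (eps / 2)) := S0.
  rewrite divr_gt0// => /(_ isT); apply: filterS => n.
  rewrite sub0r normrN => /(le_trans (ler_norm _)) sN w wrho.
  have /sums_toP D := pseriesB (eh (phi n)) aH (le_lt_trans wrho rho1).
  apply: (modulus_cvg_le (N := N) D) => K NK.
  pose c k := (e (phi n) k - a k) * w ^+ k.
  have wk k : modulus w ^+ k <= rho ^+ k.
    by rewrite lerXn2r// nnegrE ?modulus_ge0// ltW.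
  rewrite -(big_mkord xpredT c) (big_cat_nat _ NK)//= big_mkord.
  rewrite (le_trans (modulusD _ _))//.
  have -> : eps = eps / 2 + eps / 2 by field.
  apply: lerD.
    apply: le_trans sN; rewrite (le_trans (modulus_sum _ _ _))//.
    apply: ler_sum => k _; rewrite /c modulusM modulusX ler_piMr ?modulus_ge0//.
    by rewrite (le_trans (wk k))// exprn_ile1// ltW.
  apply: le_trans tN; rewrite (le_trans (modulus_sum _ _ _))//.
  apply: (@le_trans _ _ (\sum_(N <= k < K) geometric (2 * B r') q k)); last first.
    apply: sum_le_tail; last exact: geomcv.
    by move=> k; rewrite /geometric /= mulr_ge0 ?exprn_ge0// mulr_ge0.
  apply: ler_sum => k _; rewrite /c modulusM modulusX /geometric /=.
  apply: (@le_trans _ _ ((modulus (e (phi n) k) + modulus (a k)) * rho ^+ k)).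
    apply: ler_pM; rewrite ?modulus_ge0 ?exprn_ge0 ?modulus_ge0//.
    by rewrite (le_trans (modulusD _ _))// modulusN.
  rewrite rE exprMn mulrCA mulrC; apply: ler_wpM2r; first exact: exprn_ge0.
  rewrite mulrDl mulrDl mul1r.
  by apply: lerD; [apply: ce|apply: ca]; rewrite (ltW r'0).
exists phi, a, (powersum a); split=> // w w1.
apply/ler_addgt0Pr => eps eps0.
have [rho [rho0 rho1 wrho]] : exists rho, [/\ 0 < rho, rho < 1 & modulus w <= rho].
  by have w0 := modulus_ge0 w; exists ((1 + modulus w) / 2); split; lra.
have [|N _ /(_ N (leqnn N)) HN] := unif rho eps _ eps0; first by rewrite rho0.
have := HN w wrho; have := hM (phi N) w w1.
have := modulusB_ge (powersum a w) (powersum a w - h (phi N) w).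
rewrite opprB addrCA subrr addr0 modulusBC.
by move=> h1 h2 h3; move: h1 h2 h3; lra.
Qed.

End montel.

(** * Vanishing Carleson measures give compact operators *)

Section sufficiency.
Variable R : realType.
Variable mu : {finite_measure set (measurableTypeR R) -> \bar R}.
Implicit Types (e : nat -> R[i]) (h f F : R[i] -> R[i]) (z w : R[i]).

Lemma cesaro_likeE f z :
  cesaro_like mu f z = powersum (cesaro_coef mu (taylor_coef f)) z.
Proof. by []. Qed.

(** When [f] has no expansion on the whole disk its coefficients are zero by
    convention, so the operator sees the zero function. *)
Lemma taylor_model f : exists h, pseries (taylor_coef f) h 1 /\ (h = f \/ h = fun=> 0).
Proof.
have [[a af]|nf] := pselect (exists a, pseries a f 1).
  exists f; split; last by left.
  exact: (xgetPex (P := [set a | pseries a f 1]) (fun=> 0) (ex_intro _ a af)).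
exists (fun=> 0); split; last by right.
have -> : taylor_coef f = fun=> 0.
  by apply: xgetPN => a fa; apply: nf; exists a.
move=> z _; apply/sums_toP.
under eq_fun do under eq_bigr do rewrite mul0r.
by under eq_fun do rewrite big1 // subr0 modulus0; exact: cvg_cst.
Qed.

Lemma tent_norm_ge0 (zeta p alpha : R) F : (0 <= tent_norm zeta p alpha F)%E.
Proof. exact: poweR_ge0. Qed.

Lemma ecvg0 (u : nat -> \bar R) :
  (forall eps : R, 0 < eps -> \forall n \near \oo, (0 <= u n <= eps%:E)%E) ->
  u n @[n --> \oo] --> 0%E.
Proof.
move=> Hu; apply/fine_cvgP; split.
  apply: filterS (Hu 1 ltr01) => n /andP[u0 u1].
  by rewrite ge0_fin_numE// (le_lt_trans u1)// ltry.
apply/cvgrPdist_le => eps eps0; apply: filterS (Hu eps eps0) => n /andP[u0 ue].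
rewrite sub0r normrN /= ger0_norm ?fine_ge0// -lee_fin fineK//.
by rewrite ge0_fin_numE// (le_lt_trans ue)// ltry.
Qed.

Lemma pseries_measurable_on_disk e h : pseries e h 1 -> measurable_on_disk h.
Proof. by move=> eh; exact: pseries_measurable eh. Qed.

Lemma exists_exponent (alpha : R) : - 2 < alpha ->
  exists beta : R, [/\ 0 < beta, beta < 1 & beta < alpha + 2].
Proof.
move=> a2; exists (Num.min (1 / 2) ((alpha + 2) / 2)).
have m0 : 0 < Num.min (1 / 2) ((alpha + 2) / 2).
  by rewrite lt_min; apply/andP; split; lra.
have m1 : Num.min (1 / 2) ((alpha + 2) / 2) <= 1 / 2 by rewrite ge_min lexx.
have m2 : Num.min (1 / 2) ((alpha + 2) / 2) <= (alpha + 2) / 2.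
  by rewrite ge_min lexx orbT.
by split; lra.
Qed.

(** The term [sig / (1 - rho)] comes from [`[0, rho[], where [h] is evaluated on
    a compact set, and [M * eps] from [`[rho, 1[], where [mu] is small. *)
Lemma cesaro_norm_le (zeta p alpha : R) : 1 <= p -> 1 / 2 < zeta -> - 2 < alpha ->
  exists2 K : R, 0 < K & forall e h F (M rho sig eps : R),
    0 <= M -> 0 < rho < 1 -> 0 <= eps -> 0 <= sig -> carleson_from mu rho eps ->
    pseries e h 1 -> growth_bound ((alpha + 2) / p) M h ->
    (forall w, modulus w <= rho -> modulus (h w) <= sig) ->
    (forall z, disk z -> F z = powersum (cesaro_coef mu e) z) ->
    (tent_norm zeta p alpha F <= (K * (sig / (1 - rho) + M * eps))%:E)%E.
Proof.
move=> p1 z2 a2; have p0 : 0 < p by lra.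
have [beta [b0 b1 ba]] := exists_exponent a2.
have bp0 : 0 < beta / p by rewrite divr_gt0.
have bp1 : beta / p < 1 by rewrite ltr_pdivrMr// mul1r; lra.
have m0 : 0 <= fine (mu `[0, 1[%classic) by apply: fine_ge0; exact: measure_ge0.
have := ltW (near_const_gt0 bp1); have := ltW (far_const_gt0 bp0).
have absorb (A D G X Y : R) : 0 <= A -> 0 <= D -> 0 <= G -> 0 <= X -> 0 <= Y ->
    (A * X + D * Y) * G <= ((A + D) * G + 1) * (X + Y).
  move=> A0 D0 G0 X0 Y0.
  have := mulr_ge0 (mulr_ge0 A0 Y0) G0; have := mulr_ge0 (mulr_ge0 D0 X0) G0.
  by move=> ? ?; nra.
pose L := (6 * box_const beta / pi) `^ p^-1.
have L0 : 0 <= L by exact: powR_ge0.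
move En : (near_const (beta / p)) => n; move Ef : (far_const (beta / p)) => f f0 n0.
pose U := 2 `^ (beta / p) * fine (mu `[0, 1[%classic).
pose V := 2 `^ ((alpha + 2 - beta) / p) * (2 * n + f).
have U0 : 0 <= U by rewrite mulr_ge0 ?powR_ge0.
have V0 : 0 <= V by rewrite mulr_ge0 ?powR_ge0// addr_ge0// mulr_ge0.
exists ((U + V) * L + 1).
  by rewrite ltr_wpDl// mulr_ge0// addr_ge0.
move=> e h F M rho sig eps M0 rho01 eps0 sig0 Hmu eh hM hs FE.
have bb : 0 < beta < 1 by rewrite b0.
have r1 : 0 <= (1 - rho)^-1 by case/andP: rho01 => _ ?; rewrite invr_ge0 subr_ge0 ltW.
have X0 : 0 <= sig / (1 - rho) by rewrite mulr_ge0.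
have Y0 : 0 <= M * eps by rewrite mulr_ge0.
pose c := U * (sig / (1 - rho)) + V * (M * eps).
have c0 : 0 <= c by rewrite addr_ge0// mulr_ge0.
have Fc z : disk z -> modulus (F z) <= c * majorant p alpha beta z.
  move=> z1; rewrite FE//.
  have := cesaro_majorant p1 b0 b1 ba M0 rho01 eps0 sig0 Hmu eh hM hs z1.
  rewrite En Ef => /le_trans; apply; rewrite le_eqVlt; apply/orP; left; apply/eqP.
  congr (_ * _); rewrite /c /U /V.
  move: (2 `^ (beta / p)) (2 `^ _) (fine _) (1 - rho)^-1 => A D E G; ring.
have := tent_norm_le p1 z2 bb c0 Fc; rewrite -/L => /le_trans; apply.
rewrite lee_fin; exact: absorb.
Qed.

Section vanishing.
Variables zeta p alpha : R.
Hypotheses (p1 : 1 <= p) (z2 : 1 / 2 < zeta) (a2 : - 2 < alpha).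
Hypothesis vmu : vanishing_carleson mu.
Let s := (alpha + 2) / p.

Lemma growth_bound_ball (M rho : R) h w : 0 <= M -> 0 < rho < 1 ->
  growth_bound s M h -> modulus w <= rho -> modulus (h w) <= M * (1 - rho) `^ (- s).
Proof.
move=> M0 /andP[rho0 rho1] hM wrho.
apply: le_trans (hM w (le_lt_trans wrho rho1)) _; rewrite ler_wpM2l//.
have s0 : 0 <= s.
  apply: divr_ge0; last exact: le_trans ler01 p1.
  by rewrite -lerBlDr sub0r ltW.
by apply: powRN_le => //; rewrite ?subr_gt0 ?lerD2l ?lerN2.
Qed.

(** The estimate applies with any constant, say [1], in the Carleson condition. *)
Lemma cesaro_AT e h (M : R) : 0 <= M -> pseries e h 1 -> growth_bound s M h ->
  AT zeta p alpha (powersum (cesaro_coef mu e)).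
Proof.
move=> M0 eh hM; have ce := cesaro_pseries (mu := mu) eh.
have [rho rho01 Hmu] := vanishing_carleson_from ltr01 vmu.
split; last exact: pseries_analytic ce.
split; first exact: pseries_measurable_on_disk ce.
have [K _ HK] := cesaro_norm_le p1 z2 a2.
have sig0 : 0 <= M * (1 - rho) `^ (- s) by rewrite mulr_ge0 ?powR_ge0.
apply: le_lt_trans (HK e h _ M rho _ 1 M0 rho01 ler01 sig0 Hmu eh hM _ _) _ => //.
  by move=> w; exact: growth_bound_ball.
exact: ltry.
Qed.

(** The functions of [taylor_model] inherit the growth of bounded functions. *)
Lemma model_growth : exists2 C : R, 0 < C & forall f (M : R), 0 <= M ->
  (tent_norm zeta p alpha f <= M%:E)%E ->
  exists2 h, pseries (taylor_coef f) h 1 & growth_bound s (C * M) h.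
Proof.
have [C C0 HC] := growth_disk p1 z2 a2.
exists C => // f M M0 fM; have [h [hf hE]] := taylor_model f.
exists h => //; case: hE hf => -> hf w w1; first exact: HC hf fM w w1.
by rewrite modulus0 !mulr_ge0 ?powR_ge0// ltW.
Qed.

Lemma cesaro_like_AT f : AT zeta p alpha f -> AT zeta p alpha (cesaro_like mu f).
Proof.
move=> [[_ fN] _]; have [C C0 HC] := model_growth.
have fM : tent_norm zeta p alpha f = (fine (tent_norm zeta p alpha f))%:E.
  by rewrite fineK// ge0_fin_numE// tent_norm_ge0.
have M0 : 0 <= fine (tent_norm zeta p alpha f) by rewrite fine_ge0// tent_norm_ge0.
have [|h hf hM] := HC f _ M0; first by rewrite -fM.
by apply: (cesaro_AT _ hf hM); rewrite mulr_ge0// ltW.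
Qed.

Lemma powersum_cesaroB e a h H z : pseries e h 1 -> pseries a H 1 -> disk z ->
  powersum (cesaro_coef mu e) z - powersum (cesaro_coef mu a) z =
  powersum (cesaro_coef mu (fun n => e n - a n)) z.
Proof.
move=> eh aH z1.
rewrite -(pseries_powersum (pseriesB (cesaro_pseries (mu := mu) eh) (cesaro_pseries (mu := mu) aH)) z1).
congr (powersum _ z); apply/funext => n.
by rewrite /cesaro_coef sumrB mulrBr.
Qed.

(** Along a subsequence the differences to the limit are small on a disk of
    radius [rho] and of bounded growth, which is what [cesaro_norm_le] turns into
    a small norm once [rho] is chosen for a small [eps]. *)
Lemma vanishing_compact :
  compact_operator (AT zeta p alpha) (tent_norm zeta p alpha) (cesaro_like mu).
Proof.
split; first exact: cesaro_like_AT.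
move=> f fAT [M0 fM0].
have [M [M_ge0 fM]] : exists M : R, 0 <= M /\ forall n, (tent_norm zeta p alpha (f n) <= M%:E)%E.
  exists (Num.max 0 M0); split; first by rewrite le_max lexx.
  by move=> n; rewrite (le_trans (fM0 n))// lee_fin le_max lexx orbT.
have [C C0 HC] := model_growth.
have /choice [h Hh] : forall n, exists h,
    pseries (taylor_coef (f n)) h 1 /\ growth_bound s (C * M) h.
  by move=> n; have [h h1 h2] := HC _ _ M_ge0 (fM n); exists h.
have CM0 : 0 <= C * M by rewrite mulr_ge0// ltW.
have [phi [a [H [phi_lt aH HM unif]]]] :=
  montel CM0 (fun n => (Hh n).1) (fun n => (Hh n).2).
exists phi, (powersum (cesaro_coef mu a)); split=> //; first exact: cesaro_AT aH HM.
have [K K0 HK] := cesaro_norm_le p1 z2 a2.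
apply: ecvg0 => eps eps0.
pose eps1 := eps / (K * (1 + 2 * (C * M))).
have D0 : 0 < K * (1 + 2 * (C * M)).
  by rewrite mulr_gt0// ltr_pwDl// mulr_ge0.
have eps10 : 0 < eps1 by rewrite divr_gt0.
have [rho rho01 Hmu] := vanishing_carleson_from eps10 vmu.
have rho1 : 0 < 1 - rho by rewrite subr_gt0; case/andP: rho01.
have se0 : 0 < eps1 * (1 - rho) by rewrite mulr_gt0.
apply: filterS (unif rho _ rho01 se0) => n Hn; rewrite tent_norm_ge0 /=.
have [hn hnM] := Hh (phi n).
have dM : growth_bound s (2 * (C * M)) (fun z => h (phi n) z - H z).
  move=> w w1; rewrite (le_trans (modulusD _ _))// modulusN.
  by rewrite -mulrA mulrDl mul1r lerD ?hnM ?HM.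
have CM20 : 0 <= 2 * (C * M) by rewrite mulr_ge0.
have := HK _ _ (fun z => cesaro_like mu (f (phi n)) z - powersum (cesaro_coef mu a) z)
  _ _ _ _ CM20 rho01 (ltW eps10) (ltW se0) Hmu (pseriesB hn aH) dM Hn.
move=> /(_ _)/le_trans; apply; first by move=> z z1; exact: powersum_cesaroB hn aH z1.
rewrite lee_fin mulfK ?gt_eqF// le_eqVlt; apply/orP; left; apply/eqP.
have -> : K * (eps1 + 2 * (C * M) * eps1) = eps1 * (K * (1 + 2 * (C * M))).
  by move: eps1 {eps10 Hmu se0 Hn} => ?; ring.
by rewrite divfK ?gt_eqF.
Qed.

End vanishing.
End sufficiency.

(** * Test functions *)

Section test_functions.
Variable R : realType.
Variable mu : {finite_measure set (measurableTypeR R) -> \bar R}.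
Implicit Types (e : nat -> R[i]) (h f F : R[i] -> R[i]) (z w : R[i]).

Lemma complexR_neq0 z (x : R) : modulus z < 1 -> 0 <= x <= 1 -> 1 - x%:C * z != 0.
Proof.
move=> z1 /andP[x0 x1]; have z0 := modulus_ge0 z.
rewrite -modulus_gt0 (lt_le_trans _ (modulusB_ge _ _))// modulus1.
by rewrite modulusM modulus_real ger0_norm// subr_gt0; nra.
Qed.

Lemma binomial_series (x : R) m : 0 <= x <= 1 -> exists2 r : nat -> R,
  (forall n, 0 <= r n) &
  pseries (fun n => (r n)%:C) (fun z => (1 - x%:C * z) ^- m) 1.
Proof.
move=> /andP[x0 x1]; elim: m => [|m [r r0 Hr]].
  exists (fun n => (n == 0%N)%:R) => [n|z _]; first exact: ler0n.
  apply/sums_toP; apply/cvg0_shiftS.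
  have E n : \sum_(k < n.+1) ((k == 0%N :> nat)%:R)%:C * z ^+ k = 1 :> R[i].
    rewrite big_ord_recl big1 => [|i _]; last by rewrite mul0r.
    by rewrite addr0 expr0 mulr1.
  by under eq_fun do rewrite E expr0 invr1 subrr modulus0; exact: cvg_cst.
exists (fun n => \sum_(k < n.+1) r k * x ^+ (n - k)) => [n|].
  by apply: sumr_ge0 => k _; rewrite mulr_ge0 ?exprn_ge0.
have x1' : modulus (x%:C : R[i]) <= 1 by rewrite modulus_real ger0_norm.
have := pseries_geo Hr x1'; rewrite (_ : geo_coef _ _ =
    fun n => (\sum_(k < n.+1) r k * x ^+ (n - k))%:C); last first.
  apply/funext => n; rewrite /geo_coef rmorph_sum; apply: eq_bigr => k _.
  by rewrite rmorphM rmorphXn.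
by apply: pseries_eq => z z1; rewrite exprS invfM mulrC.
Qed.

(** A peak at [1]: of size [(1 - x) `^ (- s)] at distance [1 - x] to [1], the
    largest size that a bounded norm allows for [s = (alpha + 2) / p], and
    negligible elsewhere when [m] exceeds [s]. *)
Definition test_fun (s : R) m (x : R) z : R[i] :=
  ((1 - x) `^ (m%:R - s))%:C * (1 - x%:C * z) ^- m.

Lemma test_fun_series (s : R) m (x : R) : 0 <= x <= 1 -> exists2 r : nat -> R,
  (forall n, 0 <= r n) & pseries (fun n => (r n)%:C) (test_fun s m x) 1.
Proof.
move=> x01; have [r r0 Hr] := binomial_series m x01.
exists (fun n => (1 - x) `^ (m%:R - s) * r n) => [n|z z1].
  by rewrite mulr_ge0 ?powR_ge0.
apply/sums_toP; have /sums_toP := Hr z z1.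
move=> /(ccvgZ ((1 - x) `^ (m%:R - s))%:C).
under [in X in X -> _]eq_fun do rewrite mulr_sumr.
under [in X in _ -> X]eq_fun do under eq_bigr do rewrite rmorphM -mulrA.
by [].
Qed.

Lemma modulus_test_fun s m x z : modulus (test_fun s m x z) =
  (1 - x) `^ (m%:R - s) / modulus (1 - x%:C * z) ^+ m.
Proof.
by rewrite /test_fun modulusM modulusV modulusX modulus_real ger0_norm ?powR_ge0.
Qed.

Lemma dist_pole_ge (x : R) z : modulus z < 1 -> 0 <= x < 1 ->
  1 - x <= modulus (1 - x%:C * z) /\ modulus (1 - z) <= 2 * modulus (1 - x%:C * z).
Proof.
move=> z1 /andP[x0 x1]; have z0 := modulus_ge0 z.
have h : 1 - x * modulus z <= modulus (1 - x%:C * z).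
  by have := modulusB_ge 1 (x%:C * z); rewrite modulus1 modulusM modulus_real ger0_norm.
split; first by nra.
have := modulusB_triangle (x%:C * z) 1 z.
have -> : x%:C * z - z = - ((1 - x)%:C * z) by rewrite rmorphB mulrBl mul1r opprB.
by rewrite modulusN modulusM modulus_real gtr0_norm ?subr_gt0// => ?; nra.
Qed.

(** The pole [1 / x] is outside the disk, so that [1] is at most twice as far
    from [z] as the pole is. *)
Lemma test_fun_le (s x : R) m z : 0 <= s <= m%:R -> modulus z < 1 -> 0 <= x < 1 ->
  modulus (test_fun s m x z) <= 2 `^ s * modulus (1 - z) `^ (- s).
Proof.
move=> /andP[s0 sm] z1 x01; have [h1 h2] := dist_pole_ge z1 x01.
have [x0 x1] := andP x01.
have k0 : 0 < modulus (1 - x%:C * z) by lra.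
have d0 : 0 < modulus (1 - z) by exact: modulus_1B_gt0.
rewrite modulus_test_fun.
apply: (@le_trans _ _ (modulus (1 - x%:C * z) `^ (- s))).
  rewrite ler_pdivrMr ?exprn_gt0// -powR_mulrn ?modulus_ge0// -powRDgt0//.
  by rewrite [- s + _]addrC ge0_ler_powR ?nnegrE ?subr_ge0 ?modulus_ge0// ltW.
exact: powRN_le2.
Qed.

Lemma test_fun_majorant (p alpha beta x : R) m z : 0 < p -> 0 < beta ->
  beta < alpha + 2 -> (alpha + 2) / p <= m%:R -> modulus z < 1 -> 0 <= x < 1 ->
  modulus (test_fun ((alpha + 2) / p) m x z) <=
  2 `^ ((alpha + 2) / p) * 2 `^ ((alpha + 2 - beta) / p) * majorant p alpha beta z.
Proof.
move=> p0 b0 ba sm z1 x01; have z0 := modulus_ge0 z.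
have s0 : 0 <= (alpha + 2) / p by apply: divr_ge0; lra.
have [a [a0 aE]] : exists a : R, 0 < a /\ a = (alpha + 2 - beta) / p.
  by exists ((alpha + 2 - beta) / p); rewrite divr_gt0// subr_gt0.
apply: le_trans (test_fun_le _ z1 x01) _; first by rewrite s0.
rewrite -mulrA ler_wpM2l ?powR_ge0// /majorant -aE.
have dl0 : 0 < modulus (1 - z) by exact: modulus_1B_gt0.
have -> : - ((alpha + 2) / p) = - a + - (beta / p) by rewrite aE; ring.
rewrite powRDgt0// mulrA ler_wpM2r ?powR_ge0//.
have D0 : 0 < 1 - modulus z ^+ 2 by rewrite subr_gt0 expr_lt1.
apply: powRN_le2 => //; first exact: ltW.
by have := modulusB_ge 1 z; rewrite modulus1; nra.
Qed.

Lemma taylor_coef_eq e h : pseries e h 1 -> taylor_coef h = e.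
Proof.
move=> eh; apply/funext.
apply: (pseries_unique ltr01 _ eh).
exact: (xgetPex (P := [set a | pseries a h 1]) (fun=> 0) (ex_intro _ e eh)).
Qed.

(** The test functions are small on the segment from [0] to [z]. *)
Lemma cesaro_test_le (s : R) m (x : R) z : 0 <= x < 1 -> modulus z < 1 ->
  modulus (cesaro_like mu (test_fun s m x) z) <=
  (1 - x) `^ (m%:R - s) * ((1 - modulus z) ^- m.+1 * fine (mu `[0, 1[%classic)).
Proof.
move=> /andP[x0 x1] z1; have z0 := modulus_ge0 z.
have x01 : 0 <= x <= 1 by rewrite x0 ltW.
have [r r0 Hr] := test_fun_series s m x01.
have mI : measurable (`[0, 1[%classic : set (measurableTypeR R)) by exact: measurable_itv.
rewrite cesaro_likeE (taylor_coef_eq Hr) -lee_fin.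
apply: le_trans (cesaro_le mu Hr z1) _.
rewrite mulrA EFinM fineK ?fin_num_measure//.
rewrite -integral_cst//; apply: le_integral_ge0 => t.
- by rewrite lee_fin divr_ge0 ?modulus_ge0.
- by rewrite lee_fin mulr_ge0 ?powR_ge0// invr_ge0 exprn_ge0// subr_ge0 ltW.
move=> tI; split=> //; move: tI; rewrite /= in_itv /= => /andP[t0 t1].
have d0 : 0 < 1 - modulus z by rewrite subr_gt0.
have low (y : R) : 0 <= y <= 1 -> 1 - modulus z <= modulus (1 - y%:C * z).
  move=> /andP[y0 y1]; have := modulusB_ge 1 (y%:C * z).
  by rewrite modulus1 modulusM modulus_real ger0_norm// => ?; nra.
rewrite lee_fin modulus_test_fun -mulrA ler_wpM2l ?powR_ge0//.
rewrite -invfM exprSr lef_pV2 ?posrE.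
- apply: ler_pM; rewrite ?exprn_ge0 ?(ltW d0)//; last by apply: low; rewrite t0 ltW.
  rewrite lerXn2r ?nnegrE ?modulus_ge0 ?(ltW d0)//.
  rewrite mulrA -rmorphM; apply: low; nra.
- apply: mulr_gt0; last by rewrite modulus_gt0 complexR_neq0// t0 ltW.
  rewrite exprn_gt0// modulus_gt0 mulrA -rmorphM complexR_neq0//; nra.
- by rewrite -exprSr exprn_gt0.
Qed.

(** All terms being nonnegative, each moment may be replaced by its lower bound
    in [moment_ge_tail]; the factor [x ^ n] of that bound turns the point of
    evaluation [x] into [x ^ 2]. *)
Lemma cesaro_ge (r : nat -> R) h (x : R) : (forall n, 0 <= r n) ->
  pseries (fun n => (r n)%:C) h 1 -> 0 <= x < 1 ->
  fine (mu [set` `[x, 1[]) * complex.Re (h (x ^+ 2)%:C / (1 - (x ^+ 2)%:C)) <=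
  modulus (powersum (cesaro_coef mu (fun n => (r n)%:C)) x%:C).
Proof.
move=> r0 Hr x01; have [x0 x1] := andP x01.
have mx : modulus (x%:C : R[i]) < 1 by rewrite modulus_real ger0_norm.
have mx2 : modulus ((x ^+ 2)%:C : R[i]) < 1.
  by rewrite modulus_real ger0_norm ?exprn_ge0// expr_lt1.
have m1 : modulus (1 : R[i]) <= 1 by rewrite modulus1.
have /sums_toP /ccvg_Re S1 := cesaro_pseries (mu := mu) Hr mx.
have /sums_toP /ccvg_Re S2 := pseries_geo Hr m1 mx2.
rewrite mul1r in S2.
apply: le_trans (le_trans (ler_norm _) (normr_Re_le _)).
set tau := fine _.
have S3 : tau * complex.Re (\sum_(k < n) geo_coef (fun n => (r n)%:C) 1 k * (x ^+ 2)%:C ^+ k)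
    @[n --> \oo] --> tau * complex.Re (h (x ^+ 2)%:C / (1 - (x ^+ 2)%:C)).
  by apply: cvgM => //; exact: cvg_cst.
apply: ler_cvg_to S3 S1 _; apply: nearW => N.
rewrite !Re_sum mulr_sumr; apply: ler_sum => n _.
rewrite geo_coef1 /cesaro_coef -rmorph_sum -!rmorphXn -!rmorphM /=.
rewrite -exprM mulnC mulrCA [leRHS]mulrAC mulrC exprM expr2 mulrA.
have G0 : 0 <= \sum_(k < n.+1) r k by apply: sumr_ge0.
have := moment_ge_tail mu n x01; rewrite -/tau => Hm.
apply: ler_wpM2r => //; apply: ler_wpM2r; first exact: exprn_ge0.
by rewrite mulrC.
Qed.

Lemma pole_ratio_le (T P Q Y D d : R) : 0 < T -> 0 < P -> 0 < Q -> 0 <= Y ->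
  0 < D -> 0 < d -> D <= 2 * d -> Q <= T * P ->
  d^-1 * ((2 * T)^-1 * Y) <= P * (Y * (Q^-1 / D)).
Proof.
move=> T0 P0 Q0 Y0 D0 d0 DE QE.
have -> : d^-1 * ((2 * T)^-1 * Y) = P * (Y * ((T * P)^-1 * (2 * d)^-1)).
  by field; rewrite !gt_eqF.
apply: ler_wpM2l; first exact: ltW.
apply: ler_wpM2l => //; apply: ler_pM; rewrite ?invr_ge0 ?mulr_ge0 ?(ltW T0) ?(ltW P0) ?(ltW d0)//.
  by rewrite lef_pV2 ?posrE// mulr_gt0.
by rewrite lef_pV2 ?posrE// mulr_gt0.
Qed.

(** At [x ^ 2] the three quantities [1 - x ^ 3], [1 - x ^ 2] and [1 - x] are
    comparable. *)
Lemma cesaro_test_ge (s : R) m (x : R) : 0 <= x < 1 ->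
  fine (mu [set` `[x, 1[]) / (1 - x) / (2 * 3 ^+ m) * (1 - x) `^ (- s) <=
  modulus (cesaro_like mu (test_fun s m x) x%:C).
Proof.
move=> x01; have [x0 x1] := andP x01.
have x01' : 0 <= x <= 1 by rewrite x0 ltW.
have [r r0 Hr] := test_fun_series s m x01'.
rewrite cesaro_likeE (taylor_coef_eq Hr); apply: le_trans (cesaro_ge r0 Hr x01).
have -> : test_fun s m x (x ^+ 2)%:C / (1 - (x ^+ 2)%:C) =
    ((1 - x) `^ (m%:R - s) / (1 - x ^+ 3) ^+ m / (1 - x ^+ 2))%:C.
  have c1 (y : R) : 1 - y%:C = (1 - y)%:C by rewrite rmorphB rmorph1.
  by rewrite /test_fun -rmorphM -exprS !c1 -rmorphXn -!fmorphV -!rmorphM.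
rewrite /=; set A := fine _; have A0 : 0 <= A by rewrite fine_ge0// measure_ge0.
rewrite -!mulrA; apply: ler_wpM2l => //.
have x10 : 0 < 1 - x by rewrite subr_gt0.
have x20 : 0 < 1 - x ^+ 2 by rewrite subr_gt0 expr_lt1.
have x30 : 0 < 1 - x ^+ 3 by rewrite subr_gt0 expr_lt1.
rewrite powRDgt0// powR_mulrn ?(ltW x10)//.
have h3 : (1 - x ^+ 3) ^+ m <= 3 ^+ m * (1 - x) ^+ m.
  rewrite -exprMn lerXn2r ?nnegrE ?(ltW x30)//; first by rewrite mulr_ge0// ltW.
  by rewrite -subr_ge0 (_ : _ - _ = (1 - x) ^+ 2 * (x + 2)) ?mulr_ge0 ?exprn_ge0// ?(ltW x10)// ?addr_ge0//; ring.
have h2 : 1 - x ^+ 2 <= 2 * (1 - x) by nra.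
rewrite -[X in _ <= X]mulrA; apply: pole_ratio_le => //; try exact: exprn_gt0.
exact: powR_ge0.
Qed.

End test_functions.

(** * Compact operators have vanishing Carleson measures *)

Section necessity.
Variable R : realType.
Variable mu : {finite_measure set (measurableTypeR R) -> \bar R}.
Variables zeta p alpha : R.
Hypotheses (p1 : 1 <= p) (z2 : 1 / 2 < zeta) (a2 : - 2 < alpha).
Let s := (alpha + 2) / p.

Lemma test_fun_AT m : s <= m%:R -> exists M : R, forall x : R, 0 <= x < 1 ->
  AT zeta p alpha (test_fun s m x) /\ (tent_norm zeta p alpha (test_fun s m x) <= M%:E)%E.
Proof.
move=> sm; have p0 : 0 < p := lt_le_trans ltr01 p1.
have [beta [b0 b1 ba]] := exists_exponent a2.
have bb : 0 < beta < 1 by rewrite b0.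
pose c := 2 `^ s * 2 `^ ((alpha + 2 - beta) / p) : R.
have c0 : 0 <= c by rewrite mulr_ge0 ?powR_ge0.
exists (c * (6 * box_const beta / pi) `^ p^-1) => x x01.
have x01' : 0 <= x <= 1 by case/andP: x01 => -> /ltW.
have N := tent_norm_le p1 z2 bb c0
  (fun z z1 => test_fun_majorant p0 b0 ba sm z1 x01).
have [r _ Hr] := test_fun_series s m x01'.
split=> //; split; last exact: pseries_analytic Hr.
split; first exact: pseries_measurable_on_disk Hr.
by apply: le_lt_trans N _; exact: ltry.
Qed.

(** The explicit rate makes every subsequence of [x] tend to [1]. *)
Lemma not_vanishing : ~ vanishing_carleson mu -> exists (eps : R) (x : nat -> R),
  0 < eps /\ forall n, [/\ 0 <= x n < 1, 1 - x n <= n.+1%:R^-1 &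
    eps <= fine (mu [set` `[x n, 1[]) / (1 - x n)].
Proof.
move=> nv; apply: contrapT => nex; apply: nv.
apply/cvgrPdist_le => eps eps0; apply: contrapT => nnear; apply: nex.
have /choice [x Hx] : forall n, exists x : R, [/\ 0 <= x < 1, 1 - x <= n.+1%:R^-1 &
    eps <= fine (mu [set` `[x, 1[]) / (1 - x)].
  move=> n; apply: contrapT => nx; apply: nnear.
  have n0 : 0 < (n.+1%:R : R)^-1 by rewrite invr_gt0 ltr0n.
  exists n.+1%:R^-1 => //= t /= tn t1; rewrite leNgt; apply/negP => lt_t; apply: nx.
  have t10 : 0 < 1 - t by rewrite subr_gt0.
  have tn' : 1 - t < n.+1%:R^-1 by move: tn; rewrite gtr0_norm.
  have n1 : n.+1%:R^-1 <= 1 :> R by rewrite invf_le1 ?ltr0n// ler1n.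
  have t0 : 0 <= t by have := ltW (lt_le_trans tn' n1); rewrite gerBl.
  exists t; split; [by rewrite t0|exact: ltW|].
  move: lt_t; rewrite sub0r normrN ger0_norm; first exact: ltW.
  by rewrite divr_ge0 ?(ltW t10)// fine_ge0// measure_ge0.
by exists eps, x.
Qed.

Lemma cesaro_test_pseries m x : 0 <= x < 1 -> exists b,
  pseries b (cesaro_like mu (test_fun s m x)) 1.
Proof.
move=> x01; have x01' : 0 <= x <= 1 by case/andP: x01 => -> /ltW.
have [r _ Hr] := test_fun_series s m x01'.
exists (cesaro_coef mu (fun n => (r n)%:C)).
have := cesaro_pseries (mu := mu) Hr; apply: pseries_eq => z _.
by rewrite cesaro_likeE (taylor_coef_eq Hr).
Qed.

(** The growth bound at [z] compares [g] with [F n]. It holds on a disk where [g]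
    has an expansion, of a radius that is not controlled; this costs a factor
    that depends on [z] but not on [n]. *)
Lemma norm_limit_eq0 : exists2 d0 : R, 0 < d0 &
  forall (F : nat -> R[i] -> R[i]) g, @analytic R g ->
  (forall n, exists b, pseries b (F n) 1) ->
  (forall z, disk z -> modulus (F n z) @[n --> \oo] --> 0) ->
  tent_norm zeta p alpha (fun z => F n z - g z) @[n --> \oo] --> 0%E ->
  forall z, 1 - d0 < modulus z < 1 -> g z = 0.
Proof.
have [d0 d00 Hg] := growth alpha p1 z2; exists d0 => // F g ag HF F0 N0 z zd.
have [_ z1] := andP zd; have d0z : 0 < 1 - modulus z by rewrite subr_gt0.
have /analytic_atP [b [rho [rho0 bg]]] := ag z z1.
pose sg := Num.min 1 (rho / (1 - modulus z)).
have sg0 : 0 < sg by rewrite lt_min ltr01 divr_gt0.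
have sg1 : sg <= 1 by rewrite ge_min lexx.
have sgr : sg * (1 - modulus z) <= rho by rewrite -ler_pdivlMr// ge_min lexx orbT.
have [|C C0 HC] := Hg sg; first by rewrite sg0.
have /fine_cvgP [fin Nf] := N0.
apply: modulus_eq0.
have c0 : (fun=> modulus (g z)) @ \oo --> (0 : R).
  apply: (@squeeze0 _ _ (fun n => modulus (F n z) + C * (1 - modulus z) `^ (- s) *
      fine (tent_norm zeta p alpha (fun z => F n z - g z)))); last first.
    by apply: cvg0D; [exact: F0|exact: cvg0Ml].
  apply: filterS fin => n fn; rewrite modulus_ge0 /=.
  have [c Fc] := HF n; have [c' Fc'] := pseries_recenter Fc z1.
  pose rho' := Num.min rho (1 - modulus z).
  have r1 : rho' <= rho by rewrite ge_min lexx.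
  have r2 : rho' <= 1 - modulus z by rewrite ge_min lexx orbT.
  have Fg := pseriesB (pseriesW r2 Fc') (pseriesW r1 bg).
  have rad : sg * ((1 - modulus z) / 4) < rho'.
    rewrite lt_min; apply/andP; split; first by lra.
    have : sg * (1 - modulus z) <= 1 * (1 - modulus z) by rewrite ler_wpM2r// ltW.
    by lra.
  have := HC (fun z => F n z - g z) z _ rho' _ zd Fg rad; rewrite -/s.
  move=> /(_ (fine (tent_norm zeta p alpha (fun z => F n z - g z)))).
  rewrite fineK// => /(_ (lexx _)) h.
  have := modulusB_ge (g z) (g z - F n z); rewrite opprB addrCA subrr addr0.
  rewrite modulusBC => h'.
  by rewrite mulrAC; move: h h'; lra.
exact: (@cvg_unique _ (@Rhausdorff R) _ _ _ _ (@cvg_cst _ (modulus (g z)) _ \oo _) c0).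
Qed.

(** The images of the test functions tend to zero pointwise, hence a norm limit
    vanishes near the circle. The growth bound at the point [x (phi n)], applied
    to the difference that tends to zero in norm, then contradicts the lower
    bound of [cesaro_test_ge]. *)
Lemma compact_vanishing :
  compact_operator (AT zeta p alpha) (tent_norm zeta p alpha) (cesaro_like mu) ->
  vanishing_carleson mu.
Proof.
move=> [_ compactT]; apply: contrapT => /not_vanishing [eps [x [eps0 Hx]]].
have [m sm] : exists m : nat, s + 1 <= m%:R.
  have s0 : 0 <= s.
    by apply: divr_ge0; [rewrite -lerBlDr sub0r ltW|exact: le_trans ler01 p1].
  by exists (Num.bound (s + 1)); rewrite ltW// archi_boundP// addr_ge0.
have sm' : s <= m%:R by lra.
have [M HM] := test_fun_AT sm'.
have x01 n : 0 <= x n < 1 by have [] := Hx n.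
have [|phi [g [phi_lt [_ ag] N0]]] :=
  compactT (fun n => test_fun s m (x n)) (fun n => (HM _ (x01 n)).1).
  by exists M => n; exact: (HM _ (x01 n)).2.
pose F n := cesaro_like mu (test_fun s m (x (phi n))).
have phi_ge n : (n <= phi n)%N.
  by elim: n => // n IHn; exact: leq_ltn_trans IHn (phi_lt _ _ (ltnSn n)).
have xphi : 1 - x (phi n) @[n --> \oo] --> (0 : R).
  apply: squeeze0 (@cvg_harmonic R); apply: nearW => n.
  have [/andP[_ xn1] xn _] := Hx (phi n); rewrite subr_ge0 ltW//=.
  by rewrite (le_trans xn)// lef_pV2 ?posrE ?ltr0n// ler_nat ltnS.
have FP n : exists b, pseries b (F n) 1 by exact: cesaro_test_pseries.
have F0 z : disk z -> modulus (F n z) @[n --> \oo] --> 0.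
  move=> z1; pose Q := (1 - modulus z) ^- m.+1 * fine (mu `[0, 1[%classic).
  apply: squeeze0 (cvg0Ml Q xphi); apply: nearW => n; rewrite modulus_ge0 /=.
  apply: le_trans (cesaro_test_le mu s m (x01 _) z1) _.
  rewrite mulrC ler_wpM2l//.
    rewrite mulr_ge0 ?fine_ge0 ?measure_ge0// invr_ge0 exprn_ge0// subr_ge0.
    exact: ltW.
  have [xn0 xn1] := andP (x01 (phi n)).
  have xn : 0 < 1 - x (phi n) <= 1 by rewrite subr_gt0 xn1 gerBl.
  rewrite -[leRHS]powRr1; last by case/andP: xn => /ltW.
  by apply: ger_powR => //; rewrite lerBrDl.
have [d0 d00 Hg0] := norm_limit_eq0.
have g0 := Hg0 F g ag FP F0 N0.
have [d1 d10 Hgr] := growth alpha p1 z2.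
have [|C C0 HC] := Hgr 1; first by rewrite ltr01 lexx.
pose dl := Num.min (d0 / 2) d1.
have dl0 : 0 < dl by rewrite lt_min d10 divr_gt0.
pose kap := eps / (2 * 3 ^+ m).
have kap0 : 0 < kap by rewrite divr_gt0// mulr_gt0// exprn_gt0.
have /fine_cvgP [fin Nf] := N0.
have lim0 := cvg0Ml C Nf.
have near1 : \forall n \near \oo, 1 - x (phi n) < dl.
  have /cvgrPdist_lt /(_ dl dl0) := xphi; apply: filterS => n.
  by rewrite sub0r normrN; apply: le_lt_trans; exact: ler_norm.
have near2 : \forall n \near \oo, C * fine (tent_norm zeta p alpha
    (fun z => F n z - g z)) < kap.
  have /cvgrPdist_lt /(_ kap kap0) := lim0; apply: filterS => n.
  by rewrite sub0r normrN; apply: le_lt_trans; exact: ler_norm.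
have [n [n1 n2 n3]] : exists n, [/\ 1 - x (phi n) < dl,
    C * fine (tent_norm zeta p alpha (fun z => F n z - g z)) < kap &
    tent_norm zeta p alpha (fun z => F n z - g z) \is a fin_num].
  suff /filter_ex [n [[? ?] ?]] : \forall n \near \oo, (1 - x (phi n) < dl /\
    C * fine (tent_norm zeta p alpha (fun z => F n z - g z)) < kap) /\
    tent_norm zeta p alpha (fun z => F n z - g z) \is a fin_num by exists n.
  by apply: filterI => //; exact: filterI.
set y := x (phi n) in n1; have [y0 y1] := andP (x01 (phi n)).
rewrite -/y in y0 y1.
have [dd0 dd1] : 1 - y < d0 / 2 /\ 1 - y < d1.
  by apply/andP; rewrite -lt_min.
have my : modulus (y%:C : R[i]) = y by rewrite modulus_real ger0_norm.
have [b Fb] := FP n.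
have my1 : modulus (y%:C : R[i]) < 1 by rewrite my.
have [b' Fb'] := pseries_recenter Fb my1; rewrite my in Fb'.
pose rho := Num.min (1 - y) (d0 - (1 - y)).
have r1 : rho <= 1 - y by rewrite ge_min lexx.
have r2 : rho <= d0 - (1 - y) by rewrite ge_min lexx orbT.
have FG : pseries b' (fun v => F n (y%:C + v) - g (y%:C + v)) rho.
  apply: pseries_eq (pseriesW r1 Fb') => v vr; rewrite g0 ?subr0//.
  have := modulusD y%:C v; have := modulusB_ge y%:C (- v).
  by rewrite opprK modulusN my => ? ?; apply/andP; split; lra.
have rad : 1 * ((1 - modulus (y%:C : R[i])) / 4) < rho.
  by rewrite my mul1r lt_min; apply/andP; split; lra.
have yd : 1 - d1 < modulus (y%:C : R[i]) < 1 by rewrite my; apply/andP; split; lra.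
have := HC (fun z => F n z - g z) y%:C _ rho _ yd FG rad; rewrite -/s my.
move=> /(_ (fine (tent_norm zeta p alpha (fun z => F n z - g z)))).
rewrite fineK// => /(_ (lexx _)) /=; rewrite g0; last first.
  by rewrite my; apply/andP; split; lra.
rewrite subr0 => up.
have low := cesaro_test_ge mu s m (x01 (phi n)); rewrite -/(F n) -/y in low.
have [_ _ mass] := Hx (phi n); rewrite -/y in mass.
have pw : 0 < (1 - y) `^ (- s) by rewrite powR_gt0// subr_gt0.
have := le_trans low up; rewrite ler_pM2r// leNgt => /negP; apply.
apply: lt_le_trans n2 _; rewrite /kap ler_wpM2r// invr_ge0 mulr_ge0// exprn_ge0//.
Qed.

End necessity.

Theorem theorem4p8 (R : realType) (zeta p alpha : R)
    (mu : {finite_measure set (measurableTypeR R) -> \bar R})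
    (hzeta : 1 / 2 < zeta) (hp : 1 <= p) (halpha : - 2 < alpha)
    (hmu : mu (~` `[0, 1[) = 0%E) :
  compact_operator (AT zeta p alpha) (tent_norm zeta p alpha) (cesaro_like mu)
  <-> vanishing_carleson mu.
Proof.
split; first exact: compact_vanishing.
exact: vanishing_compact.
Qed.
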